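(* Let $\mathbb F$ be an algebraically closed field of characteristic zero and $n,m,d,k\ge1$. For every linear map $\phi:\mathrm{Ten}(n,d)\to\mathrm{Ten}(m,k)$ such that $a:=\max\{\mathrm{brk}(\phi(s)):s\in S\}\ge1$, where $S$ is the set of rank-one tensors in $\mathrm{Ten}(n,d)$, its border potency satisfies $$\mathrm{Bpot}(\phi)\le k^d\cdot n^{\lfloor (k-1)d/k\rfloor}.$$
   Context: $\mathrm{Ten}(m,k)=(\mathbb F^m)^{\otimes k}$. The border rank $\mathrm{brk}(T)$ of $T\in\mathrm{Ten}(m,k)$ is the least $r$ such that $T$ lies in the Zariski closure of the set of tensors of tensor rank $\le r$. The border potency is $\mathrm{Bpot}(\phi)=\max\{\mathrm{brk}(\phi(T)):T\in\mathrm{Ten}(n,d)\}/a$. *)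

(* Defs.v *)
From HB Require Import structures.
From mathcomp Require Import all_boot all_order all_algebra.
From Stdlib Require Import ClassicalEpsilon.
Set Implicit Arguments. Unset Strict Implicit. Unset Printing Implicit Defensive.
Import Order.TTheory GRing.Theory Num.Theory.
Local Open Scope ring_scope.

(* Ten(m,k) = (F^m)^{(x) k}: functions from multi-indices (i_1,..,i_k), i_j < m, to F. *)
Notation Ten F m k := {ffun k.-tuple 'I_m -> (F%type)^o}.

Definition asbool (P : Prop) : bool :=
  if excluded_middle_informative P then true else false.

Definition decomposable (F : fieldType) (m k : nat) (T : Ten F m k) : Prop :=
  exists v : 'I_k -> 'I_m -> F, T = [ffun i => \prod_(j < k) v j (tnth i j)].

Definition rank_one (F : fieldType) (m k : nat) (T : Ten F m k) : Prop :=
  decomposable T /\ T != 0.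

Definition trank_le (F : fieldType) (m k : nat) (r : nat) (T : Ten F m k) : Prop :=
  exists t : 'I_r -> Ten F m k, (forall i, decomposable (t i)) /\ T = \sum_(i < r) t i.

Definition coords (F : fieldType) (m k : nat) (T : Ten F m k) : seq F :=
  [seq T i | i : k.-tuple 'I_m].

(* Zariski closure: T lies in the closure of A iff every polynomial
   (formal ring term without inverses) vanishing on A vanishes at T. *)
Definition zariski_closure (F : fieldType) (m k : nat)
    (A : Ten F m k -> Prop) (T : Ten F m k) : Prop :=
  forall p : GRing.term F, GRing.rterm p ->
    (forall U, A U -> GRing.eval (coords U) p = 0) ->
    GRing.eval (coords T) p = 0.

Definition brk_le (F : fieldType) (m k : nat) (r : nat) (T : Ten F m k) : Prop :=
  zariski_closure (trank_le r) T.

(* Border rank: least r with T in the closure of tensors of rank <= r.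
   Every T in Ten(m,k) has rank <= m^k, so the search over 0..m^k suffices. *)
Definition brk (F : fieldType) (m k : nat) (T : Ten F m k) : nat :=
  find (fun r => asbool (brk_le r T)) (iota 0 (m ^ k).+1).

(* Maximum of a set of naturals known to be bounded by B (0 if empty). *)
Definition supnat (P : nat -> Prop) (B : nat) : nat :=
  \max_(r < B.+1 | asbool (P r)) r.

Definition rank_one_brk_max (F : fieldType) (n d m k : nat)
    (phi : {linear Ten F n d -> Ten F m k}) : nat :=
  supnat (fun r => exists s, rank_one s /\ brk (phi s) = r) (m ^ k).

Definition image_brk_max (F : fieldType) (n d m k : nat)
    (phi : {linear Ten F n d -> Ten F m k}) : nat :=
  supnat (fun r => exists T, brk (phi T) = r) (m ^ k).

Definition Bpot (F : fieldType) (n d m k : nat)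
    (phi : {linear Ten F n d -> Ten F m k}) : rat :=
  (image_brk_max phi)%:R / (rank_one_brk_max phi)%:R.

(* Main.v *)
From HB Require Import structures.
From mathcomp Require Import all_boot all_order all_algebra.
From mathcomp Require Import boolp mpoly ring zify.
Require Import Defs.
Set Implicit Arguments. Unset Strict Implicit. Unset Printing Implicit Defensive.
Import Order.TTheory GRing.Theory Num.Theory.
Local Open Scope ring_scope.

(* The coordinates of phi(x_1 (x) ... (x) x_d) are multilinear forms in the vectors x_i, and by
   hypothesis this tensor is a limit of sums of a decomposable tensors.  The limit can be taken over
   an algebraically closed field K of iterated Puiseux series containing generic x_i: there is a sum
   of a products v_1 (x) ... (x) v_k with entries in K that is arbitrarily close to it for a
   valuation of K.  The derivations x_ij d/dx_ij extend to K without lowering valuations, so the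
   value phi(e_(j_1) (x) ... (x) e_(j_d)), which is a mixed derivative of phi(x_1 (x) ... (x) x_d) up
   to a monomial, is close to the mixed derivative of the sum.  By the Leibniz rule each product
   contributes one term for each of the k^d ways of distributing the d derivations over the k
   factors.  After summation against the coefficients of T, the factor that receives most derivations
   absorbs its indices, and at most (k - 1) d / k indices remain, whence phi(T) is a limit of
   sums of a k^d n^((k - 1) d / k) decomposable tensors. *)

(** * Puiseux series *)

(** The hypothesis bounds the border rank of each [phi s] separately, and the approximations may
    vary without control with [s]. Differentiation in x requires a single approximation at the
    generic point. Its entries solve polynomial equations, so the derivations must live on an
    algebraically closed field. No extra small parameter is added: the last generic coordinate, of
    valuation at least 1, serves as one. Logarithmic derivations x d/dx are used for two reasons.
    They lose no precision, and monomials are their eigenvectors, so one derivation per tensor slot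
    singles out one monomial. Division by that monomial does lose precision, but by an amount
    bounded in advance. Border rank over K never enters: equations of tensors of rank at most r over
    F become formal identities in the parametrization, valid in every extension. An element of F of
    positive valuation is 0, which brings the conclusion back to F. The existence of the
    approximation, a point of the image of a polynomial map near a given point of its closure, is
    what calls for Noether normalization and integral closedness. *)

Section PowerSeries.
Variable L : comNzRingType.

Record pser := Pser { scoef : nat -> L }.

HB.instance Definition _ := gen_eqMixin pser.
HB.instance Definition _ := gen_choiceMixin pser.

Lemma pserP (a b : pser) : (forall i, scoef a i = scoef b i) <-> a = b.
Proof.
split=> [h|->//]; case: a b h => [a] [b] /= h.
by congr Pser; apply: funext.
Qed.

Definition strunc (n : nat) (a : pser) : {poly L} := \poly_(i < n) scoef a i.

Definition sadd a b := Pser (fun i => scoef a i + scoef b i).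
Definition sopp a := Pser (fun i => - scoef a i).
Definition smul a b := Pser (fun n => \sum_(i < n.+1) scoef a i * scoef b (n - i)%N).
Definition sconst (c : L) := Pser (fun i => if i == 0%N then c else 0).

(** Coefficient [i] of a product involves only coefficients up to [i], so commutativity and
    associativity are inherited from truncated polynomials. *)
Lemma smul_polyE (p q : {poly L}) i a b :
    (forall j, (j <= i)%N -> p`_j = scoef a j) ->
    (forall j, (j <= i)%N -> q`_j = scoef b j) ->
  scoef (smul a b) i = (p * q)`_i.
Proof.
move=> hp hq; rewrite coefM; apply: eq_bigr => j _.
by rewrite hp ?hq ?leq_subr // -ltnS.
Qed.

Lemma coef_strunc n a j : (j < n)%N -> (strunc n a)`_j = scoef a j.
Proof. by move=> jn; rewrite coef_poly jn. Qed.

Fact saddA : associative sadd.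
Proof. by move=> a b c; apply/pserP => i /=; rewrite addrA. Qed.
Fact saddC : commutative sadd.
Proof. by move=> a b; apply/pserP => i /=; rewrite addrC. Qed.
Fact sadd0 : left_id (sconst 0) sadd.
Proof. by move=> a; apply/pserP => i /=; rewrite if_same add0r. Qed.
Fact saddN : left_inverse (sconst 0) sopp sadd.
Proof. by move=> a; apply/pserP => i /=; rewrite addNr if_same. Qed.

HB.instance Definition _ := GRing.isZmodule.Build pser saddA saddC sadd0 saddN.

Fact smulC : commutative smul.
Proof.
move=> a b; apply/pserP => i; pose t := strunc i.+1.
rewrite (@smul_polyE (t a) (t b)) ?(@smul_polyE (t b) (t a)) 1?mulrC //;
  by move=> j ji; rewrite coef_strunc.
Qed.
Fact smulA : associative smul.
Proof.
move=> a b c; apply/pserP => i; pose t := strunc i.+1.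
have h x y j : (j <= i)%N -> (t x * t y)`_j = scoef (smul x y) j.
  move=> ji; apply/esym/smul_polyE => l lj; apply: coef_strunc; exact: leq_trans ji.
have h1 x j : (j <= i)%N -> (t x)`_j = scoef x j by move=> ji; rewrite coef_strunc.
by rewrite (smul_polyE (h1 a) (h b c)) (smul_polyE (h a b) (h1 c)) mulrA.
Qed.
Fact smul1 : left_id (sconst 1) smul.
Proof.
move=> a; apply/pserP => i /=; rewrite big_ord_recl /= subn0 mul1r big1 ?addr0 //.
by move=> j _; rewrite /= mul0r.
Qed.
Fact smulD : left_distributive smul sadd.
Proof.
move=> a b c; apply/pserP => i /=; rewrite -big_split /=.
by apply: eq_bigr => j _; rewrite mulrDl.
Qed.
Fact s1_neq0 : sconst 1 != 0.
Proof.
apply/eqP => /pserP/(_ 0%N) /= /eqP; by rewrite oner_eq0.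
Qed.

HB.instance Definition _ :=
  GRing.Zmodule_isComNzRing.Build pser smulA smulC smul1 smulD s1_neq0.

Lemma scoefD a b i : scoef (a + b) i = scoef a i + scoef b i. Proof. by []. Qed.
Lemma scoefM a b n :
  scoef (a * b) n = \sum_(i < n.+1) scoef a i * scoef b (n - i)%N.
Proof. by []. Qed.
Lemma scoef0 i : scoef 0 i = 0. Proof. by rewrite /= if_same. Qed.
Lemma scoef1 i : scoef 1 i = (i == 0%N)%:R. Proof. by rewrite /=; case: eqP. Qed.
Lemma scoef_sum (I : Type) (r : seq I) (P : pred I) (F : I -> pser) i :
  scoef (\sum_(j <- r | P j) F j) i = \sum_(j <- r | P j) scoef (F j) i.
Proof. by apply: (big_morph (fun a => scoef a i)) => //; apply: scoef0. Qed.

Definition sshift (n : nat) (a : pser) :=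
  Pser (fun i => if (n <= i)%N then scoef a (i - n)%N else 0).

Definition sX n : pser := Pser (fun i => (i == n)%:R).

Arguments sX n%_N.

Lemma sXE n a : sX n * a = sshift n a.
Proof.
apply/pserP => i; rewrite scoefM /=; case: leqP => [le_ni|lt_in].
  have lt : (n < i.+1)%N by rewrite ltnS.
  rewrite (bigD1 (Ordinal lt)) //= eqxx mul1r big1 ?addr0 // => j nj.
  by rewrite (negbTE (_ : j != n :> nat)) ?mul0r.
rewrite big1 // => j _; case: eqP => [e|_]; last by rewrite mul0r.
by have := ltn_ord j; rewrite e ltnS leqNgt lt_in.
Qed.

Lemma sXD m n : sX (m + n)%N = sX m * sX n.
Proof.
apply/pserP => i; rewrite sXE /=; case: leqP => le.
  by congr (_ %:R); congr nat_of_bool; lia.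
by rewrite (_ : (i == m + n)%N = false) //; lia.
Qed.

Lemma sX0 : sX 0 = 1. Proof. by apply/pserP => i; rewrite scoef1. Qed.

(** The substitution of t^k for t, which turns a series in t^(1/D) into one in t^(1/(D k)). *)
Definition ssub (k : nat) (a : pser) :=
  Pser (fun i => if (k %| i)%N then scoef a (i %/ k)%N else 0).

Lemma ssubM k a b : (0 < k)%N -> ssub k (a * b) = ssub k a * ssub k b.
Proof.
move=> k0; apply/pserP => i; pose t := strunc i.+1.
have h x j : (j <= i)%N -> (t x \Po 'X^k)`_j = scoef (ssub k x) j.
  move=> ji; rewrite coef_comp_poly_Xn //=; case: ifP => // _.
  by rewrite coef_strunc // ltnS (leq_trans (leq_div _ _)).
rewrite [RHS](smul_polyE (h a) (h b)) -comp_polyM coef_comp_poly_Xn //=.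
case: ifP => // _; apply: smul_polyE => j ji; apply: coef_strunc;
  by rewrite ltnS (leq_trans ji) // leq_div.
Qed.

End PowerSeries.

Section SeriesField.
Variable L : fieldType.

(** The first [n] coefficients of 1/a, solved from a b = 1 one at a time; they are kept in a list
    because each one depends on all earlier ones. *)
Fixpoint sinv_seq (a : pser L) (n : nat) : seq L :=
  if n is n'.+1 then
    let s := sinv_seq a n' in
    rcons s (((n' == 0)%:R - \sum_(i < n') scoef a (i.+1) * s`_(n' - i.+1)) / scoef a 0)
  else [::].

Lemma size_sinv_seq a n : size (sinv_seq a n) = n.
Proof. by elim: n => //= n IH; rewrite size_rcons IH. Qed.

Lemma nth_sinv_seq a m n i : (i < m)%N -> (m <= n)%N ->
  (sinv_seq a m)`_i = (sinv_seq a n)`_i.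
Proof.
move=> im /subnK <-; elim: (n - m)%N => //= d ->.
by rewrite nth_rcons size_sinv_seq (leq_trans im) // leq_addl.
Qed.

Lemma sinvP (a : pser L) : scoef a 0 != 0 -> exists b, a * b = 1.
Proof.
move=> a0; exists (Pser (fun n => (sinv_seq a n.+1)`_n)).
apply/pserP => n; rewrite scoefM scoef1 big_ord_recl /= subn0.
rewrite nth_rcons size_sinv_seq ltnn eqxx mulrCA divff // mulr1.
rewrite [X in _ + X](eq_bigr (fun i : 'I_n => scoef a i.+1 * (sinv_seq a n)`_(n - i.+1))).
  by rewrite subrK.
move=> i _; congr (_ * _).
rewrite -/(sinv_seq a _.+1) (@nth_sinv_seq a _ n) //; rewrite /bump /=; case: i => i /=; lia.
Qed.

Lemma pser_val (a : pser L) : a != 0 -> exists n b, a = sX L n * b /\ scoef b 0 != 0.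
Proof.
move=> a0; have ex : exists n, scoef a n != 0.
  apply: contrapT => h; move/eqP: a0; apply; apply/pserP => i; rewrite scoef0.
  by apply/eqP; apply: contraT => hi; case: h; exists i.
case: (ex_minnP ex) => n an nmin; exists n, (Pser (fun i => scoef a (n + i)%N)).
split; last by rewrite /= addn0.
apply/pserP => i; rewrite sXE /=; case: leqP => [le|lt]; first by rewrite subnKC.
by apply/eqP; apply: contraLR lt => /nmin; rewrite leqNgt.
Qed.

End SeriesField.

Lemma ssub_comp (L : comNzRingType) k l (a : pser L) : (0 < k)%N -> (0 < l)%N ->
  ssub k (ssub l a) = ssub (k * l) a.
Proof.
move=> k0 l0; apply/pserP => i /=; case: (boolP (k %| i)%N) => [/dvdnP[q ->]|nk].
  rewrite mulnK // (mulnC q) dvdn_pmul2l //; case: ifP => // _.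
  by rewrite divnMl.
by case: ifP => // /(dvdn_trans (dvdn_mulr l (dvdnn k))); rewrite (negbTE nk).
Qed.

Section Puiseux.
Variable L : fieldType.

(* The Puiseux series sum_s a_s t^(s/D - B), as its coefficient function. *)
Definition pemb (D B : nat) (a : pser L) : rat -> L := fun q =>
  let x := (q + B%:R) * D%:R in
  if x \is a Num.nat then scoef a (Num.truncn x) else 0.

Arguments pemb (D B)%_N a _.

Definition is_puis (f : rat -> L) :=
  exists D B a, (0 < D)%N /\ f = pemb D B a.

(** A series has many representations (D, B, a). With the coefficient function as the only data,
    equality is pointwise and no quotient is required. *)
Record puis := Puis { pcoef :> rat -> L; puisP : is_puis pcoef }.

HB.instance Definition _ := gen_eqMixin puis.
HB.instance Definition _ := gen_choiceMixin puis.

Lemma puis_eq (f g : puis) : (forall q, f q = g q) <-> f = g.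
Proof.
split=> [h|->//]; case: f g h => [f hf] [g hg] /= /funext h.
by case: _ / h hg => hg; congr Puis; apply: Prop_irrelevance.
Qed.

Definition prep (f : puis) D B a := pcoef f = pemb D B a.
Arguments prep f (D B)%_N a.

Lemma pemb_at D B a s : (0 < D)%N -> pemb D B a (s%:R / D%:R - B%:R) = scoef a s.
Proof.
move=> D0; rewrite /pemb /= subrK mulfVK ?pnatr_eq0 -?lt0n //.
by rewrite natr_nat natrK.
Qed.

Lemma pemb_neq0 D B a q : (0 < D)%N -> pemb D B a q != 0 ->
  exists s : nat, q = s%:R / D%:R - B%:R.
Proof.
move=> D0; rewrite /pemb; case: ifP => [/natrP[s hs] _|_]; last by rewrite eqxx.
exists s; rewrite -hs mulfK ?addrK // pnatr_eq0 -lt0n //.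
Qed.

Lemma pemb_inj D B a b : (0 < D)%N -> pemb D B a = pemb D B b -> a = b.
Proof.
move=> D0 h; apply/pserP => s.
by rewrite -(pemb_at B a s D0) h pemb_at.
Qed.

(** The exponent s/D - B equals (s k + c D k)/(D k) - (B + c). By such refinements any two
    representations reach a common denominator and a common lower bound. *)
Lemma pemb_scale D B a k c : (0 < D)%N -> (0 < k)%N ->
  pemb D B a = pemb (D * k) (B + c) (sX L (c * (D * k))%N * ssub k a).
Proof.
move=> D0 k0; have Dk0 : (0 < D * k)%N by rewrite muln_gt0 D0.
have nz n : (0 < n)%N -> n%:R != 0 :> rat by move=> n0; rewrite pnatr_eq0 -lt0n.
have E s : s%:R / D%:R - B%:R =
     (c * (D * k) + s * k)%N%:R / (D * k)%N%:R - (B + c)%N%:R :> rat.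
  by rewrite !natrD !natrM; field; rewrite !nz.
apply: funext => q; case: (eqVneq (pemb D B a q) 0) => [e|/(pemb_neq0 D0)[s ->]].
  rewrite e; case: (eqVneq (pemb (D * k) (B + c) (sX L (c * (D * k))%N * ssub k a) q) 0) => // h.
  have [s hs] := pemb_neq0 Dk0 h; move: h; rewrite hs pemb_at // sXE /=.
  case: leqP => [le|]; last by rewrite eqxx.
  case: ifP => [/dvdnP[t ht] _|]; last by rewrite eqxx.
  have {}ht : s = (c * (D * k) + t * k)%N by rewrite -ht subnKC.
  by move: e; rewrite hs ht -E pemb_at // => e; rewrite addKn mulnK ?e.
by rewrite pemb_at // E pemb_at // sXE /= leq_addr addKn dvdn_mull // mulnK.
Qed.

Lemma prepP f : exists D B a, (0 < D)%N /\ prep f D B a.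
Proof. exact: puisP f. Qed.

Lemma prep_ex D B a : (0 < D)%N -> exists f, prep f D B a.
Proof.
move=> D0; have h : is_puis (pemb D B a) by exists D, B, a.
by exists (Puis h).
Qed.

Lemma prep_inj f g D B a : prep f D B a -> prep g D B a -> f = g.
Proof. by move=> hf hg; apply/puis_eq => q; rewrite hf hg. Qed.

Lemma prep_eq f D B a b : (0 < D)%N -> prep f D B a -> prep f D B b -> a = b.
Proof. by move=> D0 ha hb; apply: (@pemb_inj D B) => //; rewrite -ha. Qed.

Lemma prep_scale f D B a k c : (0 < D)%N -> (0 < k)%N -> prep f D B a ->
  prep f (D * k) (B + c) (sX L (c * (D * k))%N * ssub k a).
Proof. by rewrite /prep => D0 k0 ->; apply: pemb_scale. Qed.

Lemma prep_common (fs : seq puis) : exists D B, (0 < D)%N /\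
  forall f, f \in fs -> exists a, prep f D B a.
Proof.
elim: fs => [|f fs [D [B [D0 IH]]]]; first by exists 1%N, 0%N.
have [E [C [a [E0 ha]]]] := prepP f.
exists (D * E)%N, (B + C)%N; rewrite muln_gt0 D0 E0; split=> // g.
rewrite inE => /predU1P[->|/IH[b hb]].
  by rewrite mulnC addnC; eexists; apply: (prep_scale B E0 D0 ha).
by eexists; apply: (prep_scale C D0 E0 hb).
Qed.

Lemma prep_common3 (f g h : puis) : exists D B a b c,
  [/\ (0 < D)%N, prep f D B a, prep g D B b & prep h D B c].
Proof.
have [D [B [D0 H]]] := prep_common [:: f; g; h].
have [a ha] := H f (mem_head _ _).
have [b hb] : exists b, prep g D B b by apply: H; rewrite !inE eqxx orbT.
have [c hc] : exists b, prep h D B b by apply: H; rewrite !inE eqxx !orbT.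
by exists D, B, a, b, c.
Qed.

Lemma pembD D B a b q : pemb D B (a + b) q = pemb D B a q + pemb D B b q.
Proof. by rewrite /pemb /=; case: ifP; rewrite ?addr0. Qed.

Lemma pembN D B a q : pemb D B (- a) q = - pemb D B a q.
Proof. by rewrite /pemb /=; case: ifP; rewrite ?oppr0. Qed.

Lemma pemb0 D B q : pemb D B 0 q = 0.
Proof. by rewrite /pemb scoef0 if_same. Qed.

Fact padd_subproof (f g : puis) : is_puis (fun q => f q + g q).
Proof.
have [D [B [a [b [_ [D0 ha hb _]]]]]] := prep_common3 f g g.
exists D, B, (a + b); split=> //; apply: funext => q; by rewrite pembD ha hb.
Qed.
Definition padd f g := Puis (padd_subproof f g).

Fact popp_subproof (f : puis) : is_puis (fun q => - f q).
Proof.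
have [D [B [a [D0 ha]]]] := prepP f.
by exists D, B, (- a); split=> //; apply: funext => q; rewrite pembN ha.
Qed.
Definition popp f := Puis (popp_subproof f).

Fact pzero_subproof : is_puis (fun=> 0).
Proof. by exists 1%N, 0%N, 0; split=> //; apply: funext => q; rewrite pemb0. Qed.
Definition pzero := Puis pzero_subproof.

Definition prep_pick (f : puis) : {x : nat * nat * pser L |
  (0 < x.1.1)%N /\ prep f x.1.1 x.1.2 x.2}.
Proof.
apply: cid; have [D [B [a h]]] := prepP f; by exists (D, B, a).
Defined.
Definition pden f := (projT1 (prep_pick f)).1.1.
Definition plow f := (projT1 (prep_pick f)).1.2.
Definition pnum f := (projT1 (prep_pick f)).2.
Lemma pden_gt0 f : (0 < pden f)%N.
Proof. by rewrite /pden; case: prep_pick => x []. Qed.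
Lemma prep_num f : prep f (pden f) (plow f) (pnum f).
Proof. by rewrite /pden /plow /pnum; case: prep_pick => x []. Qed.

Fact pmul_subproof (f g : puis) : is_puis (pemb (pden f * pden g) (plow f + plow g)
  (ssub (pden g) (pnum f) * ssub (pden f) (pnum g))).
Proof. by do 3!eexists; split; last reflexivity; rewrite muln_gt0 !pden_gt0. Qed.
Definition pmul f g := Puis (pmul_subproof f g).

(** [pmul] is defined from chosen representations with unrelated denominators. Refined to the
    denominator D E F and equal lower bounds, they coincide with the refinements of [a] and [b], so
    the choice does not matter and ring laws can be checked on power series. *)
Lemma prepM f g D B B' a b : (0 < D)%N -> prep f D B a -> prep g D B' b ->
  prep (pmul f g) D (B + B') (a * b).
Proof.
move=> D0 ha hb.
have [hf hg] := (prep_num f, prep_num g); have [f0 g0] := (pden_gt0 f, pden_gt0 g).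
rewrite /prep /=; move: (pden f) (pden g) (plow f) (plow g) (pnum f) (pnum g) f0 g0 hf hg.
move=> E F C C' u v E0 F0 hu hv.
have [EF0 DE0 DF0] : [/\ 0 < E * F, 0 < D * E & 0 < D * F]%N by rewrite !muln_gt0 D0 E0 F0.
rewrite (pemb_scale (B + B')%N _ (C + C')%N D0 EF0) (pemb_scale (C + C')%N _ (B + B')%N EF0 D0).
have ea := prep_scale C D0 EF0 ha; have eb := prep_scale C' D0 EF0 hb.
have eu := prep_scale B E0 DF0 hu; have ev := prep_scale B' F0 DE0 hv.
rewrite (_ : E * (D * F) = D * (E * F))%N in eu; last by lia.
rewrite (_ : F * (D * E) = D * (E * F))%N in ev; last by lia.
rewrite (addnC C) in eu; rewrite (addnC C') in ev.
have N0 : (0 < D * (E * F))%N by rewrite muln_gt0 D0.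
have {}ea := prep_eq N0 ea eu; have {}eb := prep_eq N0 eb ev.
rewrite (mulnC (E * F)%N) (addnC (C + C')%N); congr pemb.
rewrite !ssubM // !ssub_comp //. rewrite !mulnDl !sXD.
rewrite mulrACA [RHS]mulrACA ea eb; congr (_ * _).
Qed.

Lemma prepD f g D B a b : prep f D B a -> prep g D B b -> prep (padd f g) D B (a + b).
Proof. by move=> ha hb; apply: funext => q; rewrite pembD /= ha hb. Qed.

Fact pmono_subproof (r : rat) (c : L) : is_puis (fun q => if q == r then c else 0).
Proof.
have [D [B [s [D0 hs]]]] :
    exists D B s : nat, (0 < D)%N /\ r = s%:R / D%:R - B%:R.
  have D0 : (0 < `|denq r|)%N by rewrite absz_gt0 denq_neq0.
  (* The lower bound B = |numq r| makes numq r + B denq r nonnegative, since denq r >= 1. *)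
  exists `|denq r|%N, `|numq r|%N.
  have : (0 <= numq r + (`|numq r| * `|denq r|)%N%:Z) by nia.
  case e : (numq r + _) => [s|//] _; exists s; split=> //.
  rewrite -[r in LHS]divq_num_den.
  have dD : (denq r)%:~R = `|denq r|%:R :> rat.
    by rewrite natr_absz gtr0_norm ?denq_gt0.
  have nD : `|denq r|%:R != 0 :> rat by rewrite pnatr_eq0 -lt0n.
  rewrite dD; have : (numq r)%:~R + `|numq r|%:R * `|denq r|%:R = s%:R :> rat.
    by rewrite -natrM -[s%:R]/(s%:Z%:~R) -e rmorphD.
  by move=> <-; field.
exists D, B, (Pser (fun i => if i == s then c else 0)); split=> //.
apply: funext => q; case: eqP => [->|nq]; first by rewrite hs pemb_at //= eqxx.
apply/eqP; apply: contraT; rewrite eq_sym => h; have [t ht] := pemb_neq0 D0 h.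
move: h; rewrite ht pemb_at //=; case: (t =P s) => [et|_]; last by rewrite eqxx.
by case: nq; rewrite ht hs et.
Qed.
Definition pmono r c := Puis (pmono_subproof r c).

Lemma prep_mono D B n : (0 < D)%N ->
  prep (pmono (n%:R / D%:R - B%:R) 1) D B (sX L n).
Proof.
move=> D0; apply: funext => q /=; case: eqP => [->|nq]; first by rewrite pemb_at //= eqxx.
apply/eqP; apply: contraT; rewrite eq_sym => h; have [t ht] := pemb_neq0 D0 h.
move: h; rewrite ht pemb_at //=; case: (t =P n) => [et|_]; last by rewrite eqxx.
by case: nq; rewrite ht et.
Qed.

Lemma prep_const D B c : (0 < D)%N ->
  prep (pmono 0 c) D B (sX L (B * D)%N * sconst c).
Proof.
move=> D0; apply: funext => q /=; case: (eqVneq q 0) => [->|nq].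
  have -> : 0 = (B * D)%N%:R / D%:R - B%:R :> rat.
    by rewrite natrM mulfK ?subrr // pnatr_eq0 -lt0n.
  by rewrite pemb_at // sXE /= leqnn subnn.
apply/eqP; apply: contraT; rewrite eq_sym => h; have [t ht] := pemb_neq0 D0 h.
move: h; rewrite ht pemb_at // sXE /=; case: leqP => [le|]; last by rewrite eqxx.
case: ((t - B * D)%N =P 0%N) => [et|_]; last by rewrite eqxx.
case/eqP: nq; rewrite ht; have -> : t = (B * D)%N by lia.
by rewrite natrM mulfK ?subrr // pnatr_eq0 -lt0n.
Qed.

Fact paddA : associative padd.
Proof. by move=> f g h; apply/puis_eq => q /=; rewrite addrA. Qed.
Fact paddC : commutative padd.
Proof. by move=> f g; apply/puis_eq => q /=; rewrite addrC. Qed.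
Fact padd0 : left_id pzero padd.
Proof. by move=> f; apply/puis_eq => q /=; rewrite add0r. Qed.
Fact paddN : left_inverse pzero popp padd.
Proof. by move=> f; apply/puis_eq => q /=; rewrite addNr. Qed.

HB.instance Definition _ := GRing.isZmodule.Build puis paddA paddC padd0 paddN.

Fact pmulC : commutative pmul.
Proof.
move=> f g; have [D [B [a [b [_ [D0 ha hb _]]]]]] := prep_common3 f g g.
by apply: (prep_inj (prepM D0 ha hb)); rewrite mulrC; apply: prepM.
Qed.
Fact pmulA : associative pmul.
Proof.
move=> f g h; have [D [B [a [b [c [D0 ha hb hc]]]]]] := prep_common3 f g h.
apply: (prep_inj (prepM D0 ha (prepM D0 hb hc))).
by rewrite addnA mulrA; do !apply: prepM.
Qed.
Fact pmul1 : left_id (pmono 0 1) pmul.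
Proof.
move=> f; have [D [B [a [D0 ha]]]] := prepP f.
have h := prepM D0 (prep_const 0 1 D0) ha; apply: (prep_inj h).
by rewrite mul0n sX0 mul1r [X in prep _ _ _ X]mul1r.
Qed.
Fact pmulD : left_distributive pmul padd.
Proof.
move=> f g h; have [D [B [a [b [c [D0 ha hb hc]]]]]] := prep_common3 f g h.
apply: (prep_inj (prepM D0 (prepD ha hb) hc)).
by rewrite mulrDl; apply: prepD; apply: prepM.
Qed.
Fact p1_neq0 : pmono 0 1 != 0.
Proof. by apply/eqP => /puis_eq/(_ 0) /= /eqP; rewrite oner_eq0. Qed.

HB.instance Definition _ :=
  GRing.Zmodule_isComNzRing.Build puis pmulA pmulC pmul1 pmulD p1_neq0.

Lemma pinv_ex (f : puis) : f != 0 -> exists g, g * f = 1.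
Proof.
move=> f0; have [D [B [a [D0 ha]]]] := prepP f.
have [|n [b [ea b0]]] := @pser_val L a.
  apply: contraNneq f0 => a0; apply/eqP/puis_eq => q.
  by rewrite ha a0 pemb0.
have [c bc] := sinvP b0.
have [g hg] := prep_ex n (sX L (B * D + n * D - n)%N * c) D0.
exists g; apply: (prep_inj (prepM D0 hg ha)).
have -> : sX L (B * D + n * D - n)%N * c * a = sX L ((n + B) * D)%N * sconst 1.
  rewrite ea mulrACA (mulrC c) bc -sXD; congr (sX L _ * _).
  by have := leq_pmulr n D0; lia.
exact: prep_const.
Qed.

Definition pinv (f : puis) : puis :=
  if pselect (exists g, g * f = 1) is left h then projT1 (cid h) else 0.

Fact pmulVf (f : puis) : f != 0 -> pinv f * f = 1.
Proof.
by move=> /pinv_ex h; rewrite /pinv; case: pselect => // h'; case: (cid h').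
Qed.
Fact pinv0 : pinv 0 = 0.
Proof.
rewrite /pinv; case: pselect => // h; exfalso; case: h => g.
by rewrite mulr0 => /esym/eqP; rewrite oner_eq0.
Qed.
HB.instance Definition _ := GRing.ComNzRing_isField.Build puis pmulVf pinv0.

End Puiseux.

(** * Valuation and derivations of Puiseux series *)

Definition derivation (R : nzRingType) (e : R -> R) :=
  (forall a b, e (a + b) = e a + e b) /\ (forall a b, e (a * b) = e a * b + a * e b).

Lemma der0 (R : nzRingType) (e : R -> R) : derivation e -> e 0 = 0.
Proof. by case=> eD _; apply: (addrI (e 0)); rewrite -eD !addr0. Qed.

Lemma der_sum (R : nzRingType) (e : R -> R) (I : Type) (r : seq I) (P : pred I) F :
  derivation e -> e (\sum_(i <- r | P i) F i) = \sum_(i <- r | P i) e (F i).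
Proof. by move=> he; apply: (big_morph e (proj1 he)); apply: der0. Qed.

Section PuiseuxValuation.
Variable L : fieldType.
Local Notation K := (puis L).
Implicit Types f g : K.

Definition pconst (c : L) : K := pmono 0 c.

Lemma prep_pconst D c : (0 < D)%N -> prep (pconst c) D 0 (sconst c).
Proof. by move=> D0; have := prep_const 0 c D0; rewrite mul0n sX0 mul1r. Qed.

Lemma pconst_is_additive : {morph pconst : a b / a - b}.
Proof.
move=> a b; apply/puis_eq => q; rewrite /= /pconst /=.
by case: eqP; rewrite ?subr0.
Qed.
HB.instance Definition _ := GRing.isZmodMorphism.Build L K pconst pconst_is_additive.
Lemma pconst_is_monoid : monoid_morphism pconst.
Proof.
split=> // a b; apply: (@prep_inj _ _ _ 1%N 0%N (sconst (a * b))).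
  exact: prep_pconst.
have -> : sconst (a * b) = sconst a * sconst b.
  apply/pserP => i; rewrite scoefM /= big_ord_recl /= subn0 big1 ?addr0.
    by case: eqP; rewrite ?mulr0.
  by move=> j _; rewrite mul0r.
exact: (@prepM _ _ _ 1%N 0%N 0%N _ _ isT (@prep_pconst 1%N a isT) (@prep_pconst 1%N b isT)).
Qed.
HB.instance Definition _ := GRing.isMonoidMorphism.Build L K pconst pconst_is_monoid.

Fact pofs_subproof D (a : pser L) : is_puis (pemb D.+1 0 a).
Proof. by exists D.+1, 0%N, a. Qed.
(** The subring of power series in t^(1/(D+1)), to which Hensel's lemma will be applied. *)
Definition pofs D (a : pser L) : K := Puis (pofs_subproof D a).
Lemma prep_pofs D a : prep (pofs D a) D.+1 0 a. Proof. by []. Qed.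
Lemma pofs_is_additive D : {morph pofs D : a b / a - b}.
Proof. by move=> a b; apply/puis_eq => q; rewrite /= pembD pembN. Qed.
HB.instance Definition _ D := GRing.isZmodMorphism.Build _ _ (pofs D) (@pofs_is_additive D).
Lemma pofs_is_monoid D : monoid_morphism (pofs D).
Proof.
split=> [|a b].
  by apply: (@prep_inj _ _ _ D.+1 0%N 1 (prep_pofs _ _)); apply: prep_pconst.
apply: (@prep_inj _ _ _ D.+1 0%N (a * b)) => //.
exact: (@prepM _ _ _ D.+1 0%N 0%N _ _ isT (prep_pofs D a) (prep_pofs D b)).
Qed.
HB.instance Definition _ D := GRing.isMonoidMorphism.Build _ _ (pofs D) (@pofs_is_monoid D).

Definition pval (f : K) (r : rat) := f r != 0 /\ forall p, p < r -> f p = 0.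

Lemma expo_lt (D B s t : nat) : (0 < D)%N ->
  (s%:R / D%:R - B%:R < t%:R / D%:R - B%:R :> rat) = (s < t)%N.
Proof. by move=> D0; rewrite ltrD2r ltr_pM2r ?invr_gt0 ?ltr0n // ltr_nat. Qed.

Lemma prep_val f D B i a : (0 < D)%N -> prep f D B (sX L i * a) ->
  scoef a 0 != 0 -> pval f (i%:R / D%:R - B%:R).
Proof.
move=> D0 hf a0; split; first by rewrite hf pemb_at // sXE /= leqnn subnn.
move=> p lt_p; apply/eqP; apply: contraTT lt_p; rewrite hf => h.
have [s hs] := pemb_neq0 D0 h; move: h; rewrite hs pemb_at // expo_lt // sXE /=.
by case: ltnP; rewrite ?eqxx.
Qed.

Lemma prep_ser_neq0 f D B a : prep f D B a -> f != 0 -> a != 0.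
Proof.
move=> hf; apply: contraNneq => a0; apply/eqP/puis_eq => q.
by rewrite hf a0 pemb0.
Qed.

Lemma pval_ex f : f != 0 -> exists r, pval f r.
Proof.
move=> f0; have [D [B [a [D0 ha]]]] := prepP f.
have [i [b [ea b0]]] := pser_val (prep_ser_neq0 ha f0).
by rewrite ea in ha; eexists; apply: prep_val ha b0.
Qed.

Lemma pval_uniq f r s : pval f r -> pval f s -> r = s.
Proof.
move=> [fr hr] [fs hs]; case: (ltgtP r s) => // [/hs|/hr] h.
  by rewrite h eqxx in fr.
by rewrite h eqxx in fs.
Qed.

Lemma pval_neq0 f r : pval f r -> f != 0.
Proof. by case=> fr _; apply: contraNneq fr => ->. Qed.

Lemma pvalM f g r s : pval f r -> pval g s -> pval (f * g) (r + s).
Proof.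
move=> vf vg; have [f0 g0] := (pval_neq0 vf, pval_neq0 vg).
have [D [B [a [b [_ [D0 ha hb _]]]]]] := prep_common3 f g g.
have [i [a' [ea a0]]] := pser_val (prep_ser_neq0 ha f0).
have [j [b' [eb b0]]] := pser_val (prep_ser_neq0 hb g0).
rewrite ea in ha; rewrite eb in hb.
rewrite (pval_uniq vf (prep_val D0 ha a0)) (pval_uniq vg (prep_val D0 hb b0)).
have := prepM D0 ha hb; rewrite mulrACA -sXD => h.
have nz : scoef (a' * b') 0 != 0.
  by rewrite scoefM big_ord1 mulf_neq0.
have := prep_val D0 h nz; rewrite !natrD; congr pval.
by rewrite mulrDl; ring.
Qed.

Definition pvge (q : rat) (f : K) := forall p, p < q -> f p = 0.

Lemma pvge_val f r q : pval f r -> pvge q f <-> q <= r.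
Proof.
move=> [fr hr]; split=> [h|qr p pq]; last by apply: hr; apply: lt_le_trans qr.
by rewrite leNgt; apply/negP => /h e; rewrite e eqxx in fr.
Qed.

(* [vge q a] stands for v(a) >= q, so that v(0) = +oo needs no special treatment. *)
Definition valuation (k : fieldType) (vge : rat -> k -> Prop) :=
  [/\ forall q, vge q 0,
      forall q a b, vge q a -> vge q b -> vge q (a + b),
      forall p q a b, vge p a -> vge q b -> vge (p + q) (a * b),
      forall p q a b, ~ vge p a -> ~ vge q b -> ~ vge (p + q) (a * b) &
      forall p q a, p <= q -> vge q a -> vge p a] /\
  (forall a, a != 0 -> exists q, ~ vge q a).

Lemma pvge_valuation : valuation pvge.
Proof.
split; first split.
- by [].
- by move=> q f g hf hg p pq; rewrite /= hf ?hg ?addr0.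
- move=> p q f g; case: (eqVneq f 0) => [->|f0]; first by rewrite mul0r.
  case: (eqVneq g 0) => [->|g0]; first by rewrite mulr0.
  have [[r vr] [s vs]] := (pval_ex f0, pval_ex g0).
  rewrite (pvge_val _ vr) (pvge_val _ vs) (pvge_val _ (pvalM vr vs)).
  exact: lerD.
- move=> p q f g; case: (eqVneq f 0) => [->|f0]; first by case.
  case: (eqVneq g 0) => [->|g0]; first by move=> _; case.
  have [[r vr] [s vs]] := (pval_ex f0, pval_ex g0).
  rewrite (pvge_val _ vr) (pvge_val _ vs) (pvge_val _ (pvalM vr vs)).
  move=> /negP; rewrite -ltNge => h1 /negP; rewrite -ltNge => h2; apply/negP.
  by rewrite -ltNge ltrD.
- by move=> p q f pq h r rp; apply: h; apply: lt_le_trans pq.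
move=> f /pval_ex[r vr]; exists (r + 1); rewrite (pvge_val _ vr).
by apply/negP; rewrite -ltNge ltrDl.
Qed.

Lemma pval_const c : c != 0 -> pval (pconst c) 0.
Proof.
by move=> c0; split=> /= [|p]; [rewrite ?eqxx|case: eqP => [->|//]; rewrite ltxx].
Qed.

Lemma pval_mono r : pval (pmono r 1) r.
Proof.
by split=> /= [|p]; [rewrite eqxx oner_eq0|case: eqP => [->|//]; rewrite ltxx].
Qed.

Section Coefficientwise.
Variables (e : L -> L) (he : derivation e).

Fact pmap_subproof f : is_puis (fun q => e (f q)).
Proof.
have [D [B [a [D0 ha]]]] := prepP f.
exists D, B, (Pser (fun i => e (scoef a i))); split=> //; apply: funext => q.
by rewrite ha /pemb; case: ifP => // _; apply: der0.
Qed.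
(** The extension for which t is a constant; it carries the derivations of earlier variables through
    each further Puiseux extension. *)
Definition pmap f : K := Puis (pmap_subproof f).

Lemma prep_pmap f D B a : prep f D B a -> prep (pmap f) D B (Pser (fun i => e (scoef a i))).
Proof.
move=> ha; apply: funext => q; rewrite /= ha /pemb; case: ifP => // _.
exact: der0.
Qed.

Lemma pmap_der : derivation pmap.
Proof.
split=> f g; first by apply/puis_eq => q; rewrite /= (proj1 he).
have [D [B [a [b [_ [D0 ha hb _]]]]]] := prep_common3 f g g.
apply: (prep_inj (prep_pmap (prepM D0 ha hb))).
have h := prepD (prepM D0 (prep_pmap ha) hb) (prepM D0 ha (prep_pmap hb)).
congr prep: h; apply/pserP => n; rewrite scoefD !scoefM -big_split /=.
by rewrite der_sum //; apply: eq_bigr => i _; rewrite (proj2 he).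
Qed.

Lemma pmap_const c : pmap (pconst c) = pconst (e c).
Proof. by apply/puis_eq => q /=; case: eqP => // _; apply: der0. Qed.

Lemma pmap_vge q f : pvge q f -> pvge q (pmap f).
Proof. by move=> h p pq; rewrite /= h // der0. Qed.

Lemma pmap_mono r : e 1 = 0 -> pmap (pmono r 1) = 0.
Proof. by move=> e1; apply/puis_eq => q /=; case: eqP => // _; apply: der0. Qed.
End Coefficientwise.

Section Euler.
Hypothesis char0 : forall n, n.+1%:R != 0 :> L.

Lemma char0_int (m : int) : m != 0 -> m%:~R != 0 :> L.
Proof. by case: m => [[|n]|n] // _; rewrite ?NegzE ?rmorphN ?oppr_eq0 ?char0. Qed.

Definition rat_in (q : rat) : L := (numq q)%:~R / (denq q)%:~R.

Lemma rat_inE (q : rat) (m n : int) : n != 0 -> q = m%:~R / n%:~R ->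
  rat_in q = m%:~R / n%:~R.
Proof.
move=> n0 hq; have d0 := denq_neq0 q.
have : q * (denq q)%:~R = (numq q)%:~R by rewrite -numqE.
rewrite {1}hq => h; have {}h : m * denq q = numq q * n.
  apply: (@intr_inj rat); rewrite !rmorphM /= -h.
  by field; rewrite intr_eq0.
apply/eqP; rewrite /rat_in eqr_div ?char0_int //.
by rewrite -!rmorphM /= h.
Qed.

Lemma rat_inD p q : rat_in (p + q) = rat_in p + rat_in q.
Proof.
have [dp dq] := (denq_neq0 p, denq_neq0 q).
rewrite (@rat_inE _ (numq p * denq q + numq q * denq p) (denq p * denq q)).
- rewrite /rat_in rmorphD !rmorphM /=; field.
  by rewrite !char0_int.
- by rewrite mulf_neq0.
rewrite -{1}[p]divq_num_den -{1}[q]divq_num_den rmorphD !rmorphM /=; field.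
by rewrite !intr_eq0 dp dq.
Qed.

Lemma rat_in1 : rat_in 1 = 1. Proof. by rewrite (@rat_inE 1 1 1) // divr1. Qed.
Lemma rat_in0 : rat_in 0 = 0. Proof. by rewrite (@rat_inE 0 0 1) // mul0r. Qed.

(* The derivation t d/dt is used rather than d/dt because it does not lower valuations. *)
Definition euler_ser D B (a : pser L) : pser L :=
  Pser (fun s => rat_in (s%:R / D%:R - B%:R) * scoef a s).

Lemma euler_pemb D B a : (0 < D)%N ->
  (fun q => rat_in q * pemb D B a q) = pemb D B (euler_ser D B a).
Proof.
move=> D0; apply: funext => q; case: (eqVneq (pemb D B (euler_ser D B a) q) 0).
  case: (eqVneq (pemb D B a q) 0) => [->|/(pemb_neq0 D0)[s ->]]; first by rewrite mulr0.
  by rewrite !pemb_at // => ->.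
by move/(pemb_neq0 D0) => [s ->]; rewrite !pemb_at.
Qed.

Fact euler_subproof f : is_puis (fun q => rat_in q * f q).
Proof.
have [D [B [a [D0 ha]]]] := prepP f.
by rewrite ha; exists D, B, (euler_ser D B a); split=> //; apply: euler_pemb.
Qed.
Definition euler f : K := Puis (euler_subproof f).

Lemma prep_euler f D B a : (0 < D)%N -> prep f D B a ->
  prep (euler f) D B (euler_ser D B a).
Proof. by move=> D0 ha; rewrite /prep /= ha euler_pemb. Qed.

(** The power t^q is an eigenvector with eigenvalue q, and exponents add in products; the rule
    follows from the additivity of [rat_in], which uses characteristic zero. *)
Lemma euler_der : derivation euler.
Proof.
split=> f g; first by apply/puis_eq => q; rewrite /= mulrDr.
have [D [B [a [b [_ [D0 ha hb _]]]]]] := prep_common3 f g g.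
apply: (prep_inj (prep_euler D0 (prepM D0 ha hb))).
have h := prepD (prepM D0 (prep_euler D0 ha) hb) (prepM D0 ha (prep_euler D0 hb)).
congr prep: h; apply/pserP => n; rewrite scoefD !scoefM -big_split /= mulr_sumr.
apply: eq_bigr => i _; rewrite -mulrA [X in _ + X]mulrCA -mulrDl; congr (_ * _).
rewrite -rat_inD; congr rat_in; rewrite natrD natrB; last by rewrite -ltnS.
by field; rewrite pnatr_eq0 -lt0n.
Qed.

Lemma euler_const c : euler (pconst c) = 0.
Proof. by apply/puis_eq => q /=; case: eqP => [->|_]; rewrite ?rat_in0 ?mul0r ?mulr0. Qed.

Lemma euler_t : euler (pmono 1 1) = pmono 1 1.
Proof. by apply/puis_eq => q /=; case: eqP => [->|_]; rewrite ?rat_in1 ?mulr1 ?mulr0. Qed.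

Lemma euler_vge q f : pvge q f -> pvge q (euler f).
Proof. by move=> h p pq; rewrite /= h // mulr0. Qed.
End Euler.

End PuiseuxValuation.

(** * Hensel's lemma and the Newton-Puiseux theorem *)

Definition alg_closed (k : fieldType) :=
  forall p : {poly k}, size p != 1 -> exists x, root p x.

Definition char0 (k : fieldType) := forall n, n.+1%:R != 0 :> k.

Section Hensel.
Variable L : fieldType.
Variables (F : {poly pser L}) (g0 h0 : {poly L}).
Hypotheses (Fmonic : F \is monic) (g0monic : g0 \is monic).
Hypothesis cop : coprimep g0 h0.
Hypothesis F0 : forall j, scoef F`_j 0 = (g0 * h0)`_j.

Let Fc i : {poly L} := \poly_(j < size F) scoef F`_j i.

(** From u g0 + v h0 = 1, take for G the remainder of v r by g0; then g0 divides r - h0 G. The bound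
    on H comes from comparing degrees, as deg F = deg g0 + deg h0. *)
Lemma hensel_step : exists G : {poly L} -> {poly L}, exists H : {poly L} -> {poly L},
  forall r : {poly L}, (size r < size F)%N ->
    [/\ g0 * H r + G r * h0 = r, (size (G r) < size g0)%N & (size (H r) < size h0)%N].
Proof.
have g00 := monic_neq0 g0monic.
have h00 : h0 != 0.
  apply/eqP => h00; have := F0 (size F).-1; rewrite h00 mulr0 coef0 -/(lead_coef F).
  by rewrite (monicP Fmonic) scoef1 /= => /eqP; rewrite oner_eq0.
have sF : size F = (size g0 + size h0).-1.
  rewrite -(size_monicM g0monic h00); apply/eqP; rewrite eqn_leq; apply/andP; split.
    rewrite leqNgt; apply/negP => lt; have := F0 (size F).-1.
    rewrite -/(lead_coef F) (monicP Fmonic) scoef1 /= nth_default; last by case: (size F) lt.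
    by move/eqP; rewrite oner_eq0.
  apply/leq_sizeP => j le; rewrite -F0 nth_default //; exact: scoef0.
have [[u v] /= uv] := Bezout_eq1_coprimepP _ _ cop.
exists (fun r => (v * r) %% g0), (fun r => (r - h0 * ((v * r) %% g0)) %/ g0) => r sr.
set G := _ %% g0; have sG : (size G < size g0)%N by rewrite ltn_modp.
have dv : g0 %| r - h0 * G.
  have -> : r - h0 * G = g0 * (u * r + h0 * ((v * r) %/ g0)).
    have := divp_eq (v * r) g0; rewrite -/G => e.
    have -> : G = v * r - v * r %/ g0 * g0 by rewrite {1}e addrC addKr.
    by rewrite -[X in X - _]mul1r -uv; ring.
  exact: dvdp_mulIl.
have e : g0 * ((r - h0 * G) %/ g0) + G * h0 = r.
  by rewrite mulrC divpK // (mulrC G) subrK.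
split=> //; have /(congr1 (fun p : {poly L} => size p)) := congr1 (fun p => p - G * h0) e.
rewrite addrK; set Hr := _ %/ g0; case: (eqVneq Hr 0) => [->|Hr0].
  by rewrite size_poly0 size_poly_gt0.
rewrite size_monicM // => s1.
have : (size (r - G * h0)%R <= (size g0 + size h0).-2)%N.
  apply: leq_trans (size_polyD _ _) _; rewrite geq_max size_polyN.
  have h0s : (0 < size h0)%N by rewrite size_poly_gt0.
  apply/andP; split; first by move: sr; rewrite sF; case: (_ + _)%N => [|[|N]].
  have aux (x y z : nat) : (x < y -> 0 < z -> (x + z).-1 <= (y + z).-2)%N by lia.
  by apply: leq_trans (size_polyMleq _ _) _; apply: aux.
rewrite -s1; have : (0 < size h0)%N by rewrite size_poly_gt0.
have : (0 < size g0)%N by rewrite size_poly_gt0.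
have : (0 < size Hr)%N by rewrite size_poly_gt0.
have aux (x y z : nat) : (0 < x -> 0 < y -> 0 < z -> (y + x).-1 <= (y + z).-2 -> x < z)%N by lia.
exact: aux.
Qed.

(** The coefficient of t^i in F = G H reads g0 h_i + g_i h0 + (terms of lower index). So
    [hensel_step] solves for g_i and h_i, given the remainder [rem] left by the earlier ones. *)
Lemma hensel_seq : exists g h : nat -> {poly L}, [/\ g 0%N = g0, h 0%N = h0,
  forall i, (0 < i)%N -> (size (g i) < size g0)%N /\ (size (h i) < size h0)%N &
  forall i j, scoef F`_j i = (\sum_(a < i.+1) g a * h (i - a)%N)`_j].
Proof.
have [G [H GH]] := hensel_step.
pose rem (s : seq ({poly L} * {poly L})) :=
  Fc (size s) - \sum_(1 <= a < size s) (nth (0, 0) s a).1 * (nth (0, 0) s (size s - a)).2.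
pose next s := if s is [::] then (g0, h0) else (G (rem s), H (rem s)).
pose fix build n := if n is n'.+1 then rcons (build n') (next (build n')) else [::].
have szb n : size (build n) = n by elim: n => //= n IH; rewrite size_rcons IH.
pose gh i := nth (0, 0) (build i.+1) i.
have ghE i n : (i < n)%N -> nth (0, 0) (build n) i = gh i.
  move=> lt; rewrite -(subnK lt); elim: (n - i.+1)%N => //= d IH.
  by rewrite nth_rcons szb leq_addl.
have ghS i : (0 < i)%N -> gh i = (G (rem (build i)), H (rem (build i))).
  move=> i0; rewrite /gh /= nth_rcons szb ltnn eqxx /next.
  by case e : (build i) => [|//]; have := szb i; rewrite e /= => ei; rewrite -ei in i0.
have gh0 : gh 0%N = (g0, h0) by [].
have remE i : rem (build i) = Fc i - \sum_(1 <= a < i) (gh a).1 * (gh (i - a)%N).2.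
  rewrite /rem szb; congr (_ - _); apply: eq_big_nat => a /andP[a1 ai].
  by rewrite !ghE // ltn_subrL; apply/andP; split; lia.
have szFc i : (0 < i)%N -> (size (Fc i) < size F)%N.
  move=> i0; have F00 : (0 < size F)%N by rewrite size_poly_gt0 monic_neq0.
  rewrite -(prednK F00) ltnS; apply/leq_sizeP => j le; rewrite coef_poly.
  case: ltnP => // lt; have -> : j = (size F).-1 by lia.
  by rewrite -/(lead_coef F) (monicP Fmonic) scoef1; case: i i0.
have szgh i : (0 < i)%N -> (size (gh i).1 < size g0)%N /\ (size (gh i).2 < size h0)%N
    /\ (size (rem (build i)) < size F)%N.
  elim/ltn_ind: i => i IH i0.
  suff sr : (size (rem (build i)) < size F)%N.
    by have [_ s1 s2] := GH _ sr; rewrite ghS.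
  have F00 : (0 < size F)%N by rewrite size_poly_gt0 monic_neq0.
  have g00 : (0 < size g0)%N by rewrite size_poly_gt0 monic_neq0.
  rewrite -(prednK F00) ltnS remE; apply: leq_trans (size_polyD _ _) _.
  rewrite geq_max size_polyN -ltnS (prednK F00) szFc //=.
  rewrite big_nat; apply: leq_trans (size_sum _ _ _) _; apply/bigmax_leqP_seq => a _ /andP[a1 ai].
  have [s1 [s2 _]] := IH a ai a1.
  have [||s3 [s4 _]] := IH (i - a)%N; [by lia|by rewrite subn_gt0|].
  apply: leq_trans (size_polyMleq _ _) _.
  have sF : (size g0 + size h0 <= (size F).+1)%N.
    have h00 : h0 != 0 by rewrite -size_poly_gt0; apply: leq_ltn_trans s4.
    have := size_monicM g0monic h00.
    suff : (size (g0 * h0)%R <= size F)%N.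
      have aux (x y z w : nat) : (x <= y -> x = (z + w).-1 -> z + w <= y.+1)%N by lia.
      by move=> /aux; apply.
    apply/leq_sizeP => j le; rewrite -F0 nth_default //; exact: scoef0.
  have aux (x y z w v : nat) :
    (x < y -> z < w -> y + w <= v.+1 -> (x + z).-1 < v)%N by lia.
  by rewrite -ltnS (prednK F00); apply: aux s1 s4 sF.
exists (fun i => (gh i).1), (fun i => (gh i).2); split=> //.
  by move=> i /szgh[? []].
move=> i j; case: (posnP i) => [->|i0]; first by rewrite big_ord1 F0.
have -> : scoef F`_j i = (Fc i)`_j.
  by rewrite coef_poly; case: ltnP => // le; rewrite nth_default //; apply: scoef0.
congr (_`_j); have [_ [_ sr]] := szgh i i0; have [e _ _] := GH _ sr.
rewrite -(big_mkord xpredT (fun a => (gh a).1 * (gh (i - a)%N).2)).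
rewrite big_nat_recr //= big_ltn // subn0 subnn gh0 (ghS i i0) /=.
by rewrite addrAC e remE subrK.
Qed.

(** The corrections g_i with i > 0 have degree below that of g0, hence do not touch the leading
    coefficient of G. *)
Lemma hensel : exists G H : {poly pser L}, [/\ F = G * H, G \is monic & size G = size g0].
Proof.
have [g [h [eg0 eh0 szgh gh]]] := hensel_seq.
pose S (n : nat) (s : nat -> {poly L}) : {poly pser L} := \poly_(j < n) Pser (fun i => (s i)`_j).
have Sc n (s : nat -> {poly L}) i j : (forall i, (size (s i) <= n)%N) -> scoef (S n s)`_j i = (s i)`_j.
  move=> sz; rewrite coef_poly; case: ltnP => // le.
  by rewrite nth_default ?scoef0 // (leq_trans (sz i)).
have sg i : (size (g i) <= size g0)%N.
  by case: (posnP i) => [->|/szgh[/ltnW]//]; rewrite eg0.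
have sh i : (size (h i) <= size h0)%N.
  by case: (posnP i) => [->|/szgh[_ /ltnW]//]; rewrite eh0.
have g00 : (0 < size g0)%N by rewrite size_poly_gt0 monic_neq0.
have lG : (S (size g0) g)`_(size g0).-1 = 1.
  apply/pserP => i; rewrite Sc // scoef1; case: (posnP i) => [->|i0].
    by rewrite eg0 -/(lead_coef g0) (monicP g0monic).
  by have [s1 _] := szgh i i0; rewrite nth_default ?(gtn_eqF i0) // -ltnS prednK.
have szG : size (S (size g0) g) = size g0.
  apply/eqP; rewrite eqn_leq size_poly /=; rewrite leqNgt; apply/negP => lt.
  move: lG; rewrite nth_default; last by rewrite -ltnS prednK.
  by move/eqP; rewrite eq_sym oner_eq0.
exists (S (size g0) g), (S (size h0) h); split=> //.
  apply/polyP => j; apply/pserP => i; rewrite gh coefM scoef_sum coef_sum.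
  rewrite (eq_bigr (fun a : 'I_j.+1 => \sum_(b < i.+1) (g b)`_a * (h (i - b)%N)`_(j - a))).
    by rewrite exchange_big /=; apply: eq_bigr => a _; rewrite coefM.
  by move=> a _; rewrite scoefM; apply: eq_bigr => b _; rewrite !Sc.
by apply/monicP; rewrite lead_coefE szG.
Qed.
End Hensel.

Section Roots.
Variable L : fieldType.
Hypotheses (Lclosed : alg_closed L) (L0 : char0 L).
Local Notation K := (puis L).

Lemma coef_XsubC_pred (R : comNzRingType) (c : R) n : (('X - c%:P) ^+ n.+1)`_n = - (c *+ n.+1).
Proof.
elim: n => [|n IH]; first by rewrite expr1 coefB coefX coefC sub0r mulr1n.
rewrite exprSr mulrBr coefB coefMX coefMC /= IH [c *+ n.+2]mulrS opprD addrC; congr (_ + _).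
have mo : ('X - c%:P) ^+ n.+1 \is monic.
  by apply: monic_exp; apply: monicXsubC.
have := monicP mo; rewrite lead_coefE size_exp_XsubC /= => ->; by rewrite mul1r.
Qed.

(** Finitely many series share a denominator D and a lower bound B; nonnegative valuation makes the
    first B D coefficients vanish, so they can be shifted away. *)
Lemma pofs_ex (fs : seq K) : (forall f, f \in fs -> pvge 0 f) ->
  exists D, forall f, f \in fs -> exists b, f = pofs D b.
Proof.
move=> hfs; have [D [B [D0 H]]] := prep_common fs; exists D.-1 => f ff.
have [a ha] := H f ff; have va := hfs f ff.
exists (Pser (fun s => scoef a (B * D + s)%N)); set b := Pser _.
have ea : a = sX L (B * D) * b.
  apply/pserP => s; rewrite sXE /=; case: leqP => [le|lt]; first by rewrite subnKC.
  have := va (s%:R / D%:R - B%:R); rewrite ha pemb_at //; apply.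
  have -> : 0 = (B * D)%N%:R / D%:R - B%:R :> rat.
    by rewrite natrM mulfK ?subrr // pnatr_eq0 -lt0n.
  by rewrite expo_lt.
have hp := prep_pofs D.-1 b; rewrite (prednK D0) in hp.
have := prep_scale B D0 (isT : (0 < 1)%N) hp.
have -> : ssub 1 b = b by apply/pserP => s; rewrite /= dvd1n divn1.
rewrite muln1 add0n -ea => h; exact: prep_inj ha h.
Qed.

Lemma pofs_inj D : injective (pofs (L := L) D).
Proof.
by move=> a b h; apply: (@pemb_inj L D.+1 0%N) => //; rewrite -(prep_pofs D a) h.
Qed.

Lemma pofs_at0 D b : pofs D b 0 = scoef b 0 :> L.
Proof.
rewrite (prep_pofs D b); have := @pemb_at L D.+1 0%N b 0%N isT.
by rewrite mul0r subr0.
Qed.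

(* Newton-Puiseux: kill the subleading coefficient, rescale so that the coefficients become integral
   with a nonzero residue, and split off by Hensel's lemma the part of a root of the reduction,
   whose multiplicity is not full since the subleading coefficient vanishes. *)
Lemma monic_puis_root n (p : {poly K}) : p \is monic -> size p = n.+2 -> exists x, root p x.
Proof.
elim/ltn_ind: n p => n IH p pm sp.
have v1 : pval (1 : K) 0 by exact: (pval_const (oner_neq0 L)).
have K0 : n.+1%:R != 0 :> K.
  by rewrite -(rmorph_nat (@pconst L)) fmorph_eq0.
pose c := p`_n / n.+1%:R; pose p1 := p \Po ('X - c%:P).
suff [x] : exists x, root p1 x.
  by rewrite /root horner_comp hornerXsubC => h; exists (x - c).
have sp1 : size p1 = n.+2 by rewrite size_comp_poly2 ?size_XsubC.
have p1m : p1 \is monic.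
  by apply/monicP; rewrite lead_coef_comp ?size_XsubC // lead_coefXsubC expr1n (monicP pm) mulr1.
have p1n : p1`_n = 0.
  rewrite coef_comp_poly sp !big_ord_recr /= big1 ?add0r => [|i _]; last first.
    by rewrite [X in _ * X]nth_default ?mulr0 // size_exp_XsubC.
  rewrite coef_XsubC_pred; have := monicP pm; rewrite lead_coefE sp /= => ->.
  have mo : ('X - c%:P) ^+ n \is monic by apply: monic_exp; apply: monicXsubC.
  have := monicP mo; rewrite lead_coefE size_exp_XsubC /= => ->.
  by rewrite mulr1 mul1r -mulr_natr /c divfK // subrr.
have p1N : p1`_n.+1 = 1 by have := monicP p1m; rewrite lead_coefE sp1.
move: {p pm sp c K0} p1 sp1 p1m p1n p1N => p sp pm pn pN.
case: (boolP [exists i : 'I_n.+1, p`_i != 0]) => [/existsP[i1 hi1]|/existsPn h]; last first.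
  exists 0; rewrite /root horner_coef sp big_ord_recr /= expr0n mulr0 addr0 big1 // => i _.
  by have := h i; rewrite negbK => /eqP ->; rewrite mul0r.
have /choice[v hv] : forall f : K, exists r, f != 0 -> pval f r.
  by move=> f; case: (eqVneq f 0) => [->|/pval_ex[r hr]]; [exists 0|exists r].
(* Up to sign, the slopes from the vertex (n+1, 0) of the Newton polygon. For the least one q, the
   substitution X = t^q Y gives coefficients of valuation v(p_i) - q (n+1-i) >= 0, with equality at
   [i0]. *)
pose ratio (i : 'I_n.+1) := v p`_i / (n.+1 - i)%:R.
have [i0 hi0 imin] : exists2 i0 : 'I_n.+1, p`_i0 != 0 &
    forall i : 'I_n.+1, p`_i != 0 -> ratio i0 <= ratio i.
  by case: (@arg_minP _ _ _ i1 (fun i : 'I_n.+1 => p`_i != 0) ratio hi1) => i ? ?; exists i.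
have di (i : 'I_n.+1) : (n.+1 - i)%:R != 0 :> rat by rewrite pnatr_eq0 subn_eq0 -ltnNge.
pose q := ratio i0; pose t : K := pmono q 1.
have t0 : t != 0 by apply: pval_neq0 (pval_mono _ q).
have vt m : pval (t ^- m) (- (q * m%:R)).
  have vtm : pval (t ^+ m) (q * m%:R).
    elim: m => [|m IHm]; first by rewrite mulr0.
    by rewrite exprS mulrSr mulrDr mulr1 addrC; apply: pvalM => //; apply: pval_mono.
  have [|r hr] := @pval_ex L (t ^- m); first by rewrite invr_eq0 expf_neq0.
  have h1 := pvalM vtm hr; rewrite divff ?expf_neq0 // in h1.
  have e := pval_uniq h1 v1.
  by rewrite (_ : - _ = r) //; apply/eqP; rewrite eq_sym -addr_eq0 addrC e.
pose p2 : {poly K} := \poly_(i < n.+2) (p`_i * t ^- (n.+1 - i)).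
suff [y ry] : exists y, root p2 y.
  exists (t * y); move: ry; rewrite /root /p2 horner_poly horner_coef sp.
  have -> : \sum_(i < n.+2) p`_i * (t * y) ^+ i =
            t ^+ n.+1 * \sum_(i < n.+2) p`_i * t ^- (n.+1 - i) * y ^+ i.
    rewrite mulr_sumr; apply: eq_bigr => i _; rewrite exprMn.
    have le : (i <= n.+1)%N by rewrite -ltnS.
    have -> : t ^+ n.+1 = t ^+ (n.+1 - i) * t ^+ i by rewrite -exprD subnK.
    set z := t ^+ (n.+1 - i).
    have z0 : z != 0 by rewrite expf_neq0.
    by field.
  by move=> /eqP ->; rewrite mulr0.
have c2 (i : nat) : (i < n.+2)%N -> p2`_i = p`_i * t ^- (n.+1 - i).
  by move=> lt; rewrite coef_poly lt.
have p2N : p2`_n.+1 = 1 by rewrite c2 // pN subnn expr0 invr1 mulr1.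
have p2n : p2`_n = 0 by rewrite c2 ?pn ?mul0r.
have v2 (i : 'I_n.+1) : p`_i != 0 -> pval p2`_i (v p`_i - q * (n.+1 - i)%:R).
  by move=> hi; rewrite c2; [apply: pvalM; [apply: hv|apply: vt]|apply: ltnW; rewrite ltnS].
have vge2 i : pvge 0 p2`_i.
  case: (ltnP i n.+1) => [lt|le].
    case: (eqVneq p`_i 0) => [e|hi]; first by rewrite c2 ?e ?mul0r // ltnW.
    rewrite (pvge_val _ (v2 (Ordinal lt) hi)) subr_ge0 /=.
    rewrite -ler_pdivlMr ?ltr0n ?subn_gt0 //; exact: (imin (Ordinal lt) hi).
  case: (ltngtP i n.+1) le => // [gt|->] _.
    by rewrite nth_default ?(leq_trans (size_poly _ _)).
  by rewrite p2N; apply/(pvge_val _ v1).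
have v20 : pval p2`_i0 0.
  by have := v2 i0 hi0; rewrite /q /ratio divfK // subrr.
have [D HD] := @pofs_ex [seq p2`_i | i <- iota 0 n.+2] (fun f => ltac:(by case/mapP => i _ ->)).
have /choice[b hb] : forall i, exists b, p2`_i = pofs D b.
  move=> i; case: (ltnP i n.+2) => [lt|le].
    by apply: HD; apply: map_f; rewrite mem_iota.
  by exists 0; rewrite rmorph0 nth_default // (leq_trans (size_poly _ _)).
have bN : b n.+1 = 1 by apply: (@pofs_inj D); rewrite -hb p2N rmorph1.
pose F : {poly pser L} := \poly_(i < n.+2) b i.
have Fc i : F`_i = b i.
  rewrite coef_poly; case: ltnP => // le; apply: (@pofs_inj D); rewrite -hb rmorph0.
  by rewrite nth_default // (leq_trans (size_poly _ _)).
have sF : size F = n.+2 by rewrite size_poly_eq // bN oner_neq0.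
have Fm : F \is monic by apply/monicP; rewrite lead_coefE sF /= Fc bN.
have eF : map_poly (pofs D) F = p2 by apply/polyP => i; rewrite coef_map /= Fc hb.
pose f : {poly L} := \poly_(i < n.+2) scoef (b i) 0.
have fc i : f`_i = p2`_i 0.
  rewrite coef_poly hb pofs_at0; case: ltnP => // le.
  by rewrite -Fc nth_default ?sF // scoef0.
have fN : f`_n.+1 = 1 by rewrite fc p2N /=.
have sf : size f = n.+2 by rewrite size_poly_eq // bN scoef1 oner_neq0.
have fm : f \is monic by apply/monicP; rewrite lead_coefE sf.
have [|z rz] := @Lclosed f; first by rewrite sf.
have [m [h /implyP/(_ (monic_neq0 fm)) nz ef]] := multiplicity_XsubC f z.
have m0 : (0 < m)%N.
  rewrite lt0n; apply: contra nz => /eqP m0; move: rz.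
  by rewrite ef m0 expr0 mulr1.
pose g0 := ('X - z%:P) ^+ m.
have g0m : g0 \is monic by apply: monic_exp; apply: monicXsubC.
have sg0 : size g0 = m.+1 by rewrite size_exp_XsubC.
have h0 : h != 0 by apply: contraNneq nz => ->; rewrite root0.
have sfm : (n.+2 = m + size h)%N.
  by rewrite -sf ef mulrC size_monicM // -/g0 sg0 addSn.
(* If m = n+1 then f = (X - z)^(n+1). Its coefficient of X^n is 0, so z = 0 in characteristic zero,
   and f = X^(n+1) contradicts the nonzero residue at [i0]. *)
have mn : (m < n.+1)%N.
  have : (0 < size h)%N by rewrite size_poly_gt0.
  case: (ltngtP (size h) 1) => [lt1 gt0|gt1 _|s1 _].
  - by [].
  - by move: sfm gt1; move: (size h) => s; lia.
  have hm : h \is monic by have := fm; rewrite ef (monicMr _ g0m).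
  have em : m = n.+1 by rewrite s1 in sfm; lia.
  have eh : h = 1.
    have := monicP hm; rewrite lead_coefE s1 /= => c1.
    by rewrite (size1_polyC (_ : (size h <= 1)%N)) ?s1 // c1.
  have := fc n; rewrite p2n ef eh mul1r em coef_XsubC_pred /= => /eqP.
  rewrite oppr_eq0 -mulr_natr mulf_eq0 (negbTE (L0 n)) orbF => /eqP z0.
  have := fc i0; rewrite ef eh mul1r z0 subr0 em coefXn.
  rewrite (ltn_eqF (ltn_ord i0)) => /esym e0; have [] := v20.
  by rewrite e0 eqxx.
have cop : coprimep g0 h by rewrite /g0 coprimep_expl // coprimep_sym coprimep_XsubC.
have F0 j : scoef F`_j 0 = (g0 * h)`_j by rewrite mulrC -ef fc Fc hb pofs_at0.
have [G [H [FGH Gm sG]]] := hensel Fm g0m cop F0.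
have [m' em] : exists m', m = m'.+1 by case: (m) m0 => // m' _; exists m'.
have [|||x rx] := IH m' _ (map_poly (pofs D) G).
- by lia.
- exact: monic_map.
- by rewrite size_map_poly_id0 ?sG ?sg0 ?em // (monicP Gm) rmorph1 oner_neq0.
by exists x; rewrite -eF FGH rmorphM rootM rx.
Qed.

Theorem puis_closed : alg_closed (puis L).
Proof.
move=> p sp; case: (eqVneq p 0) => [->|p0]; first by exists 0; apply: root0.
have l0 : lead_coef p != 0 by rewrite lead_coef_eq0.
have pm : (lead_coef p)^-1 *: p \is monic by apply/monicP; rewrite lead_coefZ mulVf.
have [n en] : exists n, size p = n.+2.
  by case: (size p) sp (size_poly_gt0 p) => [|[|n]] //; [rewrite p0|exists n].
have [|x] := monic_puis_root (n := n) pm; first by rewrite size_scale ?invr_eq0.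
by rewrite rootZ ?invr_eq0 // => rx; exists x.
Qed.

Lemma puis_char0 : char0 (puis L).
Proof. by move=> n; rewrite -(rmorph_nat (@pconst L)) fmorph_eq0. Qed.
End Roots.

(** * Multivariate polynomials *)

Lemma mpoly_hom_ext (n : nat) (R : comNzRingType) (S : comNzRingType)
    (h1 h2 : {rmorphism {mpoly R[n]} -> S}) :
  (forall c, h1 c%:MP = h2 c%:MP) -> (forall i, h1 'X_i = h2 'X_i) ->
  forall p, h1 p = h2 p.
Proof.
move=> hc hX p; rewrite [p]mpolyE !rmorph_sum; apply: eq_bigr => m _.
rewrite -mul_mpolyC !rmorphM hc; congr (_ * _).
rewrite mpolyXE_id !rmorph_prod; apply: eq_bigr => i _.
by rewrite !rmorphXn hX.
Qed.

Lemma mmap_ext (n : nat) (R S : nzRingType) (f : R -> S) (h1 h2 : 'I_n -> S) p :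
  h1 =1 h2 -> mmap f h1 p = mmap f h2 p.
Proof.
by move=> e; apply: eq_bigr => m _; congr (_ * _); apply: eq_bigr => i _; rewrite e.
Qed.

Lemma mmapXU (n : nat) (R S : nzRingType) (f : {rmorphism R -> S}) (h : 'I_n -> S) i :
  mmap f h 'X_i = h i.
Proof. by rewrite mmapX mmap1U. Qed.

Section Muni.
Variables (n : nat) (R : comNzRingType).
Local Notation widen := (widen_ord (leqnSn n)).

Lemma muniX (i : 'I_n) : muni ('X_(widen i) : {mpoly R[n.+1]}) = ('X_i)%:P.
Proof.
rewrite /muni mmapXU; case: splitP => [j eq|j].
  by congr ('X__)%:P; apply/val_inj; rewrite /= -eq.
by rewrite ord1 /= addn0 => /eqP; rewrite ltn_eqF.
Qed.

Lemma muniXmax : muni ('X_ord_max : {mpoly R[n.+1]}) = 'X.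
Proof.
rewrite /muni mmapXU; case: splitP => // -[j lt_jn] /= /eqP.
by have := lt_jn; rewrite ltn_neqAle eq_sym => /andP[/negbTE->].
Qed.

Lemma ord_widenP (P : 'I_n.+1 -> Prop) : (forall i, P (widen i)) -> P ord_max -> forall i, P i.
Proof.
move=> hw hm i; case: (ltnP i n) => [lt|ge].
  by have -> : i = widen (Ordinal lt) by apply: val_inj.
by have -> : i = ord_max by apply/val_inj/eqP; rewrite /= eqn_leq ge -ltnS ltn_ord.
Qed.

(** Splitting off the last variable is what drives the later inductions on the number of
    variables. *)
Lemma mmap_muni (S : comNzRingType) (f : {rmorphism R -> S}) (x : 'I_n.+1 -> S) p :
  mmap f x p = (map_poly (mmap f (fun i => x (widen i))) (muni p)).[x ord_max].
Proof.
pose h := (horner_eval (x ord_max) \o map_poly (mmap f (fun i => x (widen i))) \o @muni n R).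
apply: (@mpoly_hom_ext _ _ _ (mmap f x) h) => [c|].
  by rewrite /= mmapC muniC map_polyC /= horner_evalE hornerC mmapC.
apply: ord_widenP => [i|] /=; rewrite mmapXU ?muniX ?muniXmax.
  by rewrite map_polyC /= horner_evalE hornerC mmapXU.
by rewrite map_polyX horner_evalE hornerX.
Qed.

Definition unmuni : {rmorphism {poly {mpoly R[n]}} -> {mpoly R[n.+1]}} :=
  horner_eval ('X_ord_max) \o map_poly (@mwiden n R).

Lemma muniK p : unmuni (muni p) = p.
Proof.
apply: (@mpoly_hom_ext _ _ _ (unmuni \o @muni n R) idfun) => [c|].
  by rewrite /= muniC map_polyC /= horner_evalE hornerC mwidenC.
apply: ord_widenP => [i|] /=; rewrite ?muniX ?muniXmax.
  rewrite map_polyC /= horner_evalE hornerC mwidenX; congr mpolyX.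
  exact: mnmwiden1.
by rewrite map_polyX horner_evalE hornerX.
Qed.
End Muni.

Lemma poly_nonroot (R : idomainType) (p : {poly R}) (A : nat -> R) :
  injective A -> p != 0 -> exists k, p.[A k] != 0.
Proof.
move=> Ainj p0; apply: contrapT => h.
have : (size [seq A k | k <- iota 0 (size p)] < size p)%N.
  apply: max_poly_roots => //; last by rewrite map_inj_uniq ?iota_uniq.
  apply/allP => _ /mapP[k _ ->]; apply/eqP; apply: contrapT => hk.
  by apply: h; exists k; apply/eqP.
by rewrite size_map size_iota ltnn.
Qed.

Lemma mpoly0K (R : comNzRingType) : cancel (@meval 0 R (fun=> 0)) (@mpolyC 0 R).
Proof.
apply: (@mpoly_hom_ext _ _ _ (@mpolyC 0 R \o @meval 0 R (fun=> 0)) idfun) => [c|[]//].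
by rewrite /= mevalC.
Qed.

(** By induction the leading coefficient in the last variable stays nonzero, and then only finitely
    many values are excluded. Each variable has its own sequence of values, so that the point can be
    sought in a small neighbourhood of a given one. *)
Lemma mpoly_nonvanish (R : comNzRingType) (S : idomainType) (f : {rmorphism R -> S}) n
    (A : 'I_n -> nat -> S) (p : {mpoly R[n]}) :
  injective f -> (forall i, injective (A i)) -> p != 0 ->
  exists s : 'I_n -> nat, mmap f (fun i => A i (s i)) p != 0.
Proof.
move=> finj; elim: n A p => [|n IH] A p Ainj p0.
  exists (fun=> 0%N); apply: contraNneq p0; rewrite -(mpoly0K p) mmapC => /eqP.
  by rewrite -(rmorph0 f) (inj_eq finj) => /eqP ->.
have mp0 : muni p != 0 by apply: contraNneq p0 => e; rewrite -(muniK p) e rmorph0.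
have [|s hs] := IH (fun i => A (widen_ord (leqnSn n) i)) (lead_coef (muni p)) (fun i => Ainj _).
  by rewrite lead_coef_eq0.
set h := mmap f _ in hs; have q0 : map_poly h (muni p) != 0.
  apply: contraNneq hs => /polyP/(_ (size (muni p)).-1); rewrite coef_map coef0 => e.
  by apply/eqP; rewrite lead_coefE.
have [k hk] := poly_nonroot (Ainj ord_max) q0.
exists (fun i => if insub (val i) is Some j then s j else k).
rewrite mmap_muni; have eh : mmap f (fun i => A (widen_ord (leqnSn n) i)
    (if insub (val (widen_ord (leqnSn n) i)) is Some j then s j else k)) =1 h.
  move=> q; apply: mmap_ext => i /=; congr (A _ _).
  by case: insubP => [j _ e|]; [congr s; apply: val_inj|rewrite ltn_ord].
by rewrite (eq_map_poly eh) insubF ?ltnn.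
Qed.

(* Integral closedness in the field of fractions, stated without denominators. *)
Definition int_closed (R : idomainType) := forall (a b : R) (p : {poly R}),
  b != 0 -> p \is monic ->
  \sum_(i < size p) p`_i * a ^+ i * b ^+ ((size p).-1 - i) = 0 ->
  exists c, a = b * c.

Lemma int_closed_field (F : fieldType) : int_closed F.
Proof. by move=> a b p b0 _ _; exists (a / b); rewrite mulrCA divff ?mulr1. Qed.

Lemma int_closed_retract (R S : idomainType) (s : {rmorphism R -> S}) (t : {rmorphism S -> R}) :
  cancel s t -> int_closed S -> int_closed R.
Proof.
move=> st hS a b p b0 pm e; have sinj := can_inj st.
have sp : size (map_poly s p) = size p.
  by rewrite size_map_poly_id0 // (monicP pm) rmorph1 oner_neq0.
have [||| c ec] := hS (s a) (s b) (map_poly s p).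
- by rewrite -(rmorph0 s) (inj_eq sinj).
- exact: monic_map.
- rewrite sp -[RHS](rmorph0 s) -e rmorph_sum; apply: eq_bigr => i _.
  by rewrite coef_map !rmorphM !rmorphXn.
by exists (t c); rewrite -[a]st ec rmorphM st.
Qed.

(** * Integral closedness of polynomial rings *)

Section IntClosedPoly.
Variable R : idomainType.
Hypothesis RQ : forall n, exists u : R, u * n.+1%:R = 1.

Lemma natr_diff_unit m n : (m < n)%N -> exists u : R, u * (n%:R - m%:R) = 1.
Proof.
move=> lt; have [u hu] := RQ (n - m).-1; exists u; rewrite -natrB 1?ltnW //.
by rewrite prednK ?subn_gt0 // in hu.
Qed.

Lemma natr_injQ : injective (fun n : nat => n%:R : R).
Proof.
suff h m n : (m < n)%N -> m%:R != n%:R :> R.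
  move=> m n /= e; case: (ltngtP m n) => // /h; by rewrite e eqxx.
move=> /natr_diff_unit[u hu]; apply: contraPneq hu => ->.
by rewrite subrr mulr0 => /esym/eqP; rewrite oner_eq0.
Qed.

(** Divide C - C(n0) by X - n0. At n > n0 the quotient has the value (C(n) - C(n0))/(n - n0), still
    divisible by k because n - n0 is a unit; induct on the degree. *)
Lemma dvd_values (k : R) (C : {poly R}) (P : nat -> Prop) :
  (forall N, exists2 n, (N <= n)%N & P n) ->
  (forall n, P n -> exists e, C.[n%:R] = k * e) ->
  exists D, C = k *: D.
Proof.
have [d] := ubnP (size C); elim: d C P => // d IH C P sC Pinf PC.
case: (eqVneq C 0) => [->|C0]; first by exists 0; rewrite scaler0.
have [n0 _ Pn0] := Pinf 0%N; have [e he] := PC _ Pn0.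
have /factor_theorem[C1 eC] : root (C - C.[n0%:R]%:P) n0%:R.
  by rewrite /root hornerD hornerN hornerC subrr.
have sC1 : (size C1 < d)%N.
  case: (eqVneq C1 0) => [->|C10].
    rewrite size_poly0; have : (0 < size C)%N by rewrite size_poly_gt0.
    by move=> h; rewrite -ltnS; apply: leq_trans sC; rewrite ltnS.
  have : size (C1 * ('X - n0%:R%:P)) = (size C1).+1.
    by rewrite size_Mmonic ?monicXsubC // size_XsubC addnC.
  rewrite -eC => s1; rewrite -ltnS -s1; apply: leq_ltn_trans sC.
  apply: leq_trans (size_polyD _ _) _; rewrite geq_max leqnn size_polyN /=.
  by apply: leq_trans (size_polyC_leq1 _) _; rewrite size_poly_gt0.
have [||D hD] := IH C1 (fun n => P n /\ (n0 < n)%N) sC1.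
- move=> N; have [n le Pn] := Pinf (maxn N n0.+1); exists n.
    by apply: leq_trans le; apply: leq_maxl.
  by split=> //; apply: leq_trans le; apply: leq_maxr.
- move=> n [Pn lt]; have [e' he'] := PC _ Pn; have [u hu] := natr_diff_unit lt.
  exists (u * (e' - e)).
  have /(congr1 (fun p : {poly R} => p.[n%:R])) := eC.
  rewrite hornerD hornerN hornerC hornerM hornerXsubC he he' => h.
  by rewrite mulrCA mulrBr h mulrCA hu mulr1.
exists (e%:P + D * ('X - n0%:R%:P)).
by rewrite scalerDr scalerAl -hD -eC -mul_polyC -polyCM -he addrC subrK.
Qed.

(** The rational root argument: once a and b are replaced by coprime a' and b', the relation makes
    b' divide a power of a' up to scalars, so b' is constant. The scalar k pays for the
    denominators. *)
Lemma dvdp_of_int (a b : {poly R}) (p : {poly {poly R}}) : b != 0 -> p \is monic ->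
  \sum_(i < size p) p`_i * a ^+ i * b ^+ ((size p).-1 - i) = 0 ->
  exists2 k, k != 0 & exists C, k *: a = b * C.
Proof.
move=> b0 pm e; pose g := gcdp a b.
have g0 : g != 0 by rewrite gcdp_eq0 negb_and b0 orbT.
have /Pdiv.Idomain.dvdpP[[al a'] /= al0 ea] := dvdp_gcdl a b.
have /Pdiv.Idomain.dvdpP[[be b'] /= be0 eb] := dvdp_gcdr a b.
rewrite -/g in ea eb.
have b'0 : b' != 0.
  by apply: contraNneq b0 => b'0; move: eb; rewrite b'0 mul0r -mul_polyC => /eqP; rewrite mulf_eq0 polyC_eq0 (negbTE be0).
have cop : coprimep a' b'.
  have := gcdp_mul2r a' b' g; rewrite -ea -eb => h.
  rewrite /coprimep; have h2 : gcdp (al *: a) (be *: b) %= g.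
    exact: eqp_trans (gcdp_scalel _ _ al0) (gcdp_scaler _ _ be0).
  have : gcdp a' b' * g %= 1 * g by rewrite mul1r; apply: eqp_trans h2; rewrite eqp_sym.
  by rewrite eqp_mul2r // => /eqp_size ->; rewrite size_poly1.
have [n sp] : exists n, size p = n.+1.
  by exists (size p).-1; rewrite prednK // size_poly_gt0 monic_neq0.
rewrite sp /= in e.
have e2 : \sum_(i < n.+1) p`_i * (be *: a') ^+ i * (al *: b') ^+ (n - i) = 0.
  apply: (mulIf (expf_neq0 n g0)); rewrite mul0r.
  transitivity ((al * be) ^+ n *: \sum_(i < n.+1) p`_i * a ^+ i * b ^+ (n - i)); last first.
    by rewrite e scaler0.
  rewrite mulr_suml scaler_sumr; apply: eq_bigr => i _.
  have le : (i <= n)%N by rewrite -ltnS.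
  have -> : g ^+ n = g ^+ i * g ^+ (n - i) by rewrite -exprD subnKC.
  have -> : (al * be) ^+ n = (al * be) ^+ i * (al * be) ^+ (n - i) by rewrite -exprD subnKC.
  have h1 : (be *: a') ^+ i * g ^+ i = (al * be) ^+ i *: a ^+ i.
    by rewrite -exprMn -scalerAl -ea scalerA mulrC exprZn.
  have h2 : (al *: b') ^+ (n - i) * g ^+ (n - i) = (al * be) ^+ (n - i) *: b ^+ (n - i).
    by rewrite -exprMn -scalerAl -eb scalerA exprZn.
  transitivity (p`_i * ((be *: a') ^+ i * g ^+ i) * ((al *: b') ^+ (n - i) * g ^+ (n - i))).
    by ring.
  by rewrite h1 h2 -!mul_polyC; rewrite !polyCM; ring.
have dv : b' %| (be *: a') ^+ n.
  move: e2; rewrite big_ord_recr /= subnn mulr1 => /eqP; rewrite addrC addr_eq0.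
  have -> : p`_n = 1 by have := monicP pm; rewrite lead_coefE sp.
  rewrite mul1r => /eqP ->; rewrite dvdpNr; apply: (big_ind (fun q => b' %| q)) => [|x y|i _].
  - exact: dvdp0.
  - exact: dvdp_add.
  have [m ->] : exists m, (n - i)%N = m.+1 by exists (n - i.+1)%N; rewrite subnSK.
  by rewrite exprS -scalerAl -scalerAr dvdpZr // mulrCA dvdp_mulIl.
have sb' : size b' = 1%N.
  apply/eqP; rewrite -[_ == _]coprimepp; apply: coprimep_dvdl dv _.
  by rewrite coprimep_sym; apply: coprimep_expl; rewrite coprimepZl.
have [ka ka0 eka] : exists2 ka, ka != 0 & b' = ka%:P.
  by have /size_poly1P[ka h1 h2] := introT eqP sb'; exists ka.
exists (ka * al); first by rewrite mulf_neq0.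
exists (be *: a'); rewrite -scalerA ea -scalerAr [RHS]scalerAl eb.
by rewrite eka -!mul_polyC; ring.
Qed.

(** Specialization of the variable to integers reduces to R: where b(n) is nonzero it divides a(n),
    so k divides C(n), and [dvd_values] removes the factor k. *)
Lemma int_closed_poly : int_closed R -> int_closed {poly R}.
Proof.
move=> hR a b p b0 pm e.
have [k k0 [C eC]] := dvdp_of_int b0 pm e.
have [||D eD] := @dvd_values k C (fun n => b.[n%:R] != 0).
- move=> N; have inj : injective (fun n => (N + n)%:R : R).
    by move=> x y /natr_injQ/addnI.
  by have [n hn] := poly_nonroot inj b0; exists (N + n)%N; rewrite ?leq_addr.
- move=> n bn; have sp : size (map_poly (horner_eval (n%:R : R)) p) = size p.
    by rewrite size_map_poly_id0 // (monicP pm) rmorph1 oner_neq0.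
  have [|||c ec] := hR a.[n%:R] b.[n%:R] (map_poly (horner_eval (n%:R : R)) p) => //.
  - exact: monic_map.
  - rewrite sp -[RHS](rmorph0 (horner_eval (n%:R : R))) -e rmorph_sum; apply: eq_bigr => i _.
    by rewrite coef_map !rmorphM !rmorphXn.
  exists c; apply: (mulfI bn); rewrite mulrCA -ec -hornerM -eC hornerZ.
  by [].
exists D; have : k *: a = k *: (b * D) by rewrite eC eD scalerAr.
by rewrite -!mul_polyC; apply: mulfI; rewrite polyC_eq0.
Qed.
End IntClosedPoly.

Lemma int_closed_mpoly (F : fieldType) n : (forall n, n.+1%:R != 0 :> F) ->
  int_closed {mpoly F[n]}.
Proof.
move=> F0; elim: n => [|n IH].
  by apply: int_closed_retract (@mpoly0K F) _; apply: int_closed_field.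
apply: int_closed_retract (@muniK n F) _; apply: int_closed_poly => // m.
by exists (m.+1%:R^-1)%:MP; rewrite -(rmorph_nat (@mpolyC n F)) -rmorphM mulVf ?rmorph1.
Qed.

(** * A differential field of iterated Puiseux series *)

Lemma pofs_const (L : fieldType) D (c : L) : pofs D (sconst c) = pconst c.
Proof. by apply: (prep_inj (prep_pofs D _)); apply: prep_pconst. Qed.

Lemma pofs_t (L : fieldType) : pofs 0 (sX L 1) = pmono 1 1.
Proof.
apply: (prep_inj (prep_pofs 0 _)).
by have := @prep_mono L 1%N 0%N 1%N isT; rewrite divr1 subr0.
Qed.

(** A polynomial evaluated at t is the power series with the same coefficients, so t is
    transcendental over L. *)
Lemma puis_t_free (L : fieldType) (p : {poly L}) :
  (map_poly (@pconst L) p).[pmono 1 1] = 0 -> p = 0.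
Proof.
have -> : (map_poly (@pconst L) p).[pmono 1 1] = pofs 0 (Pser (fun l => p`_l)).
  rewrite horner_coef size_map_poly -pofs_t.
  have sXn l : sX L 1 ^+ l = sX L l.
    by elim: l => [|l IH]; rewrite ?sX0 // exprS IH -sXD.
  rewrite (eq_bigr (fun l : 'I_(size p) => pofs 0 (sX L l * sconst p`_l))); last first.
    by move=> l _; rewrite coef_map /= -(pofs_const 0) -rmorphXn -rmorphM sXn mulrC.
  rewrite -rmorph_sum; congr (pofs _ _); apply/pserP => l; rewrite scoef_sum.
  rewrite (eq_bigr (fun i : 'I_(size p) => if i == l :> nat then p`_l else 0)); last first.
    move=> i _; rewrite sXE /=; case: (ltngtP i l) => // [lt|->]; last by rewrite subnn.
    by rewrite subn_eq0 leqNgt lt.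
  rewrite /=; case: (ltnP l (size p)) => [lt|le].
    rewrite (bigD1 (Ordinal lt)) //= eqxx big1 ?addr0 // => i ne.
    by rewrite (negbTE (_ : i != l :> nat)).
  by rewrite nth_default // big1 // => i _; rewrite if_same.
rewrite -(rmorph0 (pofs (L := L) 0)) => /pofs_inj/pserP h.
by apply/polyP => l; rewrite coef0 -[RHS](scoef0 L l) -h.
Qed.

(** One Puiseux extension per variable. Only the valuation of the outermost variable is kept; for it
    the earlier variables are constants of valuation 0. Earlier derivations act on coefficients, the
    new one is t d/dt. *)
Theorem series_field (F : fieldType) (r : nat) : alg_closed F -> char0 F ->
  exists (K : fieldType) (i : {rmorphism F -> K}) (x : nat -> K) (E : nat -> K -> K)
         (vge : rat -> K -> Prop),
  [/\ alg_closed K, char0 K, valuation vge &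
      forall f : {mpoly F[r]}, mmap i (fun j => x (val j)) f = 0 -> f = 0] /\
  [/\ forall j, derivation (E j), forall j c, E j (i c) = 0,
      forall j l, (l < r)%N -> E j (x l) = if j == l then x l else 0 &
      forall j q a, vge q a -> vge q (E j a)] /\
  [/\ forall c, vge 0 (i c), forall c q, 0 < q -> vge q (i c) -> c = 0,
      forall j, (j < r)%N -> x j != 0 /\ vge 0 (x j) &
      (0 < r)%N -> vge 1 (x r.-1)].
Proof.
move=> Fc F0; elim: r => [|r [K [i [x [E [vge [[Kc K0 _ xfree] [[Eder Ei Ex _] _]]]]]]]].
  (* Without variables the valuation is the trivial one, equal to 0 at every nonzero element. *)
  exists F, idfun, (fun=> 0), (fun _ _ => 0), (fun q a => (a == 0) || (q <= 0)).
  split; split=> //.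
  - split; first split.
    + by move=> q; rewrite eqxx.
    + move=> q a b /orP[/eqP->|->]; last by rewrite !orbT.
      by rewrite add0r.
    + move=> p q a b /orP[/eqP->|hp]; first by rewrite mul0r eqxx.
      move=> /orP[/eqP->|hq]; first by rewrite mulr0 eqxx.
      by rewrite orbC -[0]addr0 lerD.
    + move=> p q a b /negP; rewrite negb_or -ltNge => /andP[a0 hp].
      move=> /negP; rewrite negb_or -ltNge => /andP[b0 hq]; apply/negP.
      by rewrite negb_or -ltNge mulf_neq0 // addr_gt0.
    + by move=> p q a pq /orP[->//|hq]; rewrite (le_trans pq hq) orbT.
    by move=> a a0; exists 1; rewrite (negbTE a0).
  - move=> f; rewrite -(mpoly0K f) mmapC /= => ->; exact: rmorph0.
  - split.
    + by move=> j; split=> a b; rewrite ?mulr0 ?mul0r addr0.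
    + by [].
    + by [].
    + by move=> j q a _; rewrite eqxx.
  - split=> //; first by move=> c; rewrite lexx orbT.
    by move=> c q q0 /orP[/eqP//|]; rewrite leNgt q0.
pose t : puis K := pmono 1 1.
exists (puis K), (@pconst K \o i), (fun j => if (j < r)%N then pconst (x j) else t),
  (fun j => if j == r then @euler K else pmap (Eder j)), (@pvge K).
have vt : pval t 1 := pval_mono K 1.
have vc (c : K) : pvge 0 (pconst c).
  case: (eqVneq c 0) => [->|c0]; first by rewrite rmorph0.
  by rewrite (pvge_val _ (pval_const c0)).
have der j : derivation (if j == r then @euler K else pmap (Eder j)).
  by case: eqP => _; [apply: (euler_der K0)|apply: pmap_der].
have E1 j : E j 1 = 0 by rewrite -(rmorph1 i) Ei.
split; split.
- exact: puis_closed.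
- exact: puis_char0.
- exact: pvge_valuation.
- move=> f; rewrite mmap_muni /= ltnn => h.
  suff : muni f = 0 by move=> e; rewrite -(muniK f) e rmorph0.
  apply/polyP => s; rewrite coef0; apply: xfree.
  have eq_h : mmap (@pconst K \o i) (fun j : 'I_r =>
      (if (widen_ord (leqnSn r) j < r)%N then pconst (x j) else t)) =1
      @pconst K \o mmap i (fun j => x (val j)).
    move=> q; rewrite /= /mmap rmorph_sum; apply: eq_bigr => m _.
    rewrite rmorphM; congr (_ * _); rewrite /mmap1 rmorph_prod; apply: eq_bigr => j _.
    by rewrite rmorphXn ltn_ord.
  move: h; rewrite (eq_map_poly eq_h) map_poly_comp => /puis_t_free/polyP/(_ s).
  by rewrite coef_map coef0.
- split=> // [j c|j l|j q a].
  + by case: eqP => _; rewrite /= ?(euler_const K0) // pmap_const Ei rmorph0.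
  + rewrite ltnS => le; case: (ltnP l r) => [lt|ge].
      case: (j =P r) => [->|_]; first by rewrite (euler_const K0) (gtn_eqF lt).
      by rewrite pmap_const Ex //; case: eqP; rewrite ?rmorph0.
    have -> : l = r by apply/eqP; rewrite eqn_leq le ge.
    by case: (j =P r) => _; [apply: (euler_t K0)|apply: pmap_mono].
  + by case: eqP => _; [apply: euler_vge|apply: pmap_vge].
split=> [c|c q q0|j _|_].
- exact: vc.
- move=> h; apply/eqP; apply: contraT => c0; move: h.
  by rewrite /= (pvge_val _ (pval_const _)) ?fmorph_eq0 // leNgt q0.
- case: ifP => lt.
    split; last exact: vc.
    rewrite fmorph_eq0; have := xfree 'X_(Ordinal lt); rewrite mmapXU /=.
    move=> h; apply/eqP => /h /eqP; rewrite -msize_poly_eq0 msizeX.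
    by rewrite mdeg1.
  by split; [apply: pval_neq0 vt|rewrite (pvge_val _ vt)].
- by rewrite ltnn (pvge_val _ vt).
Qed.

(** * Noether normalization *)

Lemma natr_inj0 (k : fieldType) : char0 k -> injective (fun n : nat => n%:R : k).
Proof.
move=> k0; suff lt m n : (m < n)%N -> m%:R != n%:R :> k.
  by move=> m n /= e; case: (ltngtP m n) => // /lt; rewrite e eqxx.
move=> lt; rewrite eq_sym -subr_eq0 -natrB 1?ltnW //.
by rewrite -[(n - m)%N]prednK ?subn_gt0.
Qed.

Lemma integral_sum (R K : comNzRingType) (f : {rmorphism R -> K}) (I : Type) (r : seq I)
    (P : pred I) (x : I -> K) :
  (forall i, P i -> integralOver f (x i)) -> integralOver f (\sum_(i <- r | P i) x i).
Proof.
move=> h; apply: (big_ind (integralOver f)) => //; first exact: integral0.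
by move=> a b; apply: integral_add.
Qed.

Section IntegralCoefficients.
Variables (R : comNzRingType) (K : fieldType) (f : {rmorphism R -> K}).

Definition int_coefs (p : {poly K}) := forall i, integralOver f p`_i.

Lemma int_coefs1 : int_coefs 1.
Proof. by move=> i; rewrite coef1; case: eqP => _; [apply: integral1|apply: integral0]. Qed.

Lemma int_coefsD p q : int_coefs p -> int_coefs q -> int_coefs (p + q).
Proof. by move=> hp hq i; rewrite coefD; apply: integral_add. Qed.

Lemma int_coefsM p q : int_coefs p -> int_coefs q -> int_coefs (p * q).
Proof.
by move=> hp hq i; rewrite coefM; apply: integral_sum => j _; apply: integral_mul.
Qed.

Lemma int_coefsX : int_coefs 'X.
Proof. by move=> i; rewrite coefX; case: eqP => _; [apply: integral1|apply: integral0]. Qed.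

Lemma int_coefsC c : integralOver f c -> int_coefs c%:P.
Proof. by move=> hc i; rewrite coefC; case: eqP => // _; apply: integral0. Qed.

Lemma int_coefs_prod (I : Type) (r : seq I) (P : pred I) (p : I -> {poly K}) :
  (forall i, P i -> int_coefs (p i)) -> int_coefs (\prod_(i <- r | P i) p i).
Proof.
by move=> h; apply: (big_ind int_coefs) => //; [apply: int_coefs1|apply: int_coefsM].
Qed.

Lemma int_coefs_exp p n : int_coefs p -> int_coefs (p ^+ n).
Proof.
move=> hp; elim: n => [|n IH]; first exact: int_coefs1.
by rewrite exprS; apply: int_coefsM.
Qed.

Lemma int_coefs_sum (I : eqType) (r : seq I) (p : I -> {poly K}) :
  (forall i, int_coefs (p i)) -> int_coefs (\sum_(i <- r) p i).
Proof.
move=> h; apply: (big_ind int_coefs) => //; last exact: int_coefsD.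
by move=> i; rewrite coef0; apply: integral0.
Qed.

Lemma integral_root (p : {poly K}) x :
  lead_coef p != 0 -> integralOver f (lead_coef p)^-1 -> int_coefs p -> root p x ->
  integralOver f x.
Proof.
move=> l0 lint pint rx; apply: (@integral_root_monic _ _ f x ((lead_coef p)^-1 *: p)).
- by apply/monicP; rewrite lead_coefZ mulVf.
- by rewrite rootZ // invr_eq0.
by apply/integral_poly => i; rewrite coefZ; apply: integral_mul.
Qed.
End IntegralCoefficients.

Lemma integral_mmap (F K : fieldType) (R : comNzRingType) (i : {rmorphism F -> K})
    (f : {rmorphism R -> K}) n (u : 'I_n -> K) (p : {mpoly F[n]}) :
  (forall c, integralOver f (i c)) -> (forall j, integralOver f (u j)) ->
  integralOver f (mmap i u p).
Proof.
move=> hc hu; apply: integral_sum => m _; apply: integral_mul => //.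
apply: (big_ind (integralOver f)) => [||j _]; [exact: integral1|exact: integral_mul|].
by elim: (m j) => [|k IH]; rewrite ?exprS; [apply: integral1|apply: integral_mul].
Qed.

Lemma integral_tower (R S : comNzRingType) (K : fieldType) (f : {rmorphism R -> K})
    (g : {rmorphism S -> K}) x :
  (forall s, integralOver f (g s)) -> integralOver g x -> integralOver f x.
Proof.
move=> h [p pm rx]; apply: (integral_root_monic _ rx); first exact: monic_map.
by apply/integral_poly => k; rewrite coef_map; apply: h.
Qed.

Section NoetherStep.
Variables (F K : fieldType) (i : {rmorphism F -> K}) (r : nat) (u : 'I_r.+1 -> K).
Hypothesis F0 : char0 F.
Variable f : {mpoly F[r.+1]}.
Hypotheses (f0 : f != 0) (fu : mmap i u f = 0).
Local Notation widen := (widen_ord (leqnSn r)).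

Lemma coefM_top (A : comNzRingType) (p q : {poly A}) d e :
  (size p <= d.+1)%N -> (size q <= e.+1)%N ->
  (size (p * q)%R <= (d + e).+1)%N /\ (p * q)`_(d + e) = p`_d * q`_e.
Proof.
move=> sp sq; split.
  by apply: leq_trans (size_polyMleq _ _) _; move: sp sq; move: (size p) (size q) => a b; lia.
have lt : (d < (d + e).+1)%N by rewrite ltnS leq_addr.
rewrite coefM (bigD1 (Ordinal lt)) //= addKn big1 ?addr0 // => j nj.
have {}nj : j != d :> nat by [].
case: (ltngtP j d) nj => // h _.
  by rewrite [q`__]nth_default ?mulr0 //; apply: leq_trans sq _; rewrite ltn_subRL ltn_add2r.
by rewrite nth_default ?mul0r // (leq_trans sp).
Qed.

(** Set the last variable to 1 in the form of top degree of f. Nothing cancels, since in a fixed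
    degree the other exponents determine the last one; the resulting nonzero polynomial is nonzero
    at some point with natural coordinates. *)
Lemma noether_coef : exists c : 'I_r -> F,
  \sum_(m <- msupp f | mdeg m == (msize f).-1) f@_m * \prod_(j < r) c j ^+ m (widen j) != 0.
Proof.
pose h : {mpoly F[r]} := \sum_(m <- msupp f | mdeg m == (msize f).-1)
  f@_m *: 'X_[[multinom m (widen j) | j < r]].
have h0 : h != 0.
  have m0 := mlead_supp f0; have d0 : mdeg (mlead f) = (msize f).-1 by rewrite -mlead_deg.
  apply/eqP => /(congr1 (mcoeff [multinom (mlead f) (widen j) | j < r])).
  rewrite mcoeff0 /h raddf_sum big_mkcond (bigD1_seq (mlead f)) ?msupp_uniq //= d0 eqxx.
  rewrite mcoeffZ mcoeffX eqxx mulr1 big1 ?addr0 => [|m ne]; last first.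
    case: eqP => // dm; rewrite mcoeffZ mcoeffX; case: eqP => [e|]; last by rewrite mulr0.
    case/eqP: ne; apply/mnmP; have ew j : m (widen j) = mlead f (widen j).
      by have := congr1 (fun x : 'X_{1..r} => x j) e; rewrite !mnmE.
    apply: ord_widenP => [//|]; have : mdeg m = mdeg (mlead f) by rewrite dm.
    by rewrite !mdegE !big_ord_recr /= (eq_bigr _ (fun j _ => ew j)) => /addnI.
  by move/eqP; rewrite mleadc_eq0 (negbTE f0).
have [s hs] := @mpoly_nonvanish F F idfun r (fun=> fun n => n%:R) h (fun x y e => e)
  (fun=> natr_inj0 F0) h0.
exists (fun j => (s j)%:R); move: hs; rewrite /h rmorph_sum /=.
congr (_ != _); apply: eq_bigr => m _; rewrite mmapZ mmapX; congr (_ * _).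
by apply: eq_bigr => j _; rewrite mnmE.
Qed.

(** After u_j = u'_j + c_j u_max, the relation f is an equation for u_max whose leading coefficient
    is the nonzero constant of [noether_coef]. *)
Lemma noether_step : exists c : 'I_r -> F,
  integralOver (mmap i (fun j => u (widen j) - i (c j) * u ord_max)) (u ord_max).
Proof.
have [c hc] := noether_coef; exists c.
set u' := fun j => _; set a := \sum_(m <- _ | _) _ in hc.
pose lin j : {poly K} := (u' j)%:P + (i (c j)) *: 'X.
pose x (j : 'I_r.+1) : {poly K} := if insub (val j) is Some j' then lin j' else 'X.
have xw j : x (widen j) = lin j.
  rewrite /x; case: insubP => [j' _ e|]; last by rewrite /= ltn_ord.
  by congr lin; apply: val_inj.
have xm : x ord_max = 'X by rewrite /x insubF //= ltnn.
pose G := mmap (polyC \o i) x f.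
have Gu : G.[u ord_max] = 0.
  rewrite -fu -horner_evalE /G /mmap rmorph_sum; apply: eq_bigr => m _.
  rewrite rmorphM /= horner_evalE hornerC; congr (_ * _).
  rewrite rmorph_prod; apply: eq_bigr => j _; rewrite rmorphXn; congr (_ ^+ _).
  elim/ord_widenP: j => [j|]; rewrite ?xw ?xm /= horner_evalE ?hornerX //.
  by rewrite /lin hornerD hornerC hornerZ hornerX /u' subrK.
have top (m : 'X_{1..r.+1}) : (size (mmap1 x m) <= (mdeg m).+1)%N /\
    (mmap1 x m)`_(mdeg m) = \prod_(j < r) i (c j) ^+ m (widen j).
  have xtop (p : {poly K}) k : (size p <= 2)%N ->
      (size (p ^+ k)%R <= k.+1)%N /\ (p ^+ k)`_k = p`_1 ^+ k.
    move=> sp; elim: k => [|k [IH1 IH2]]; first by rewrite size_poly1 coef1.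
    have [s1 s2] := coefM_top sp IH1.
    by rewrite exprS; split; [apply: s1|rewrite -[k.+1]/(1 + k)%N s2 IH2 exprS].
  have linsize j : (size (lin j) <= 2)%N.
    apply: leq_trans (size_polyD _ _) _; rewrite geq_max (leq_trans (size_polyC_leq1 _)) //=.
    by apply: leq_trans (size_scale_leq _ _) _; rewrite size_polyX.
  have lin1 j : (lin j)`_1 = i (c j) by rewrite coefD coefC coefZ coefX mulr1 add0r.
  have [t1 t2] := xtop 'X (m ord_max) (eq_leq (size_polyX _)).
  rewrite /mmap1 mdegE !big_ord_recr /= xm.
  have [s1 s2] : (size (\prod_(j < r) x (widen j) ^+ m (widen j))%R <=
      (\sum_(j < r) m (widen j)).+1)%N /\
      (\prod_(j < r) x (widen j) ^+ m (widen j))`_(\sum_(j < r) m (widen j)) =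
      \prod_(j < r) i (c j) ^+ m (widen j).
    elim/big_rec3: _ => [|j k q y _ [h1 h2]]; first by rewrite size_poly1 coef1.
    have [p1 p2] := xtop (lin j) (m (widen j)) (linsize j).
    have [q1 q2] := coefM_top p1 h1.
    by rewrite xw; split; [apply: q1|rewrite q2 p2 h2 lin1].
  have [q1 q2] := coefM_top s1 t1.
  by split; [apply: q1|rewrite q2 s2 t2 coefX expr1n mulr1].
have sG : (size G <= (msize f).-1.+1)%N.
  apply: leq_trans (size_sum _ _ _) _; apply/bigmax_leqP_seq => m mf _.
  rewrite mul_polyC; apply: leq_trans (size_scale_leq _ _) _; apply: leq_trans (top m).1 _.
  by rewrite ltnS -ltnS prednK ?msize_mdeg_lt // lt0n msize_poly_eq0.
have Ga : G`_(msize f).-1 = i a.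
  rewrite /G /mmap coef_sum /a [X in i X]big_mkcond rmorph_sum; apply: eq_big_seq => m mf.
  rewrite coefCM /=; case: eqP => [<-|ne].
    rewrite (top m).2 rmorphM rmorph_prod; congr (_ * _).
    by apply: eq_bigr => j _; rewrite rmorphXn.
  rewrite rmorph0 nth_default ?mulr0 //; apply: leq_trans (top m).1 _.
  have : (mdeg m < msize f)%N by apply: msize_mdeg_lt.
  by move: ne; case: (msize f) => // k /eqP ne; rewrite ltnS leq_eqVlt (negbTE ne).
have ia0 : i a != 0 by rewrite fmorph_eq0.
have lG : lead_coef G = i a.
  suff esz : (size G).-1 = (msize f).-1 by rewrite lead_coefE esz.
  have sG2 : ((msize f).-1 < size G)%N.
    by rewrite ltnNge; apply/negP => le; move: ia0; rewrite -Ga nth_default ?eqxx.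
  by move: sG sG2; move: (size G) (msize f).-1 => sz e; lia.
have ic e : integralOver (mmap i u') (i e).
  by have := integral_id (mmap i u') e%:MP; rewrite /= mmapC.
apply: (@integral_root _ _ _ G); rewrite ?lG //.
- by rewrite -fmorphV.
- apply: int_coefs_sum => m; apply: int_coefsM; first exact: int_coefsC.
  apply: int_coefs_prod => j _; apply: int_coefs_exp; elim/ord_widenP: j => [j|].
    rewrite xw; apply: int_coefsD.
      by apply: int_coefsC; have := integral_id (mmap i u') 'X_j; rewrite /= mmapXU.
    by rewrite -mul_polyC; apply: int_coefsM; [apply: int_coefsC|apply: int_coefsX].
  by rewrite xm; apply: int_coefsX.
by rewrite /root Gu.
Qed.
End NoetherStep.

(** Take the least r such that every b_t is integral over r polynomials in b; a relation among these
    would lower r by [noether_step]. The new coordinates are recorded as polynomials U_j, so that a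
    specialization of b carries them along. *)
Theorem noether (F K : fieldType) (i : {rmorphism F -> K}) M (b : 'I_M -> K) : char0 F ->
  exists r (U : 'I_r -> {mpoly F[M]}),
    injective (mmap i (fun j => mmap i b (U j)) : {mpoly F[r]} -> K) /\
    forall t, integralOver (mmap i (fun j => mmap i b (U j)) : {mpoly F[r]} -> K) (b t).
Proof.
move=> F0.
pose Q r := exists U : 'I_r -> {mpoly F[M]},
  forall t, integralOver (mmap i (fun j => mmap i b (U j)) : {mpoly F[r]} -> K) (b t).
have ex : exists r, `[< Q r >].
  exists M; apply/asboolP; exists (fun t => 'X_t) => t.
  have := integral_id (mmap i (fun j => mmap i b 'X_j)) ('X_t : {mpoly F[M]}).
  by rewrite /= !mmapXU.
case: (ex_minnP ex) => r /asboolP[U hU] rmin; exists r, U; split=> //.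
set j := mmap _ _; suff inj f : j f = 0 -> f = 0.
  by move=> f g /eqP; rewrite -subr_eq0 -rmorphB => /eqP/inj/eqP; rewrite subr_eq0 => /eqP.
move=> jf; apply/eqP; apply: contraT => f0.
case: r U hU rmin @j f jf f0 => [|r] U hU rmin j f jf f0.
  by move: f0; rewrite -(mpoly0K f); move: jf; rewrite -(mpoly0K f) /j mmapC => /eqP;
    rewrite fmorph_eq0 => /eqP ->; rewrite rmorph0 eqxx.
have [c hc] := noether_step F0 f0 jf.
suff /asboolP/rmin : Q r by rewrite ltnn.
exists (fun l => U (widen_ord (leqnSn r) l) - (c l)%:MP * U ord_max) => t.
set j' := mmap _ _; have ej : j' = mmap i (fun l => mmap i b (U (widen_ord (leqnSn r) l)) -
     i (c l) * mmap i b (U ord_max)).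
  apply: funext => g; apply: mmap_ext => l.
  by rewrite rmorphB rmorphM /= mmapC.
have ic e : integralOver j' (i e) by have := integral_id j' e%:MP; rewrite /= mmapC.
have hm : integralOver j' (mmap i b (U ord_max)) by rewrite ej.
have hw l : integralOver j' (mmap i b (U (widen_ord (leqnSn r) l))).
  have -> : mmap i b (U (widen_ord (leqnSn r) l)) =
      j' 'X_l + i (c l) * mmap i b (U ord_max).
    by rewrite /j' mmapXU rmorphB rmorphM /= mmapC subrK.
  apply: integral_add; [exact: integral_id|exact: integral_mul].
apply: integral_tower (hU t) => s; apply: integral_mmap => //.
by elim/ord_widenP.
Qed.

(** * Minimal polynomials over an integrally closed domain *)

Lemma closed_split (k : fieldType) (p : {poly k}) : alg_closed k -> p != 0 ->
  exists s : seq k, p = lead_coef p *: \prod_(x <- s) ('X - x%:P).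
Proof.
move=> kc; have [n] := ubnP (size p); elim: n p => // n IH p sp p0.
case: (eqVneq (size p) 1%N) => [s1|s1].
  by exists [::]; rewrite big_nil lead_coefE s1 alg_polyC; apply: size1_polyC; rewrite s1.
have [x /factor_theorem[q eq]] := kc p s1.
have q0 : q != 0 by apply: contraNneq p0 => q0; rewrite eq q0 mul0r.
have [|s es] := IH q _ q0.
  by move: sp; rewrite eq size_Mmonic ?monicXsubC // size_XsubC addn2.
exists (x :: s); rewrite big_cons {1}eq {1}es.
by rewrite eq lead_coefM lead_coefXsubC mulr1 -scalerAl mulrC.
Qed.

Section MinimalPolynomial.
Variables (R : idomainType) (E : fieldType) (j : {rmorphism R -> E}) (z : E).
Hypotheses (Ec : alg_closed E) (jinj : injective j) (Rint : int_closed R).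
Hypothesis zint : integralOver j z.

Lemma int_closedE (a b : R) : b != 0 -> integralOver j (j a / j b) -> exists c, a = b * c.
Proof.
move=> b0 [p pm /eqP rp]; apply: (Rint b0 pm); apply: jinj; rewrite rmorph0.
have jb0 : j b != 0 by rewrite -(rmorph0 j) (inj_eq jinj).
have [n sp] : exists n, size p = n.+1.
  by exists (size p).-1; rewrite prednK // size_poly_gt0 monic_neq0.
transitivity (j b ^+ n * (map_poly j p).[j a / j b]); last by rewrite rp mulr0.
rewrite horner_coef size_map_poly_id0 ?(monicP pm) ?rmorph1 ?oner_neq0 // sp /=.
rewrite rmorph_sum mulr_sumr; apply: eq_bigr => i _.
have le : (i <= n)%N by rewrite -ltnS.
rewrite coef_map !rmorphM !rmorphXn /= expr_div_n.
have -> : j b ^+ n = j b ^+ (n - i) * j b ^+ i by rewrite -exprD subnK.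
have x0 : j b ^+ i != 0 by rewrite expf_neq0.
by field.
Qed.

(** A polynomial G of least degree killing z divides, up to scalars, a monic S0 killing z. So the
    roots of G are integral, and so are the coefficients of G over its leading one; these lie in the
    fraction field of R, hence in R. Division by the monic quotient is then exact. *)
Lemma min_poly : exists P : {poly R}, [/\ P \is monic, root (map_poly j P) z &
  forall Q, root (map_poly j Q) z -> exists S, Q = S * P].
Proof.
have szj (p : {poly R}) : size (map_poly j p) = size p by apply: size_map_inj_poly; rewrite ?rmorph0.
have [S0 S0m S0z] := zint.
have ex : exists n, `[< exists G : {poly R}, [/\ G != 0, root (map_poly j G) z & size G = n] >].
  by exists (size S0); apply/asboolP; exists S0; rewrite monic_neq0.
case: (ex_minnP ex) => n /asboolP[G [G0 Gz sG]] nmin.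
have minG (Q : {poly R}) : root (map_poly j Q) z -> (size Q < size G)%N -> Q = 0.
  move=> Qz; rewrite sG ltnNge => lt; apply/eqP; apply: contraNT lt => Q0.
  by apply: nmin; apply/asboolP; exists Q.
have divG (Q : {poly R}) : root (map_poly j Q) z ->
    exists k S, lead_coef G ^+ k *: Q = S * G.
  move=> Qz; have e := Pdiv.ComRing.rdivp_eq G Q.
  exists (Pdiv.Ring.rscalp Q G), (Pdiv.Ring.rdivp Q G).
  rewrite e (_ : Pdiv.Ring.rmodp Q G = 0) ?addr0 //; apply: minG; last exact: Pdiv.Ring.ltn_rmodpN0.
  have -> : Pdiv.Ring.rmodp Q G = lead_coef G ^+ Pdiv.Ring.rscalp Q G *: Q - Pdiv.Ring.rdivp Q G * G.
    by rewrite e addrC addKr.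
  rewrite /root rmorphB rmorphM /= map_polyZ /= hornerD hornerN hornerZ hornerM.
  by rewrite (eqP Qz) (eqP Gz) !mulr0 subr0.
have [k [C eC]] := divG S0 S0z.
have jG0 : map_poly j G != 0 by rewrite -size_poly_gt0 szj size_poly_gt0.
have [s es] := closed_split Ec jG0.
have lG : lead_coef (map_poly j G) = j (lead_coef G) by rewrite !lead_coefE szj coef_map.
have a0 : lead_coef G != 0 by rewrite lead_coef_eq0.
have ja0 : j (lead_coef G) != 0 by rewrite -(rmorph0 j) (inj_eq jinj).
have sint x : x \in s -> integralOver j x.
  move=> xs; exists S0 => //.
  have Gx : root (map_poly j G) x.
    by rewrite es rootZ ?lG // root_prod_XsubC.
  have : root (map_poly j (lead_coef G ^+ k *: S0)) x.
    by rewrite eC rmorphM /= rootM Gx orbT.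
  by rewrite map_polyZ rootZ //= rmorphXn expf_neq0.
have pint : int_coefs j (\prod_(x <- s) ('X - x%:P)).
  rewrite big_seq; apply: int_coefs_prod => x xs; apply: int_coefsD; first exact: int_coefsX.
  by rewrite -rmorphN; apply: int_coefsC; apply: integral_opp; apply: sint.
have /choice[c hc] i : exists c, G`_i = lead_coef G * c.
  apply: int_closedE => //.
  have -> : j G`_i = j (lead_coef G) * (\prod_(x <- s) ('X - x%:P))`_i.
    by rewrite -coef_map es lG coefZ.
  by rewrite mulrAC divff // mul1r.
pose P : {poly R} := \poly_(i < size G) c i.
have eG : G = lead_coef G *: P.
  apply/polyP => i; rewrite coefZ coef_poly; case: ltnP => [_|le]; first exact: hc.
  by rewrite mulr0 nth_default.
have sP : size P = size G by rewrite -(size_scale P a0) -eG.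
have Pm : P \is monic.
  by apply/monicP; apply: (mulfI a0); rewrite mulr1 -lead_coefZ -eG.
have Pz : root (map_poly j P) z.
  by move: Gz; rewrite {1}eG map_polyZ rootZ.
exists P; split=> // Q Qz.
exists (Pdiv.Ring.rdivp Q P); have e := Pdiv.RingMonic.rdivp_eq Pm Q.
rewrite {1}e (_ : Pdiv.Ring.rmodp Q P = 0) ?addr0 //; apply: minG.
  have -> : Pdiv.Ring.rmodp Q P = Q - Pdiv.Ring.rdivp Q P * P by rewrite {2}e addrC addKr.
  rewrite /root rmorphB rmorphM /= hornerD hornerN hornerM.
  by rewrite (eqP Qz) (eqP Pz) !mulr0 subr0.
by rewrite -sP; apply: Pdiv.Ring.ltn_rmodpN0; apply: monic_neq0.
Qed.
End MinimalPolynomial.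

(** * Extension of specializations *)

Section Specialization.
Variables (R : comNzRingType) (E : fieldType) (j : {rmorphism R -> E}) (b : E).

(** [j] may kill leading coefficients. Truncation keeps the image and makes the degrees before and
    after [j] agree, as pseudo-division arguments require. *)
Lemma map_truncate (Q : {poly R}) :
  exists Q', map_poly j Q' = map_poly j Q /\ size Q' = size (map_poly j Q).
Proof.
pose Q' := \poly_(i < size (map_poly j Q)) Q`_i; exists Q'.
have e : map_poly j Q' = map_poly j Q.
  apply/polyP => i; rewrite !coef_map coef_poly; case: ltnP => // le.
  by rewrite raddf0 -coef_map nth_default.
split=> //; apply/eqP; rewrite eqn_leq size_poly -{1}e.
rewrite /= map_polyE; apply: leq_trans (size_Poly _) _; by rewrite size_map.
Qed.

Lemma truncate_lead (Q : {poly R}) : size Q = size (map_poly j Q) -> map_poly j Q != 0 ->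
  j (lead_coef Q) != 0.
Proof.
move=> s q0; rewrite lead_coefE s -coef_map -lead_coefE.
by rewrite lead_coef_eq0.
Qed.

(* Up to denominators, [P] generates the ideal of the polynomials vanishing at [b]. *)
Lemma bezout_at (P s : {poly R}) :
  size P = size (map_poly j P) -> map_poly j P != 0 ->
  (map_poly j P).[b] = 0 ->
  (forall Q : {poly R}, (map_poly j Q).[b] = 0 -> (size (map_poly j Q) < size P)%N ->
     map_poly j Q = 0) ->
  (map_poly j s).[b] != 0 ->
  exists c A B, j c != 0 /\ map_poly j (A * s + B * P) = (j c)%:P.
Proof.
move=> sP P0 Pb Pmin sb.
have ex : exists n, `[< exists A B, map_poly j (A * s + B * P) != 0 /\
    size (map_poly j (A * s + B * P)) = n >].
  by exists (size (map_poly j P)); apply/asboolP; exists 0, 1; rewrite mul0r mul1r add0r.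
case: (ex_minnP ex) => n /asboolP[A0 [B0 [W00 sW0]]] nmin.
have [W [eW sW]] := map_truncate (A0 * s + B0 * P).
have {}nmin A B : (size (map_poly j (A * s + B * P)) < size W)%N ->
    map_poly j (A * s + B * P) = 0.
  move=> lt; apply/eqP; apply: contraTT lt => nz; rewrite -leqNgt sW sW0.
  by apply: nmin; apply/asboolP; exists A, B.
rewrite -eW in W00 sW.
have l0 := truncate_lead sW W00.
case: (ltnP 1 (size W)) => [W1|W1]; last first.
  exists (lead_coef W), A0, B0; split=> //; rewrite -eW.
  have e1 : size W = 1%N.
    by apply/eqP; rewrite eqn_leq W1 sW size_poly_gt0.
  rewrite lead_coefE e1 [map_poly j W]size1_polyC ?coef_map // -sW e1 //.
have red A B : exists k S, (j (lead_coef W)) ^+ k *: map_poly j (A * s + B * P) =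
    map_poly j S * map_poly j W.
  pose Q := A * s + B * P; have e := Pdiv.ComRing.rdivp_eq W Q.
  set k := Pdiv.Ring.rscalp Q W in e; set S := Pdiv.Ring.rdivp Q W in e.
  exists k, S; pose rm := Pdiv.Ring.rmodp Q W.
  have erm : rm = lead_coef W ^+ k *: Q - S * W by rewrite e addrC addKr.
  suff h : map_poly j rm = 0.
    transitivity (map_poly j (lead_coef W ^+ k *: Q)); first by rewrite map_polyZ rmorphXn.
    by rewrite e rmorphD rmorphM /= [X in _ + X]h addr0.
  have erm2 : map_poly j rm = map_poly j ((lead_coef W ^+ k *: A - S * A0) * s +
      (lead_coef W ^+ k *: B - S * B0) * P).
    have -> : (lead_coef W ^+ k *: A - S * A0) * s + (lead_coef W ^+ k *: B - S * B0) * P =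
      lead_coef W ^+ k *: Q - S * (A0 * s + B0 * P).
      by rewrite /Q -!mul_polyC; ring.
    by rewrite erm !rmorphB !rmorphM /= eW.
  rewrite erm2; apply: nmin; rewrite -erm2.
  have W0 : W != 0 by rewrite -size_poly_gt0 ltnW.
  apply: leq_ltn_trans (Pdiv.Ring.ltn_rmodpN0 Q W0).
  by rewrite map_polyE; apply: leq_trans (size_Poly _) _; rewrite size_map.
have [k [S eS]] := red 1 0; have [k' [S' eS']] := red 0 1.
rewrite mul1r mul0r addr0 in eS; rewrite mul0r mul1r add0r in eS'.
have Wb : (map_poly j W).[b] != 0.
  apply: contraNneq sb => Wb; have := congr1 (fun p : {poly E} => p.[b]) eS.
  rewrite hornerZ hornerM Wb mulr0 => /eqP; rewrite mulf_eq0 expf_eq0 (negbTE l0) andbF /=.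
  by [].
have S'b : (map_poly j S').[b] = 0.
  have := congr1 (fun p : {poly E} => p.[b]) eS'.
  rewrite hornerZ hornerM Pb mulr0 => /esym/eqP; rewrite mulf_eq0 (negbTE Wb) orbF.
  by move/eqP.
have S'0 : map_poly j S' != 0.
  apply: contraNneq P0 => h; move: eS'; rewrite h mul0r => /eqP.
  by rewrite scaler_eq0 expf_eq0 (negbTE l0) andbF.
case/eqP: S'0; apply: Pmin => //.
have := congr1 (fun p : {poly E} => size p) eS'.
have S'0 : map_poly j S' != 0.
  apply: contraNneq P0 => h; move: eS'; rewrite h mul0r => /eqP.
  by rewrite scaler_eq0 expf_eq0 (negbTE l0) andbF.
rewrite size_scale ?expf_neq0 // -sP size_mul // -sW => ->.
by move: W1; move: (size W) (size (map_poly j S')) => x y; lia.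
Qed.

Variable (K : fieldType).
Hypotheses (Kc : alg_closed K) (K0 : char0 K).

(** In other words g factors through the image of f: the specialization f(r) -> g(r) is well
    defined. *)
Definition compatible (S : comNzRingType) (f : {rmorphism S -> E}) (g : {rmorphism S -> K}) :=
  forall r, f r = 0 -> g r = 0.

Lemma map_compat (g : {rmorphism R -> K}) (p q : {poly R}) : compatible j g ->
  map_poly j p = map_poly j q -> map_poly g p = map_poly g q.
Proof.
move=> c e; apply/polyP => i; rewrite !coef_map; apply/eqP.
rewrite -subr_eq0 -rmorphB; apply/eqP/c; rewrite rmorphB; apply/eqP.
by rewrite subr_eq0 -!coef_map e.
Qed.

(** If b is transcendental over the image of j, any value off the roots of g(s) serves. Otherwise
    the value is a root of g(P), with P of least degree killing b; a relation A s + B P = c keeps s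
    nonzero there, and [s0] is c times the leading coefficient of P. *)
Lemma extend_one (s : {poly R}) : (map_poly j s).[b] != 0 ->
  exists2 s0 : R, j s0 != 0 & forall g : {rmorphism R -> K}, compatible j g -> g s0 != 0 ->
    exists be : K, (forall Q : {poly R}, (map_poly j Q).[b] = 0 -> (map_poly g Q).[be] = 0) /\
      (map_poly g s).[be] != 0.
Proof.
move=> sb.
case: (pselect (exists Q : {poly R}, (map_poly j Q).[b] = 0 /\ map_poly j Q != 0)) => alg;
    last first.
  have s0 : map_poly j s != 0 by apply: contraNneq sb => ->; rewrite horner0.
  have [s' [es ss]] := map_truncate s.
  rewrite -es in s0 ss; exists (lead_coef s'); first exact: truncate_lead.
  move=> g cg gs.
  have gs0 : map_poly g s != 0.
    rewrite -(map_compat cg es); apply: contraNneq gs => h.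
    by rewrite lead_coefE -coef_map h coef0.
  have [k hk] := poly_nonroot (natr_inj0 K0) gs0.
  exists k%:R; split=> // Q Qb; suff -> : map_poly g Q = 0 by rewrite horner0.
  have Q0 : map_poly j Q = map_poly j 0.
    by rewrite rmorph0; apply: contrapT => nz; case: alg; exists Q; split=> //; apply/eqP.
  by rewrite (map_compat cg Q0) rmorph0.
have ex : exists n, `[< exists Q : {poly R}, [/\ (map_poly j Q).[b] = 0,
    map_poly j Q != 0 & size (map_poly j Q) = n] >].
  by have [Q [h1 h2]] := alg; exists (size (map_poly j Q)); apply/asboolP; exists Q.
case: (ex_minnP ex) => n /asboolP[P1 [P1b P10 sP1]] nmin.
have [P [eP sP]] := map_truncate P1; rewrite -eP in P1b P10 sP1 sP.
have Pmin Q : (map_poly j Q).[b] = 0 -> (size (map_poly j Q) < size P)%N -> map_poly j Q = 0.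
  move=> Qb lt; apply/eqP; apply: contraTT lt => nz; rewrite -leqNgt sP sP1.
  by apply: nmin; apply/asboolP; exists Q.
have l0 := truncate_lead sP P10.
have [c [A [B [c0 eAB]]]] := bezout_at sP P10 P1b Pmin sb.
exists (lead_coef P * c); first by rewrite rmorphM mulf_neq0.
move=> g cg; rewrite rmorphM mulf_eq0 negb_or => /andP[gl gc].
have sgP : size (map_poly g P) = size P by rewrite size_map_poly_id0.
have [|be rbe] := @Kc (map_poly g P).
  rewrite sgP sP; apply/negP => /eqP h.
  move: P1b P10; rewrite (size1_polyC (eq_leq h)) hornerC => ->.
  by rewrite eqxx.
exists be; split=> [Q Qb|].
  have e := Pdiv.ComRing.rdivp_eq P Q.
  set k := Pdiv.Ring.rscalp Q P in e; set S := Pdiv.Ring.rdivp Q P in e.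
  set rm := Pdiv.Ring.rmodp Q P in e.
  have rm0 : map_poly j rm = map_poly j 0.
    rewrite rmorph0; apply: Pmin.
      have -> : rm = lead_coef P ^+ k *: Q - S * P by rewrite e addrC addKr.
      rewrite rmorphB rmorphM /= map_polyZ hornerD hornerN hornerZ hornerM.
      by rewrite Qb P1b !mulr0 subr0.
    have Pn0 : P != 0 by apply: contraNneq P10 => ->; rewrite rmorph0.
    apply: leq_ltn_trans (Pdiv.Ring.ltn_rmodpN0 Q Pn0).
    by rewrite map_polyE; apply: leq_trans (size_Poly _) _; rewrite size_map.
  have := congr1 (fun p => (map_poly g p).[be]) e.
  rewrite map_polyZ hornerZ rmorphD rmorphM /= hornerD hornerM (eqP rbe) mulr0.
  rewrite (map_compat cg rm0) rmorph0 horner0 addr0 => /eqP.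
  by rewrite mulf_eq0 rmorphXn expf_eq0 (negbTE gl) andbF /= => /eqP.
have eAB' : map_poly j (A * s + B * P) = map_poly j c%:P by rewrite eAB map_polyC.
have := map_compat cg eAB'; rewrite map_polyC => /(congr1 (fun p : {poly K} => p.[be])).
rewrite hornerC rmorphD !rmorphM /= hornerD !hornerM (eqP rbe) mulr0 addr0 => h.
by apply: contraNneq gc => z; rewrite -h z mulr0.
Qed.
End Specialization.

(** As in Chevalley's theorem on constructible sets: [extend_one] treats the last coordinate over
    the polynomial ring in the others, and the exceptional element it returns is the [s] of the next
    stage. *)
Theorem extend_all (R : comNzRingType) (E K : fieldType) (j : {rmorphism R -> E}) n
    (y : 'I_n -> E) (s : {mpoly R[n]}) :
  alg_closed K -> char0 K -> mmap j y s != 0 ->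
  exists2 s0 : R, j s0 != 0 & forall g : {rmorphism R -> K}, compatible j g -> g s0 != 0 ->
    exists y' : 'I_n -> K, compatible (mmap j y) (mmap g y') /\ mmap g y' s != 0.
Proof.
move=> Kc K0; elim: n y s => [|n IH] y s hs.
  exists (s.@[fun=> 0]); first by move: hs; rewrite -{1}(mpoly0K s) mmapC.
  move=> g cg gs; exists (fun=> 0); split; last by rewrite -(mpoly0K s) mmapC.
  by move=> r; rewrite /= -(mpoly0K r) !mmapC; apply: cg.
rewrite mmap_muni in hs.
have [s1 hs1 ext1] := extend_one Kc K0 hs.
have [s0 hs0 ext0] := IH _ _ hs1; exists s0 => // g cg gs0.
have [y1 [c1 n1]] := ext0 g cg gs0; have [be [h1 h2]] := ext1 _ c1 n1.
pose y' (l : 'I_n.+1) := if insub (val l) is Some l' then y1 l' else be.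
have yw : (fun l => y' (widen_ord (leqnSn n) l)) = y1.
  apply: funext => l; rewrite /y'; case: insubP => [l' _ e|]; last by rewrite /= ltn_ord.
  by congr y1; apply: val_inj.
have ym : y' ord_max = be by rewrite /y' insubF //= ltnn.
exists y'; split=> [f|]; last by rewrite mmap_muni yw ym.
by rewrite /= !mmap_muni yw ym; apply: h1.
Qed.

(** * Approximation by points of the image of a polynomial map *)

Section Valued.
Variables (K : fieldType) (vge : rat -> K -> Prop).
Hypotheses (V : valuation vge) (v1 : vge 0 1) (vm1 : vge 0 (-1)).

Lemma vge0 q : vge q 0. Proof. by case: V => [[]]. Qed.
Lemma vgeD q a b : vge q a -> vge q b -> vge q (a + b). Proof. by case: V => [[]] ? h *; apply: h. Qed.
Lemma vgeM p q a b : vge p a -> vge q b -> vge (p + q) (a * b).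
Proof. by case: V => [[]] ? ? h *; apply: h. Qed.
Lemma vge_mul_strict p q a b : ~ vge p a -> ~ vge q b -> ~ vge (p + q) (a * b).
Proof. by case: V => [[]] ? ? ? h *; apply: h. Qed.
Lemma vge_le p q a : p <= q -> vge q a -> vge p a.
Proof. by case: V => [[_ _ _ _ h] _] le hv; exact: (h _ _ _ le hv). Qed.
Lemma vge_bounded a : a != 0 -> exists q, ~ vge q a. Proof. by case: V => _ h /h. Qed.
Lemma vgeMl q a b : vge 0 a -> vge q b -> vge q (a * b).
Proof. by move=> ha hb; rewrite -[q]add0r; apply: vgeM. Qed.
Lemma vgeMr q a b : vge q a -> vge 0 b -> vge q (a * b).
Proof. by move=> ha hb; rewrite -[q]addr0; apply: vgeM. Qed.
Lemma vgeN q a : vge q a -> vge q (- a).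
Proof. by move=> h; rewrite -mulN1r; apply: vgeMl. Qed.
Lemma vgeB q a b : vge q a -> vge q b -> vge q (a - b).
Proof. by move=> ha hb; apply/vgeD/vgeN. Qed.
Lemma vge_sum q (I : Type) (r : seq I) (P : pred I) (x : I -> K) :
  (forall i, P i -> vge q (x i)) -> vge q (\sum_(i <- r | P i) x i).
Proof. by move=> h; apply: (big_ind (vge q)) => //; [apply: vge0|apply: vgeD]. Qed.
Lemma vgeX a n : vge 0 a -> vge 0 (a ^+ n).
Proof. by move=> h; elim: n => [|n IH] //; rewrite exprS; apply: vgeMl. Qed.
Lemma vge_nat n : vge 0 n%:R.
Proof. by elim: n => [|n IH]; [apply: vge0|rewrite -addn1 natrD; apply: vgeD]. Qed.

(** Membership of both sides in the valuation ring is included so that congruences can be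
    multiplied. *)
Definition vcong (B : rat) (a b : K) := [/\ vge 0 a, vge 0 b & vge B (a - b)].

Lemma vcongD B a b c d : vcong B a b -> vcong B c d -> vcong B (a + c) (b + d).
Proof.
move=> [a0 b0 ab] [c0 d0 cd]; split; [exact: vgeD|exact: vgeD|].
by rewrite opprD addrACA; apply: vgeD.
Qed.

Lemma vcongM B a b c d : vcong B a b -> vcong B c d -> vcong B (a * c) (b * d).
Proof.
move=> [a0 b0 ab] [c0 d0 cd]; split; [exact: vgeMl|exact: vgeMl|].
have -> : a * c - b * d = (a - b) * c + b * (c - d) by ring.
by apply: vgeD; [apply: vgeMr|apply: vgeMl].
Qed.

Lemma vcong_refl B a : vge 0 a -> vcong B a a.
Proof. by move=> h; split=> //; rewrite subrr; apply: vge0. Qed.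

Lemma vcong_sum B (I : Type) (r : seq I) (P : pred I) (x y : I -> K) :
  (forall i, P i -> vcong B (x i) (y i)) ->
  vcong B (\sum_(i <- r | P i) x i) (\sum_(i <- r | P i) y i).
Proof.
move=> h; apply: (big_ind2 (vcong B)) => //; first by apply: vcong_refl; apply: vge0.
by move=> *; apply: vcongD.
Qed.

Lemma vcongX B a b n : vcong B a b -> vcong B (a ^+ n) (b ^+ n).
Proof.
move=> h; elim: n => [|n IH]; first by rewrite !expr0; apply: vcong_refl.
by rewrite !exprS; apply: vcongM.
Qed.

Lemma vcong_mmap (F : fieldType) (i : {rmorphism F -> K}) n (x y : 'I_n -> K) B (f : {mpoly F[n]}) :
  (forall c, vge 0 (i c)) -> (forall j, vcong B (x j) (y j)) ->
  vcong B (mmap i x f) (mmap i y f).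
Proof.
move=> hi h; apply: vcong_sum => m _; apply: vcongM; first by apply: vcong_refl.
apply: (big_ind2 (vcong B)) => [||j _]; first by apply: vcong_refl.
  by move=> *; apply: vcongM.
exact: vcongX.
Qed.

Lemma vcong_horner (R : nzRingType) (g h : {rmorphism R -> K}) (p : {poly R}) B x y :
  (forall r, vcong B (g r) (h r)) -> vcong B x y ->
  vcong B (map_poly g p).[x] (map_poly h p).[y].
Proof.
move=> gh xy; have sz f : (size (map_poly (f : {rmorphism R -> K}) p) <= size p)%N.
  by rewrite map_polyE; apply: leq_trans (size_Poly _) _; rewrite size_map.
rewrite !(horner_coef_wide _ (sz _)); apply: vcong_sum => i _.
by rewrite !coef_map; apply: vcongM; [apply: gh|apply: vcongX].
Qed.

Lemma prod_not_vge (T : rat) (I : eqType) (s : seq I) (x : I -> K) : s != [::] ->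
  (forall i, i \in s -> ~ vge T (x i)) -> ~ vge (T * (size s)%:R) (\prod_(i <- s) x i).
Proof.
elim: s => // a [|b s] IH _ h.
  by rewrite big_seq1 /= mulr1; apply: h; rewrite mem_head.
rewrite big_cons /= mulrSr mulrDr mulr1 addrC; apply: vge_mul_strict; first by apply: h; rewrite mem_head.
by apply: IH => // i iI; apply: h; rewrite inE iI orbT.
Qed.

(** If every x - r had valuation below T, their product p(x) would have valuation below T deg p <=
    B. *)
Lemma near_root (T B : rat) (p : {poly K}) (s : seq K) x :
  p = \prod_(r <- s) ('X - r%:P) -> s != [::] -> T * (size s)%:R <= B -> vge B p.[x] ->
  exists2 r, r \in s & vge T (x - r).
Proof.
move=> -> s0 hB; rewrite horner_prod => h; apply: contrapT => no.
have := @prod_not_vge T _ s (fun r => ('X - r%:P).[x]) s0 _; apply.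
  by move=> r rs; rewrite hornerXsubC => hr; apply: no; exists r.
exact: vge_le hB h.
Qed.

(** If v(x) < 0 then v(1/x) >= 0, and the equation divided by a power of x expresses x as a
    polynomial in 1/x with coefficients in the valuation ring. *)
Lemma integral_vge (p : {poly K}) x : p \is monic -> (forall i, vge 0 p`_i) -> p.[x] = 0 -> vge 0 x.
Proof.
move=> pm pint px; apply: contrapT => nx.
have x0 : x != 0 by apply: contra_notN nx => /eqP ->; apply: vge0.
have vi : vge 0 x^-1.
  apply: contrapT => ni; have := vge_mul_strict nx ni; rewrite addr0 divff //.
have [n sp] : exists n, size p = n.+1.
  by exists (size p).-1; rewrite prednK // size_poly_gt0 monic_neq0.
case: n sp => [|n] sp.
  have := monicP pm; rewrite lead_coefE sp => p0; move: px.
  by rewrite (size1_polyC (eq_leq sp)) hornerC p0 => /eqP; rewrite oner_eq0.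
apply: nx; move: px; rewrite horner_coef sp big_ord_recr /=.
have -> : p`_n.+1 = 1 by have := monicP pm; rewrite lead_coefE sp.
rewrite mul1r => /eqP; rewrite addrC addr_eq0 => /eqP e.
have -> : x = - \sum_(i < n.+1) p`_i * x^-1 ^+ (n - i).
  have xn0 : x ^+ n != 0 by rewrite expf_neq0.
  apply: (mulIf xn0); rewrite -exprS e mulNr; congr (- _); rewrite mulr_suml.
  apply: eq_bigr => i _; rewrite -mulrA; congr (_ * _).
  have le : (i <= n)%N by rewrite -ltnS.
  have -> : x ^+ n = x ^+ (n - i) * x ^+ i by rewrite -exprD subnK.
  by rewrite mulrA -exprMn mulVf // expr1n mul1r.
apply: vgeN; apply: vge_sum => i _; apply: vgeMl => //; exact: vgeX.
Qed.

Lemma finite_not_vge (I : finType) (x : I -> K) : exists q, forall i, x i != 0 -> ~ vge q (x i).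
Proof.
have /choice[q hq] i : exists q, x i != 0 -> ~ vge q (x i).
  by case: (eqVneq (x i) 0) => [_|/vge_bounded[q hq]]; [exists 0|exists q].
exists (\sum_i `|q i|) => i xi h; apply: (hq i xi); apply: vge_le h.
rewrite (bigD1 i) //=; apply: le_trans (ler_norm _) _; rewrite lerDl.
by apply: sumr_ge0 => j _; apply: normr_ge0.
Qed.
End Valued.

Lemma horner_map_comp (R S T : comNzRingType) (h : {rmorphism S -> T}) (rho : {rmorphism R -> S})
    (g : {rmorphism R -> T}) (P : {poly R}) X :
  (forall a, g a = h (rho a)) -> (map_poly g P).[h X] = h (map_poly rho P).[X].
Proof.
by move=> e; rewrite -horner_map -map_poly_comp; congr (_.[_]); apply: eq_map_poly.
Qed.

Lemma mmap_mmap (F : fieldType) (S : comNzRingType) (i : {rmorphism F -> S}) n m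
    (x : 'I_m -> S) (U : 'I_n -> {mpoly F[m]}) f :
  mmap i (fun l => mmap i x (U l)) f = mmap i x (mmap (@mpolyC m F) U f).
Proof.
apply: (@mpoly_hom_ext _ _ _ (mmap i (fun l => mmap i x (U l)))
  (mmap i x \o mmap (@mpolyC m F) U)) => [c|l] /=; first by rewrite !mmapC.
by rewrite !mmapXU.
Qed.

(** Each vector d_i is read as the coefficients of a polynomial; n is chosen off the roots of the
    product of the finitely many nonzero ones. *)
Lemma separating_powers (K : fieldType) (I : finType) M (d : I -> 'I_M -> K) : char0 K ->
  exists n : nat, forall i, \sum_(t < M) n%:R ^+ t * d i t = 0 -> forall t, d i t = 0.
Proof.
move=> K0; pose D i : {poly K} := \sum_(t < M) d i t *: 'X^t.
have DE i x : (D i).[x] = \sum_(t < M) x ^+ t * d i t.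
  by rewrite horner_sum; apply: eq_bigr => t _; rewrite hornerZ hornerXn mulrC.
have D0 i : D i = 0 -> forall t, d i t = 0.
  move=> /polyP h t; have := h t; rewrite coef0 coef_sum (bigD1 t) //=.
  rewrite coefZ coefXn eqxx mulr1 big1 ?addr0 // => l nl.
  by rewrite coefZ coefXn eq_sym (negbTE (_ : l != t :> nat)) ?mulr0.
have P0 : \prod_(i | D i != 0) D i != 0 by apply/prodf_neq0.
have [n hn] := poly_nonroot (natr_inj0 K0) P0; exists n => i; rewrite -DE => Di.
apply: D0; apply/eqP; apply: contraNT hn => nz.
by rewrite (bigD1 i) //= hornerM Di mul0r.
Qed.

Section Dense.
Variables (F E K : fieldType) (iE : {rmorphism F -> E}) (iK : {rmorphism F -> K}).
Hypotheses (F0 : char0 F) (Ec : alg_closed E) (Kc : alg_closed K) (K0 : char0 K).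
Variables (N M : nat) (y : 'I_N -> E) (Psi : 'I_M -> {mpoly F[N]}) (w : 'I_M -> K).
Variables (vge : rat -> K -> Prop) (th : K).
Hypotheses (V : valuation vge) (vi : forall c, vge 0 (iK c)).
Hypotheses (th0 : th != 0) (vth : vge 1 th) (w0 : forall t, vge 0 (w t)).
Local Notation b := (fun t => mmap iE y (Psi t)).
Hypothesis spec : forall f : {mpoly F[M]}, mmap iE b f = 0 -> mmap iK w f = 0.

(* Let b = Psi(y), let F[u] be a Noether normalization of F[b], and z a combination of the b_t which
   tells w from the finitely many other points over u(w).  As F[u] is integrally closed, the minimal
   polynomial Q of z over it is monic with coefficients in F[u].  Perturbing u(w) generically to u'
   moves the roots of Q little, hence z(w) to a nearby root of Q at u', over which there is a point
   Psi(y'); it is close to a point over u(w), which is w by the choice of z. *)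
Theorem dense_image (C : rat) : exists y' : 'I_N -> K, forall t, vge C (mmap iK y' (Psi t) - w t).
Proof.
have v1 : vge 0 1 by rewrite -(rmorph1 iK); apply: vi.
have vm1 : vge 0 (-1) by rewrite -(rmorph1 iK) -rmorphN; apply: vi.
have [r [U [jinj bint]]] := noether iE b F0.
pose R := {mpoly F[r]}.
pose j : {rmorphism R -> E} := mmap iE (fun l => mmap iE b (U l)).
pose g0 : {rmorphism R -> K} := mmap iK (fun l => mmap iK w (U l)).
pose rho : {rmorphism R -> {mpoly F[M]}} := mmap (@mpolyC M F) U.
have specP (P : {poly R}) X : (map_poly j P).[mmap iE b X] = 0 -> (map_poly g0 P).[mmap iK w X] = 0.
  rewrite (@horner_map_comp _ _ _ (mmap iE b) rho) => [/spec h|a]; last exact: mmap_mmap.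
  by rewrite (@horner_map_comp _ _ _ (mmap iK w) rho) // => a; apply: mmap_mmap.
have /choice[P hP] t : exists P : {poly R}, [/\ P \is monic, (map_poly j P).[b t] = 0 &
    (map_poly g0 P).[w t] = 0].
  have [P Pm /eqP Pb] := bint t; exists P; split=> //.
  by have := specP P 'X_t; rewrite !mmapXU; apply.
have /choice[rts hrts] t : exists s : seq K, map_poly g0 (P t) = \prod_(x <- s) ('X - x%:P) /\
    s != [::].
  have [Pm _ Pw] := hP t; have gm : map_poly g0 (P t) \is monic by apply: monic_map.
  have [s es] := closed_split Kc (monic_neq0 gm); exists s.
  rewrite (monicP gm) scale1r in es; split=> //.
  by apply: contra_eqN Pw => /eqP s0; rewrite es s0 big_nil hornerC oner_neq0.
pose D := \max_t size (rts t).
have szD t : (size (rts t) <= D)%N by apply: leq_bigmax.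
(* The candidates over u(w) are the tuples with one root of the specialized equation P_t for each t;
   [phi] indexes them, and [n0] lets z tell each of them from w. *)
have [n0 hn0] := @separating_powers K {ffun 'I_M -> 'I_D} M
  (fun phi t => (rts t)`_(phi t) - w t) K0.
pose Z : {mpoly F[M]} := \sum_(t < M) (n0%:R ^+ t)%:MP * 'X_t.
have ZE (S : comNzRingType) (i : {rmorphism F -> S}) x :
    mmap i x Z = \sum_(t < M) n0%:R ^+ t * x t.
  rewrite rmorph_sum; apply: eq_bigr => t _.
  by rewrite rmorphM /= mmapC /= mmapXU rmorphXn rmorph_nat.
have zint : integralOver j (mmap iE b Z).
  apply: integral_mmap => [c|t]; last exact: bint.
  by have := integral_id j c%:MP; rewrite /= mmapC.
have Rint : int_closed R := int_closed_mpoly F0.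
have [Q [Qm /eqP Qz Qmin]] := min_poly Ec jinj Rint zint.
(* The base ring for the extension is R[X] with X sent to z, so that y' can be found over a
   prescribed root of Q. *)
pose jz : {rmorphism {poly R} -> E} := horner_eval (mmap iE b Z) \o map_poly j.
have [|s0 js0 ext] := @extend_all {poly R} E K jz N y 1 Kc K0.
  by rewrite rmorph1 oner_neq0.
(* The exceptional [s0] depends on z. Its Bezout relation with Q leaves a condition c in R alone,
   which the perturbation of u can satisfy before a root of Q is selected. *)
have [c [A [B [jc eAB]]]] : exists c A B, j c != 0 /\ A * s0 + B * Q = c%:P.
  have szj (p : {poly R}) : size (map_poly j p) = size p.
    by apply: size_map_inj_poly; rewrite ?rmorph0.
  have mapj_inj : injective (map_poly j) by apply: map_inj_poly; rewrite ?rmorph0.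
  have [|||||c [A [B [h1 h2]]]] := @bezout_at R E j (mmap iE b Z) Q s0.
  - by rewrite szj.
  - by rewrite -size_poly_gt0 szj size_poly_gt0 monic_neq0.
  - exact: Qz.
  - move=> p /eqP/Qmin[S ->]; rewrite szj.
    case: (eqVneq S 0) => [->|S0]; first by rewrite mul0r rmorph0.
    rewrite size_Mmonic // => lt; exfalso; move: lt.
    have : (0 < size S)%N by rewrite size_poly_gt0.
    have : (0 < size Q)%N by rewrite size_poly_gt0 monic_neq0.
    by move: (size S) (size Q) => a q; lia.
  - exact: js0.
  by exists c, A, B; split=> //; apply: mapj_inj; rewrite h2 map_polyC.
have c0 : c != 0 by apply: contraNneq jc => ->; rewrite rmorph0.
have [q1 hq1] := finite_not_vge V (fun phi : {ffun 'I_M -> 'I_D} =>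
  \sum_(t < M) n0%:R ^+ t * ((rts t)`_(phi t) - w t)).
(* C is the requested precision; from [q1] on, a combination of differences between roots and w this
   small must be 0. Below, T is multiplied by a bound on the degrees, as [near_root] demands. *)
pose T := Num.max 0 (Num.max C q1).
have [T0 TC Tq] : [/\ 0 <= T, C <= T & q1 <= T] by rewrite !le_max !lexx !orbT.
pose B0 := T * (maxn D (size Q))%:R; have B00 : 0 <= B0 by rewrite mulr_ge0 ?ler0n.
pose B' := (Num.truncn B0).+1.
have B0B' : B0 <= B'%:R by apply: ltW; apply: truncnS_gt.
pose u0 l := mmap iK w (U l).
have vu0 l : vge 0 (u0 l).
  by have [] := @vcong_mmap _ _ V v1 _ iK _ w w 0 (U l) vi (fun t => vcong_refl V 0 (w0 t)).
have vthB : vge B'%:R (th ^+ B').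
  elim: (B') => [|k IH]; first by rewrite expr0.
  by rewrite exprS -natr1 addrC; apply: vgeM.
(* Each coordinate of u(w) moves by a natural multiple of th^B', of valuation at least B'; some such
   point is not a zero of c. *)
have [sh hsh] := @mpoly_nonvanish F K iK r (fun l k => u0 l + th ^+ B' * k%:R) c
  (fmorph_inj iK) (fun l x z e => natr_inj0 K0 (mulfI (expf_neq0 B' th0) (addrI (u0 l) e))) c0.
pose g : {rmorphism R -> K} := mmap iK (fun l => u0 l + th ^+ B' * (sh l)%:R).
have vg (a : R) : vcong vge B'%:R (g a) (g0 a).
  apply: (vcong_mmap V v1 _ vi) => l.
  have vd : vge B'%:R (th ^+ B' * (sh l)%:R) by apply: vgeMr => //; apply: vge_nat.
  split; [|exact: vu0|by rewrite addrC addKr].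
  by apply: vgeD => //; apply: (vge_le V _ vd); rewrite ler0n.
have near0 (p : {poly R}) x : p \is monic -> vge 0 x ->
    vge B'%:R ((map_poly g p).[x] - (map_poly g0 p).[x]).
  by move=> pm vx; have [] := vcong_horner V v1 p vg (vcong_refl V B'%:R vx).
pose z0 := mmap iK w Z.
have vz0 : vge 0 z0.
  by have [] := @vcong_mmap _ _ V v1 _ iK _ w w 0 Z vi (fun t => vcong_refl V 0 (w0 t)).
have gQm : map_poly g Q \is monic by apply: monic_map.
have [sQ esQ] := closed_split Kc (monic_neq0 gQm).
rewrite (monicP gQm) scale1r in esQ.
have szle (p : {poly R}) (s : seq K) (h : {rmorphism R -> K}) : p \is monic ->
    map_poly h p = \prod_(x <- s) ('X - x%:P) -> size p = (size s).+1.
  move=> pm e; rewrite -(size_prod_XsubC s id) -e size_map_poly_id0 //.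
  by rewrite (monicP pm) rmorph1 oner_neq0.
have [ze zes vze] : exists2 ze, ze \in sQ & vge T (z0 - ze).
  apply: (near_root V esQ).
  - apply: contraTneq isT => sQ0; move: (esQ) Qz; rewrite sQ0 big_nil => e1.
    have := szle Q sQ g Qm esQ; rewrite sQ0 /= => s1.
    have := monicP Qm; rewrite lead_coefE s1 => l1.
    by rewrite (size1_polyC (eq_leq s1)) l1 rmorph1 hornerC => /eqP; rewrite oner_eq0.
  - apply: le_trans B0B'; apply: ler_wpM2l => //; rewrite ler_nat.
    by apply: leq_trans (leq_maxr _ _); rewrite (szle Q sQ g Qm esQ).
  - have := near0 Q z0 Qm vz0; rewrite (specP Q Z Qz) subr0; by [].
pose gz : {rmorphism {poly R} -> K} := horner_eval ze \o map_poly g.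
have gQze : (map_poly g Q).[ze] = 0.
  by apply/eqP; rewrite -[_ == _]/(root _ _) esQ root_prod_XsubC.
have cgz : compatible jz gz.
  move=> p /= /eqP/Qmin[S ->]; rewrite horner_evalE rmorphM /= hornerM gQze mulr0 //.
have gs0 : gz s0 != 0.
  have := congr1 gz eAB; rewrite rmorphD !rmorphM /= !horner_evalE map_polyC /= hornerC gQze.
  by rewrite mulr0 addr0 => h; apply: contraNneq hsh => e; rewrite -/(g c) -h e mulr0.
have [y' [cy _]] := ext gz cgz gs0; exists y'.
pose cst : {rmorphism F -> {mpoly {poly R}[N]}} := @mpolyC N _ \o polyC \o @mpolyC r F.
(* Polynomials in y over F are reread over R[X], so that compatibility applies to relations that mix
   y with u and z. *)
pose ka : {rmorphism {mpoly F[N]} -> {mpoly {poly R}[N]}} := mmap cst (fun l => 'X_l).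
have kaE (S : comNzRingType) (h : {rmorphism {poly R} -> S}) (i : {rmorphism F -> S}) x f :
    (forall e, h e%:MP%:P = i e) -> mmap h x (ka f) = mmap i x f.
  move=> he; apply: (@mpoly_hom_ext _ _ _ (mmap h x \o ka) (mmap i x)) => [e|l].
    transitivity (mmap h x (cst e)); first by congr (mmap _ _ _); apply: mmapC.
    by rewrite /= !mmapC /= -he.
  transitivity (mmap h x 'X_l); first by congr (mmap _ _ _); apply: mmapXU.
  by rewrite /= !mmapXU.
have jzc e : jz e%:MP%:P = iE e by rewrite /= map_polyC horner_evalE hornerC /= mmapC.
have gzc e : gz e%:MP%:P = iK e by rewrite /= map_polyC horner_evalE hornerC /= mmapC.
pose b' t := mmap iK y' (Psi t).
pose cR : {rmorphism R -> {mpoly {poly R}[N]}} := @mpolyC N _ \o polyC.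
have b'P t : (map_poly g (P t)).[b' t] = 0.
  have [_ Pb _] := hP t.
  have := cy ((map_poly cR (P t)).[ka (Psi t)]).
  rewrite -(@horner_map_comp _ _ _ (mmap jz y) cR j) => [|a]; last first.
    by rewrite /= mmapC /= map_polyC horner_evalE hornerC.
  rewrite -(@horner_map_comp _ _ _ (mmap gz y') cR g) => [|a]; last first.
    by rewrite /= mmapC /= map_polyC horner_evalE hornerC.
  by rewrite /= (kaE _ jz iE) // (kaE _ gz iK) //; apply.
have zform (S : comNzRingType) (h : {rmorphism {poly R} -> S}) (i : {rmorphism F -> S}) x :
    (forall e, h e%:MP%:P = i e) ->
    mmap h x ('X%:MP - \sum_(t < M) n0%:R ^+ t * ka (Psi t)) =
    h 'X - \sum_(t < M) n0%:R ^+ t * mmap i x (Psi t).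
  move=> he; rewrite rmorphB rmorph_sum; congr (_ - _); first exact: mmapC.
  apply: eq_bigr => t _; rewrite rmorphM rmorphXn rmorph_nat; congr (_ * _).
  exact: kaE.
have zeE : ze = \sum_(t < M) n0%:R ^+ t * b' t.
  have jz0 : jz 'X - \sum_(t < M) n0%:R ^+ t * b t = 0.
    by rewrite /= map_polyX horner_evalE hornerX ZE subrr.
  have /cy gz0 := etrans (zform _ jz iE y jzc) jz0.
  have := etrans (esym (zform _ gz iK y' gzc)) gz0.
  by rewrite /= map_polyX horner_evalE hornerX => /eqP; rewrite subr_eq0 => /eqP.
have vb' t : vge 0 (b' t).
  have [Pm _ _] := hP t; apply: (integral_vge V v1 vm1 _ _ (b'P t)); first exact: monic_map.
  by move=> i; rewrite coef_map; have [] := vg (P t)`_i.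
have /choice[rt hrt] t : exists rt, rt \in rts t /\ vge T (b' t - rt).
  have [Pm _ _] := hP t; have [e1 ne] := hrts t.
  have [||rt h1 h2] := near_root V (x := b' t) (T := T) (B := B'%:R) e1 ne; last by exists rt.
  - apply: le_trans B0B'; apply: ler_wpM2l => //; rewrite ler_nat.
    by apply: leq_trans (szD t) (leq_maxl _ _).
  - have := near0 (P t) _ Pm (vb' t); rewrite b'P sub0r => /(vgeN V vm1).
    by rewrite opprK.
have idx t : (index (rt t) (rts t) < D)%N.
  by apply: leq_trans (szD t); rewrite index_mem; have [] := hrt t.
pose phi : {ffun 'I_M -> 'I_D} := [ffun t => Ordinal (idx t)].
have phiE t : (rts t)`_(phi t) = rt t by rewrite ffunE nth_index //; have [] := hrt t.
have vn t : vge 0 (n0%:R ^+ t) by apply: vgeX => //; apply: vge_nat.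
(* The roots are close to the b'_t, whose combination is [ze], itself close to z(w). By the choice
   of [q1] this small sum is 0, and by that of [n0] each root equals w_t. *)
have small : vge T (\sum_(t < M) n0%:R ^+ t * ((rts t)`_(phi t) - w t)).
  have -> : \sum_(t < M) n0%:R ^+ t * ((rts t)`_(phi t) - w t) =
      - (z0 - ze) - \sum_(t < M) n0%:R ^+ t * (b' t - rt t).
    rewrite /z0 ZE zeE opprB -!sumrB; apply: eq_bigr => t _; rewrite phiE; ring.
  apply: vgeB => //; first exact: vgeN.
  by apply: vge_sum => // t _; apply: vgeMl => //; have [] := hrt t.
have zero : \sum_(t < M) n0%:R ^+ t * ((rts t)`_(phi t) - w t) = 0.
  apply/eqP; apply: contraT => nz; case: (hq1 phi nz); exact: (vge_le V Tq small).
move=> t; apply: (vge_le V TC); have := hn0 phi zero t; rewrite phiE => /eqP.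
by rewrite subr_eq0 => /eqP <-; have [] := hrt t.
Qed.
End Dense.

(** * Tensor rank and the Leibniz rule *)

Section TensorRank.
Variables (F : fieldType) (m k : nat).
Hypothesis k0 : (0 < k)%N.
Implicit Types T U : Ten F m k.

Lemma decomposable0 : decomposable (0 : Ten F m k).
Proof.
exists (fun _ _ => 0); apply/ffunP => i; rewrite !ffunE.
by rewrite (bigD1 (Ordinal k0)) //= mul0r.
Qed.

Lemma trank_leD r s T U : trank_le r T -> trank_le s U -> trank_le (r + s) (T + U).
Proof.
move=> [t [ht ->]] [u [hu ->]].
exists (fun i => match split i with inl a => t a | inr b => u b end); split.
  by move=> i; case: split.
rewrite big_split_ord /=; congr (_ + _); apply: eq_bigr => i _.
  by rewrite (unsplitK (inl i)).
by rewrite (unsplitK (inr i)).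
Qed.

Lemma trank_le0 : trank_le 0 (0 : Ten F m k).
Proof. by exists (fun=> 0); split=> [[]|] //; rewrite big_ord0. Qed.

Lemma trank_leW r s T : (r <= s)%N -> trank_le r T -> trank_le s T.
Proof.
move=> /subnKC <-; move: (s - r)%N => l hT; rewrite -[T]addr0; apply: trank_leD => //.
by exists (fun=> 0); split; [move=> _; apply: decomposable0|rewrite big1].
Qed.

Lemma trank_le_sum (I : eqType) (s : seq I) r (T : I -> Ten F m k) :
  (forall i, i \in s -> trank_le r (T i)) -> trank_le (size s * r) (\sum_(i <- s) T i).
Proof.
elim: s => [|a s IH] h; first by rewrite big_nil; apply: trank_le0.
rewrite big_cons mulSn; apply: trank_leD; first by apply: h; rewrite mem_head.
by apply: IH => i iI; apply: h; rewrite inE iI orbT.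
Qed.

Lemma trank_le_card (I : finType) (A : {set I}) (T : I -> Ten F m k) :
  (forall i, i \in A -> decomposable (T i)) -> trank_le #|A| (\sum_(i in A) T i).
Proof.
move=> h; exists (fun i => T (enum_val i)); split; last by rewrite big_enum_val.
by move=> i; apply: h; apply: enum_valP.
Qed.
End TensorRank.

Section Words.
Variable k : nat.
(** Letter i of a word names the factor on which derivation i acts. *)
Fixpoint words (d : nat) : seq (seq 'I_k) :=
  if d is d'.+1 then [seq c :: s | c <- enum 'I_k, s <- words d'] else [:: [::]].

Lemma size_words d : size (words d) = (k ^ d)%N.
Proof. by elim: d => //= d IH; rewrite size_allpairs size_enum_ord IH expnS. Qed.

Lemma mem_words d s : s \in words d -> size s = d.
Proof.
elim: d s => [|d IH] s /=; first by rewrite inE => /eqP ->.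
by case/allpairsP => -[c s'] [_ /= /IH h ->]; rewrite /= h.
Qed.
End Words.

Section Leibniz.
Variables (K : fieldType) (k : nat).

Definition apply_all (ds : seq (K -> K)) (a : K) := foldr (fun D g => D g) a ds.

(* The derivations of ds that the word s attributes to the q-th factor. *)
Definition apply_sel (ds : seq (K -> K)) (s : seq 'I_k) (q : 'I_k) (a : K) :=
  foldr (fun Dc g => if Dc.2 == q then Dc.1 g else g) a (zip ds s).

Lemma der_prod (D : K -> K) (f : 'I_k -> K) : derivation D ->
  D (\prod_q f q) = \sum_(c < k) \prod_q (if c == q then D (f q) else f q).
Proof.
move=> hD; have D1 : D 1 = 0.
  by have := (proj2 hD) 1 1; rewrite !mulr1 mul1r => /(congr1 (fun x => x - D 1));
    rewrite subrr addrK.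
elim: k f => [|l IH] f; first by rewrite !big_ord0.
rewrite big_ord_recl (proj2 hD) IH big_ord_recl big_ord_recl eqxx; congr (_ + _).
rewrite mulr_sumr; apply: eq_bigr => c _; rewrite big_ord_recl /=; congr (_ * _).
Qed.

Lemma leibniz (ds : seq (K -> K)) (f : 'I_k -> K) :
  (forall i, (i < size ds)%N -> derivation (nth id ds i)) ->
  apply_all ds (\prod_q f q) = \sum_(s <- words k (size ds)) \prod_q apply_sel ds s q (f q).
Proof.
elim: ds => [|D ds IH] h /=.
  by rewrite big_seq1; apply: eq_bigr => q _; rewrite /apply_sel.
rewrite IH => [|i lt]; last exact: (h i.+1).
have hD : derivation D := h 0%N isT; rewrite (der_sum _ _ _ hD) big_allpairs_dep exchange_big /=.
apply: eq_bigr => s _; rewrite der_prod // big_enum /=.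
by apply: eq_bigr => c _; apply: eq_bigr => q _; rewrite /apply_sel /=.
Qed.
End Leibniz.

Section RankBound.
Variables (K : fieldType) (m k d n : nat).
Hypotheses (k0 : (0 < k)%N) (n0 : (0 < n)%N).
Variables (E : 'I_d -> 'I_n -> K -> K) (Eder : forall i l, derivation (E i l)).

Definition ders (e : d.-tuple 'I_n) : seq (K -> K) := [seq E i (tnth e i) | i <- enum 'I_d].

Lemma apply_selE (e : d.-tuple 'I_n) (s : seq 'I_k) q a c0 : size s = d ->
  apply_sel (ders e) s q a =
  foldr (fun (i : 'I_d) g => if nth c0 s i == q then E i (tnth e i) g else g) a (enum 'I_d).
Proof.
move=> ss; rewrite /apply_sel /ders.
have -> : zip [seq E i (tnth e i) | i <- enum 'I_d] s =
    [seq (E i (tnth e i), nth c0 s i) | i : 'I_d <- enum 'I_d].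
  apply: (@eq_from_nth _ (id, c0)).
    by rewrite size_zip 2!size_map size_enum_ord ss minnn.
  move=> i; rewrite size_zip size_map size_enum_ord ss minnn => lt.
  rewrite nth_zip; last by rewrite size_map size_enum_ord ss.
  rewrite (nth_map (Ordinal lt)) ?size_enum_ord //.
  by rewrite (nth_map (Ordinal lt)) ?size_enum_ord //= nth_enum_ord.
by elim: (enum 'I_d) => //= i l ->.
Qed.

(** Factor q sees only the indices of the derivations attributed to it; this is what allows the sum
    over [e] to be split between factors. *)
Lemma apply_sel_eq (e e' : d.-tuple 'I_n) (s : seq 'I_k) q a c0 : size s = d ->
  (forall i : 'I_d, nth c0 s i = q -> tnth e i = tnth e' i) ->
  apply_sel (ders e) s q a = apply_sel (ders e') s q a.
Proof.
move=> ss h; rewrite !(@apply_selE _ _ _ _ c0) //.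
elim: (enum 'I_d) => //= i l ->; case: eqP => // /h e1; by rewrite e1.
Qed.

Lemma popular_letter (s : seq 'I_k) : exists q : 'I_k, (size s <= count_mem q s * k)%N.
Proof.
have [q hq] : exists q : 'I_k, forall q', (count_mem q' s <= count_mem q s)%N.
  have := @arg_maxnP 'I_k (Ordinal k0) xpredT (fun q => count_mem q s) isT.
  by case=> q _ h; exists q => q'; apply: h.
exists q; have -> : size s = (\sum_(q' < k) count_mem q' s)%N.
  elim: s {hq} => [|a s IH]; first by rewrite big1.
  rewrite /= big_split /= -IH (bigD1 a) //= eqxx big1 // => i ne.
  by rewrite eq_sym (negbTE ne).
have : (\sum_(q' < k) count_mem q' s <= \sum_(q' < k) count_mem q s)%N.
  by apply: leq_sum => q' _.
by rewrite sum_nat_const card_ord mulnC.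
Qed.

(* The factor qs to which the word attributes most derivations absorbs the sum over their indices;
   at most (k - 1) d / k indices remain free. *)
Lemma word_rank (co : d.-tuple 'I_n -> K) (f : 'I_k -> 'I_m -> K) (s : seq 'I_k) :
  size s = d ->
  trank_le (n ^ ((k - 1) * d %/ k))
    ([ffun t : k.-tuple 'I_m => \sum_e co e * \prod_q apply_sel (ders e) s q (f q (tnth t q))]
      : Ten K m k).
Proof.
move=> ss; have [qs hqs] := popular_letter s.
pose i0 : 'I_n := Ordinal n0.
pose C := [set i : 'I_d | nth qs s i != qs].
have cC : (#|C| <= (k - 1) * d %/ k)%N.
  have -> : #|C| = (d - count_mem qs s)%N.
    have -> : count_mem qs s = #|~: C|.
      rewrite -sum1_card -sum1_count (big_nth qs) ss big_mkord.
      by apply: eq_bigl => i; rewrite !inE negbK.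
    have h := cardsC C; rewrite card_ord in h.
    by rewrite -[LHS](addnK #|~: C|) h.
  rewrite leq_divRL // mulnBl mulnBl mul1n mulnC; apply: leq_sub2l.
  by rewrite -ss.
(* The indices attributed to [qs] are reset to [i0]. Fixed points of [proj] are thus choices of the
   remaining indices, at most n^#|C| of them, and each fibre is summed inside the factor [qs]. *)
pose proj (e : d.-tuple 'I_n) := [tuple if i \in C then tnth e i else i0 | i < d].
pose A := [set al : d.-tuple 'I_n | proj al == al].
have projA e : proj e \in A.
  rewrite inE; apply/eqP/eq_from_tnth => i; rewrite !tnth_mktuple.
  by case: (i \in C).
have cA : (#|A| <= n ^ #|C|)%N.
  pose h (al : d.-tuple 'I_n) : {ffun 'I_d -> 'I_n} := [ffun i => tnth al i].
  have hinj : injective h.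
    by move=> x y /ffunP e; apply: eq_from_tnth => i; have := e i; rewrite !ffunE.
  rewrite -(card_imset _ hinj) -[n in (n ^ _)%N]card_ord -(card_pffun_on i0 (mem C) predT).
  apply: subset_leq_card; apply/subsetP => _ /imsetP[al alA ->].
  apply/pffun_onP; split; last by [].
  apply/subsetP => i; rewrite inE ffunE; apply: contraR => iC.
  by move: alA; rewrite inE => /eqP <-; rewrite tnth_mktuple (negbTE iC).
apply: (trank_leW k0 (leq_trans cA (leq_pexp2l n0 cC))).
pose v al q (l : 'I_m) := if q == qs then
    \sum_(e | proj e == al) co e * apply_sel (ders e) s qs (f qs l)
  else apply_sel (ders al) s q (f q l).
pose D al : Ten K m k := [ffun t => \prod_(q < k) v al q (tnth t q)].
have -> : [ffun t : k.-tuple 'I_m => \sum_e co e *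
    \prod_q apply_sel (ders e) s q (f q (tnth t q))] = \sum_(al in A) D al.
  apply/ffunP => t; rewrite ffunE sum_ffunE.
  rewrite (partition_big proj (mem A)) //=; apply: eq_bigr => al alA.
  rewrite ffunE (bigD1 qs) //= {1}/v eqxx mulr_suml.
  apply: eq_bigr => e /eqP pe; rewrite (bigD1 qs) //= mulrA; congr (_ * _).
  apply: eq_bigr => q nq; rewrite /v (negbTE nq).
  apply: (@apply_sel_eq _ _ _ _ _ qs) => // i hi.
  by rewrite -pe tnth_mktuple inE hi nq.
by apply: trank_le_card => al _; exists (v al).
Qed.

Theorem leibniz_rank (a : nat) (co : d.-tuple 'I_n -> K) (v : 'I_a -> 'I_k -> 'I_m -> K) :
  trank_le (a * (k ^ d * n ^ ((k - 1) * d %/ k)))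
    ([ffun t : k.-tuple 'I_m =>
        \sum_e co e * apply_all (ders e) (\sum_l \prod_q v l q (tnth t q))] : Ten K m k).
Proof.
have -> : [ffun t : k.-tuple 'I_m =>
    \sum_e co e * apply_all (ders e) (\sum_l \prod_q v l q (tnth t q))] =
  \sum_(l <- enum 'I_a) \sum_(s <- words k d) ([ffun t : k.-tuple 'I_m =>
    \sum_e co e * \prod_q apply_sel (ders e) s q (v l q (tnth t q))] : Ten K m k).
  apply/ffunP => t; rewrite ffunE sum_ffunE big_enum /=.
  rewrite [RHS](eq_bigr (fun l => \sum_(s <- words k d)
      \sum_e co e * \prod_q apply_sel (ders e) s q (v l q (tnth t q)))); last first.
    by move=> l _; rewrite sum_ffunE; apply: eq_bigr => s _; rewrite ffunE.
  rewrite (eq_bigr (fun l => \sum_e \sum_(s <- words k d)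
      co e * \prod_q apply_sel (ders e) s q (v l q (tnth t q)))); last first.
    by move=> l _; rewrite exchange_big.
  rewrite [RHS]exchange_big /=; apply: eq_bigr => e _.
  have hder i : (i < size (ders e))%N -> derivation (nth id (ders e) i).
    rewrite size_map size_enum_ord => lt.
    by rewrite (nth_map (Ordinal lt)) ?size_enum_ord //; apply: Eder.
  have szd : size (ders e) = d by rewrite size_map size_enum_ord.
  have allD : apply_all (ders e) (\sum_l \prod_q v l q (tnth t q)) =
      \sum_l apply_all (ders e) (\prod_q v l q (tnth t q)).
    elim: (ders e) hder => [|D ds IH] h //=.
    rewrite IH => [|i lt]; last exact: (h i.+1).
    by rewrite (der_sum _ _ _ (h 0%N isT : derivation D)).
  rewrite allD mulr_sumr; apply: eq_bigr => l _; rewrite leibniz // szd mulr_sumr.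
  by [].
have -> : (a * (k ^ d * n ^ ((k - 1) * d %/ k)) =
    size (enum 'I_a) * (size (words k d) * n ^ ((k - 1) * d %/ k)))%N.
  by rewrite size_enum_ord size_words.
apply: trank_le_sum => l _; apply: trank_le_sum => s /mem_words ss.
exact: word_rank.
Qed.
End RankBound.

(** * Border rank *)

Section Terms.
Variables (F : fieldType) (M : nat).

(** The closure is defined by formal ring terms; this and the converse translation let it be tested
    on multivariate polynomials. *)
Lemma term_of_mpoly (f : {mpoly F[M]}) : exists p : GRing.term F, GRing.rterm p /\
  forall s : seq F, GRing.eval s p = mmap idfun (fun t : 'I_M => s`_t) f.
Proof.
pose Q (f : {mpoly F[M]}) := exists p : GRing.term F, GRing.rterm p /\
  forall s : seq F, GRing.eval s p = mmap idfun (fun t : 'I_M => s`_t) f.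
have QC c : Q c%:MP by exists (GRing.Const c); split=> // s; rewrite mmapC.
have QM g h : Q g -> Q h -> Q (g * h).
  move=> [p [rp hp]] [q [rq hq]]; exists (GRing.Mul p q); split=> [|s] /=.
    by rewrite rp rq.
  by rewrite hp hq rmorphM.
rewrite -/(Q f) [f]mpolyE; apply: (big_ind Q) => [|g h|m _]; first by rewrite -mpolyC0.
  move=> [p [rp hp]] [q [rq hq]]; exists (GRing.Add p q); split=> [|s] /=.
    by rewrite rp rq.
  by rewrite hp hq rmorphD.
rewrite -mul_mpolyC; apply: (QM _ _) => //; rewrite mpolyXE_id.
apply: (big_ind Q) => [|g h|t _]; [by rewrite -mpolyC1|exact: (QM g h)|].
elim: (m t) => [|l IH]; first by rewrite expr0 -mpolyC1.
rewrite exprS; apply: (QM _ _) => //; exists (GRing.Var _ t); split=> // s /=.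
by rewrite mmapXU.
Qed.

Lemma mpoly_of_term (p : GRing.term F) : GRing.rterm p -> exists f : {mpoly F[M]},
  forall s : seq F, size s = M -> GRing.eval s p = mmap idfun (fun t : 'I_M => s`_t) f.
Proof.
elim: p => [i _|c _|l _|p IHp q IHq /andP[/IHp[f hf] /IHq[g hg]]|p IH /IH[f hf]|
    p IH l /IH[f hf]|p IHp q IHq /andP[/IHp[f hf] /IHq[g hg]]|p _ //|p IH l /IH[f hf]].
- case: (ltnP i M) => [lt|le].
    by exists ('X_(Ordinal lt)) => s _; rewrite mmapXU.
  by exists 0 => s ss; rewrite rmorph0 /= nth_default // ss.
- by exists c%:MP => s _; rewrite mmapC.
- by exists l%:R => s _; rewrite rmorph_nat.
- by exists (f + g) => s ss; rewrite /= hf // hg // rmorphD.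
- by exists (- f) => s ss; rewrite /= hf // rmorphN.
- by exists (f *+ l) => s ss; rewrite /= hf // rmorphMn.
- by exists (f * g) => s ss; rewrite /= hf // hg // rmorphM.
- by exists (f ^+ l) => s ss; rewrite /= hf // rmorphXn.
Qed.
End Terms.

Section Closure.
Variables (F : fieldType) (m k : nat).
Local Notation idx := (k.-tuple 'I_m).
Local Notation M := #|{: idx}|.

Definition pt (R : Type) (T : {ffun idx -> R}) (t : 'I_M) : R := T (enum_val t).

Lemma coords_nth (T : Ten F m k) (t : 'I_M) : (coords T)`_t = pt T t.
Proof.
rewrite /coords /image_mem (nth_map (enum_val t)) -?cardE ?card_ord //.
congr (T _); rewrite /enum_val; apply: set_nth_default.
by rewrite -cardE.
Qed.

Lemma size_coords (T : Ten F m k) : size (coords T) = M.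
Proof. by rewrite size_map -cardE. Qed.

Lemma brk_leP r (T : Ten F m k) : brk_le r T <-> forall f : {mpoly F[M]},
  (forall U : Ten F m k, trank_le r U -> mmap idfun (pt U) f = 0) -> mmap idfun (pt T) f = 0.
Proof.
split=> h.
  move=> f hf; have [p [rp hp]] := term_of_mpoly f.
  have e U : GRing.eval (coords U) p = mmap idfun (pt U) f.
    by rewrite hp; apply: mmap_ext => t; apply: coords_nth.
  by rewrite -e; apply: h => // U /hf; rewrite -e.
move=> p rp hU; have [f hf] := mpoly_of_term M rp.
have e U : GRing.eval (coords U) p = mmap idfun (pt U) f.
  by rewrite hf ?size_coords //; apply: mmap_ext => t; apply: coords_nth.
by rewrite e; apply: h => U /hU; rewrite e.
Qed.
End Closure.

Section BorderRank.
Variables (F : fieldType) (m k : nat).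
Hypothesis k0 : (0 < k)%N.
Implicit Types T U : Ten F m k.

Lemma brk_leW r s T : (r <= s)%N -> brk_le r T -> brk_le s T.
Proof.
move=> rs h p rp hU; apply: h => // U hr; apply: hU; exact: trank_leW rs hr.
Qed.

Lemma trank_brk_le r T : trank_le r T -> brk_le r T.
Proof. by move=> h p _; apply. Qed.

Lemma trank_full T : trank_le (m ^ k) T.
Proof.
pose D (i : k.-tuple 'I_m) : Ten F m k := [ffun j => if j == i then T i else 0].
have -> : T = \sum_(i in [set: k.-tuple 'I_m]) D i.
  apply/ffunP => j; rewrite sum_ffunE (bigD1 j) ?inE //= ffunE eqxx big1 ?addr0 // => i.
  by rewrite inE /= ffunE eq_sym => /negbTE ->.
have -> : (m ^ k)%N = #|[set: k.-tuple 'I_m]| by rewrite cardsT card_tuple card_ord.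
apply: trank_le_card => i _.
(* The scalar T i is carried by the factor of index 0, which exists since k > 0. *)
exists (fun q l => (if q == Ordinal k0 then T i else 1) * (l == tnth i q)%:R).
apply/ffunP => j; rewrite !ffunE big_split /= (bigD1 (Ordinal k0)) //= ?eqxx big1 ?mulr1; last first.
  by move=> q /negbTE ->.
case: (j =P i) => [->|ne]; first by rewrite big1 ?mulr1 // => q _; rewrite eqxx.
have /existsP[q hq] : [exists q, tnth j q != tnth i q].
  rewrite -negb_forall; apply/negP => /forallP h; apply: ne; apply: eq_from_tnth => q.
  exact/eqP/h.
by rewrite (bigD1 q) //= (negbTE hq) mul0r mulr0.
Qed.

Lemma has_brk T : has (fun r => Defs.asbool (brk_le r T)) (iota 0 (m ^ k).+1).
Proof.
apply/hasP; exists (m ^ k)%N; first by rewrite mem_iota add0n ltnS leqnn.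
rewrite /Defs.asbool; case: ClassicalEpsilon.excluded_middle_informative => // h; case: h.
by apply: trank_brk_le; apply: trank_full.
Qed.

Lemma brkP T : brk_le (brk T) T.
Proof.
have := nth_find 0%N (has_brk T); rewrite -/(brk T) nth_iota; last first.
  by have := has_brk T; rewrite has_find size_iota.
by rewrite add0n /Defs.asbool; case: ClassicalEpsilon.excluded_middle_informative.
Qed.

Lemma brk_max T : (brk T <= m ^ k)%N.
Proof. by have := has_brk T; rewrite has_find size_iota ltnS. Qed.

Lemma brk_min r T : brk_le r T -> (brk T <= r)%N.
Proof.
move=> h; rewrite leqNgt; apply/negP => lt.
have := before_find 0%N lt; rewrite nth_iota; last first.
  by apply: leq_trans lt _; apply: leq_trans (brk_max T) _.
rewrite add0n /Defs.asbool; case: ClassicalEpsilon.excluded_middle_informative => //.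
Qed.

Lemma supnat_ge (P : nat -> Prop) B r : P r -> (r <= B)%N -> (r <= supnat P B)%N.
Proof.
move=> Pr rB; rewrite -ltnS in rB; apply: (@leq_bigmax_cond _ _ (fun i : 'I_B.+1 => val i) (Ordinal rB)).
by rewrite /Defs.asbool /=; case: ClassicalEpsilon.excluded_middle_informative.
Qed.

Lemma supnat_le (P : nat -> Prop) B c : (forall r, P r -> (r <= c)%N) -> (supnat P B <= c)%N.
Proof.
move=> h; apply/bigmax_leqP => i; rewrite /Defs.asbool.
by case: ClassicalEpsilon.excluded_middle_informative => [p _|//]; apply: h.
Qed.
End BorderRank.

(** * The numeric to symbolic transfer *)

Lemma apply_all_vge (K : fieldType) (vge : rat -> K -> Prop) (ds : seq (K -> K)) q a :
  (forall i b, (i < size ds)%N -> vge q b -> vge q (nth id ds i b)) -> vge q a ->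
  vge q (apply_all ds a).
Proof.
elim: ds => //= D ds IH h ha; apply: (h 0%N) => //.
by apply: IH => // i b lt; apply: (h i.+1).
Qed.

Lemma apply_all_sum (K : fieldType) (ds : seq (K -> K)) (I : Type) (r : seq I) (x : I -> K) :
  (forall i, (i < size ds)%N -> derivation (nth id ds i)) ->
  apply_all ds (\sum_(i <- r) x i) = \sum_(i <- r) apply_all ds (x i).
Proof.
elim: ds => //= D ds IH h; rewrite IH => [|i lt]; last exact: (h i.+1).
by rewrite (der_sum _ _ _ (h 0%N isT : derivation D)).
Qed.

Lemma apply_all_scale (K : fieldType) (ds : seq (K -> K)) c a :
  (forall i, (i < size ds)%N -> derivation (nth id ds i) /\ nth id ds i c = 0) ->
  apply_all ds (c * a) = c * apply_all ds a.
Proof.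
elim: ds => //= D ds IH h; rewrite IH => [|i lt]; last exact: (h i.+1).
have [hd Dc] : derivation D /\ D c = 0 := h 0%N isT.
by rewrite (proj2 hd) Dc mul0r add0r.
Qed.

(** Logarithmic derivatives add in a product, so monomials in eigenvectors are eigenvectors. *)
Lemma der_prod_eigen (K : fieldType) (D : K -> K) (I : Type) (r : seq I) (x la : I -> K) :
  derivation D -> (forall i, D (x i) = la i * x i) ->
  D (\prod_(i <- r) x i) = (\sum_(i <- r) la i) * \prod_(i <- r) x i.
Proof.
move=> hD h; elim: r => [|i r IH].
  rewrite !big_nil mul0r; have := (proj2 hD) 1 1; rewrite !mulr1 mul1r.
  by move=> /(congr1 (fun x => x - D 1)); rewrite subrr addrK.
by rewrite !big_cons (proj2 hD) h IH; ring.
Qed.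

Section Transfer.
Variables (F : fieldType) (n m d k a : nat) (phi : {linear Ten F n d -> Ten F m k}).
Hypotheses (Fc : alg_closed F) (F0 : char0 F) (n0 : (0 < n)%N) (k0 : (0 < k)%N) (d0 : (0 < d)%N).
Hypothesis Ha : forall s, decomposable s -> brk_le a (phi s).
Local Notation M := #|{: k.-tuple 'I_m}|.

Definition tvar r : nat := #|{: 'I_r * 'I_k * 'I_m}|.

(* The t-th coordinate of a sum of r decomposable tensors with generic entries. *)
Definition rank_poly r (t : 'I_M) : {mpoly F[tvar r]} :=
  \sum_(l < r) \prod_(q < k) 'X_(enum_rank (l, q, tnth (enum_val t) q)).

Lemma rank_polyE (S : comNzRingType) (i : {rmorphism F -> S}) r (x : 'I_(tvar r) -> S) t :
  mmap i x (rank_poly r t) = \sum_(l < r) \prod_(q < k) x (enum_rank (l, q, tnth (enum_val t) q)).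
Proof.
rewrite rmorph_sum; apply: eq_bigr => l _; rewrite rmorph_prod.
by apply: eq_bigr => q _; rewrite /= mmapXU.
Qed.

Lemma rank_poly_trank r (x : 'I_(tvar r) -> F) : exists2 U : Ten F m k, trank_le r U &
  forall t, pt U t = mmap idfun x (rank_poly r t).
Proof.
pose T l : Ten F m k := [ffun t => \prod_(q < k) x (enum_rank (l, q, tnth t q))].
exists (\sum_(l < r) T l); first by exists T; split=> // l; exists (fun q i => x (enum_rank (l, q, i))).
by move=> t; rewrite rank_polyE /pt sum_ffunE; apply: eq_bigr => l _; rewrite ffunE.
Qed.

Lemma trank_rank_poly r (U : Ten F m k) : trank_le r U -> exists x : 'I_(tvar r) -> F,
  forall t, pt U t = mmap idfun x (rank_poly r t).
Proof.
move=> [T [hT ->]]; have /choice[v hv] := hT.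
exists (fun i => let: (l, q, j) := enum_val i in v l q j) => t.
rewrite rank_polyE /pt sum_ffunE; apply: eq_bigr => l _; rewrite hv ffunE.
by apply: eq_bigr => q _; rewrite enum_rankK.
Qed.

Lemma mpoly_vanish r (f : {mpoly F[r]}) : (forall x, mmap idfun x f = 0) -> f = 0.
Proof.
move=> h; apply/eqP; apply: contraT => f0.
have [s] := @mpoly_nonvanish F F idfun r (fun=> fun l => l%:R) f (fun x y e => e)
  (fun=> natr_inj0 F0) f0.
by rewrite h eqxx.
Qed.

(** F is infinite, so an equation valid at all F-points of the parametrization is a formal identity;
    it then holds for tensors of rank at most r over any extension field. *)
Lemma rank_poly_vanish r (f : {mpoly F[M]}) :
  (forall U : Ten F m k, trank_le r U -> mmap idfun (pt U) f = 0) ->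
  mmap (@mpolyC _ F) (rank_poly r) f = 0.
Proof.
move=> h; apply: mpoly_vanish => x; rewrite -(mmap_mmap idfun x).
have [U hU e] := rank_poly_trank x.
by rewrite -(h U hU); apply: mmap_ext => t; rewrite e.
Qed.

Definition unit_ten (e : d.-tuple 'I_n) : Ten F n d := [ffun e' => (e' == e)%:R].

Lemma ten_sum (T : Ten F n d) : T = \sum_e T e *: unit_ten e.
Proof.
apply/ffunP => e; rewrite sum_ffunE (bigD1 e) //= !ffunE eqxx big1 => [|e' ne].
  by rewrite addr0 -[_ *: _]/(_ * _) mulr1.
by rewrite !ffunE eq_sym (negbTE ne) scaler0.
Qed.

Lemma phi_coord T t : pt (phi T) t = \sum_e T e * pt (phi (unit_ten e)) t.
Proof.
rewrite {1}(ten_sum T) linear_sum /pt sum_ffunE; apply: eq_bigr => e _.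
by rewrite linearZ ffunE.
Qed.

Definition xvar : nat := #|{: 'I_d * 'I_n}|.

(* The t-th coordinate of phi(x_1 (x) ... (x) x_d) for generic vectors x_i. *)
Definition phi_poly (t : 'I_M) : {mpoly F[xvar]} :=
  \sum_e (pt (phi (unit_ten e)) t)%:MP * \prod_(i < d) 'X_(enum_rank (i, tnth e i)).

Lemma phi_polyE (S : comNzRingType) (i : {rmorphism F -> S}) (x : 'I_xvar -> S) t :
  mmap i x (phi_poly t) =
  \sum_e i (pt (phi (unit_ten e)) t) * \prod_(l < d) x (enum_rank (l, tnth e l)).
Proof.
rewrite rmorph_sum; apply: eq_bigr => e _; rewrite rmorphM /= mmapC /= rmorph_prod.
by congr (_ * _); apply: eq_bigr => l _; rewrite /= mmapXU.
Qed.

(** The hypothesis at all F-points x turns each equation of the closure into a formal identity, so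
    it holds at the generic x as well. *)
Lemma phi_poly_vanish (f : {mpoly F[M]}) :
  (forall U : Ten F m k, trank_le a U -> mmap idfun (pt U) f = 0) ->
  mmap (@mpolyC _ F) phi_poly f = 0.
Proof.
move=> h; apply: mpoly_vanish => x; rewrite -(mmap_mmap idfun x).
pose s : Ten F n d := [ffun e => \prod_(l < d) x (enum_rank (l, tnth e l))].
have ds : decomposable s by exists (fun l i => x (enum_rank (l, i))).
rewrite -((brk_leP a (phi s)).1 (Ha ds) f h); apply: mmap_ext => t.
rewrite phi_polyE phi_coord; apply: eq_bigr => e _.
by rewrite ffunE mulrC.
Qed.

Theorem transfer (T : Ten F n d) :
  brk_le (a * (k ^ d * n ^ ((k - 1) * d %/ k))) (phi T).
Proof.
apply/brk_leP => f hf; set R := (a * _)%N in hf.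
(* From this first field only algebraic closedness and independent elements y are used: they give a
   generic sum of [a] decomposable tensors. *)
have [G [iG [y [_ [_ [[Gc _ _ yfree] _]]]]]] := series_field (tvar a) Fc F0.
have [K [i [x [E [vge [[Kc K0 V xfree] [[Eder Ei Ex Evge] [vi vi0 vx vlast]]]]]]]] :=
  series_field xvar Fc F0.
have v1 : vge 0 1 by rewrite -(rmorph1 i); apply: vi.
have vm1 : vge 0 (-1) by rewrite -(rmorph1 i) -rmorphN; apply: vi.
have x0 : (0 < xvar)%N by rewrite /xvar card_prod !card_ord muln_gt0 d0.
pose X (l : 'I_d) (c : 'I_n) := x (enum_rank (l, c)).
have X0 l c : X l c != 0 by have [] := vx (enum_rank (l, c)) (ltn_ord _).
pose w (t : 'I_M) := mmap i (fun j : 'I_xvar => x j) (phi_poly t).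
pose th := x xvar.-1.
have th0 : th != 0 by have [] := vx xvar.-1; rewrite ?prednK.
have w0 t : vge 0 (w t).
  have hx (j : 'I_xvar) : vcong vge 0 (x j) (x j).
    by apply: vcong_refl => //; have [] := vx j (ltn_ord _).
  by have [] := vcong_mmap V v1 (phi_poly t) vi hx.
pose yG (j : 'I_(tvar a)) := y j.
have spec (g : {mpoly F[M]}) : mmap iG (fun t => mmap iG yG (rank_poly a t)) g = 0 ->
    mmap i w g = 0.
  rewrite mmap_mmap => /yfree g0; rewrite /w mmap_mmap phi_poly_vanish ?rmorph0 // => U hU.
  have [z hz] := trank_rank_poly hU.
  by rewrite (mmap_ext _ _ hz) (mmap_mmap idfun z) g0 rmorph0.
pose Ed (l : 'I_d) (c : 'I_n) := E (enum_rank (l, c)).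
have Edder l c : derivation (Ed l c) by apply: Eder.
pose mono (e : d.-tuple 'I_n) := \prod_(l < d) X l (tnth e l).
have mono0 e : mono e != 0 by apply/prodf_neq0.
(* The derivations attached to [e] map the generic tensor's image to [mono e] times phi(unit_ten e);
   dividing by [mono e] and summing rebuilds phi(T). *)
pose co e := i (T e) * (mono e)^-1.
have dersn e l : (l < size (ders Ed e))%N -> derivation (nth id (ders Ed e) l).
  rewrite size_map size_enum_ord => lt.
  by rewrite (nth_map (Ordinal lt)) ?size_enum_ord.
have dersc e l c : (l < size (ders Ed e))%N -> nth id (ders Ed e) l (i c) = 0.
  rewrite size_map size_enum_ord => lt.
  by rewrite (nth_map (Ordinal lt)) ?size_enum_ord //; apply: Ei.
have dersv e l q b : (l < size (ders Ed e))%N -> vge q b -> vge q (nth id (ders Ed e) l b).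
  rewrite size_map size_enum_ord => lt.
  by rewrite (nth_map (Ordinal lt)) ?size_enum_ord //; apply: Evge.
have EdX l c l' c' : Ed l c (X l' c') = ((l == l') && (c == c'))%:R * X l' c'.
  rewrite /Ed /X Ex ?ltn_ord // (inj_eq val_inj) (inj_eq enum_rank_inj) xpair_eqE.
  by case: (_ && _); rewrite ?mul1r ?mul0r.
(* Derivation l multiplies [mono e'] by 1 or 0 according as e and e' agree in slot l, so only e' = e
   survives all of them. *)
have ders_mono e e' : apply_all (ders Ed e) (mono e') = (e == e')%:R * mono e'.
  have step l : Ed l (tnth e l) (mono e') = (tnth e l == tnth e' l)%:R * mono e'.
    rewrite /mono (der_prod_eigen _ (Edder _ _) (fun l' => EdX _ _ l' _)); congr (_ * _).
    rewrite (bigD1 l) //= eqxx big1 ?addr0 // => l' ne.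
    by rewrite eq_sym (negbTE ne).
  have -> : (e == e') = all (fun l => tnth e l == tnth e' l) (enum 'I_d).
    apply/eqP/allP => [-> //|h]; apply: eq_from_tnth => l.
    by apply/eqP/h; rewrite mem_enum.
  rewrite /ders; elim: (enum 'I_d) => [|l s IH] /=; first by rewrite mul1r.
  rewrite IH (proj2 (Edder _ _)) step mulrA.
  have -> : Ed l (tnth e l) (all (fun l => tnth e l == tnth e' l) s)%:R = 0.
    by rewrite -(rmorph_nat i); apply: Ei.
  by rewrite mul0r add0r -natrM mulnb andbC.
have /choice[vc hvc] e : exists q, vge (- q) (co e).
  case: (eqVneq (co e) 0) => [->|c0]; first by exists 0; apply: vge0.
  have [|q hq] := @vge_bounded _ _ V (co e)^-1; first by rewrite invr_eq0.
  exists q; apply: contrapT => nq; have := vge_mul_strict V hq nq.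
  by rewrite subrr mulVf.
(* The coefficients [co e] may have negative valuation. This precision absorbs the worst loss and
   leaves a difference of valuation at least 1. *)
pose C := 1 + \sum_e `|vc e|.
have hC e : 1 <= - vc e + C.
  rewrite /C (bigD1 e) //= addrCA lerDl addrA; apply: addr_ge0.
    by rewrite addrC subr_ge0 ler_norm.
  by apply: sumr_ge0 => e' _; apply: normr_ge0.
have [y' hy'] := @dense_image F G K iG i F0 Gc Kc K0 (tvar a) M yG (rank_poly a) w vge th
  V vi th0 (vlast x0) w0 spec C.
pose v (l : 'I_a) (q : 'I_k) (c : 'I_m) := y' (enum_rank (l, q, c)).
have hU := leibniz_rank k0 n0 Edder co v; rewrite -/R in hU; set U := finfun _ in hU.
have UE t : pt U t = \sum_e co e * apply_all (ders Ed e) (mmap i y' (rank_poly a t)).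
  by rewrite /pt ffunE; apply: eq_bigr => e _; rewrite rank_polyE.
(* U has rank at most R over K, not over F; the formal identity of [rank_poly_vanish] applies to it
   all the same. *)
have fU : mmap i (pt U) f = 0.
  have [W [hW eW]] := hU; have /choice[z hz] := hW.
  pose zz (j : 'I_(tvar R)) := let: (l, q, c) := enum_val j in z l q c.
  have -> : mmap i (pt U) f = mmap i (fun t => mmap i zz (rank_poly R t)) f.
    apply: mmap_ext => t; rewrite rank_polyE /pt eW sum_ffunE; apply: eq_bigr => l _.
    by rewrite hz ffunE; apply: eq_bigr => q _; rewrite /zz enum_rankK.
  by rewrite mmap_mmap rank_poly_vanish // rmorph0.
have wE t : w t = \sum_e i (pt (phi (unit_ten e)) t) * mono e by rewrite /w phi_polyE.
have phiE t : i (pt (phi T) t) = \sum_e co e * apply_all (ders Ed e) (w t).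
  rewrite phi_coord rmorph_sum; apply: eq_bigr => e _.
  rewrite wE apply_all_sum; last exact: dersn.
  rewrite (bigD1 e) //= big1 ?addr0 => [|e' ne].
    rewrite apply_all_scale => [|l lt]; last by split; [apply: dersn|apply: dersc].
    rewrite ders_mono eqxx mul1r /co rmorphM.
    by rewrite mulrA [X in _ = X * _]mulrAC mulfVK.
  rewrite apply_all_scale => [|l lt]; last by split; [apply: dersn|apply: dersc].
  by rewrite ders_mono eq_sym (negbTE ne) mul0r mulr0.
have close t : vge 1 (pt U t - i (pt (phi T) t)).
  rewrite UE phiE -sumrB; apply: (vge_sum V) => e _; rewrite -mulrBr.
  have -> : apply_all (ders Ed e) (mmap i y' (rank_poly a t)) - apply_all (ders Ed e) (w t) =
      apply_all (ders Ed e) (mmap i y' (rank_poly a t) - w t).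
    have := apply_all_sum [:: mmap i y' (rank_poly a t) - w t; w t] id (dersn e).
    by rewrite !big_cons !big_nil !addr0 subrK => ->; rewrite addrK.
  apply: (vge_le V (hC e)); apply: (vgeM V (hvc e)).
  by apply: apply_all_vge => [l b lt|]; [apply: dersv|apply: hy'].
have vphi t : vge 0 (i (pt (phi T) t)) := vi _.
have cong t : vcong vge 1 (pt U t) (i (pt (phi T) t)).
  split=> //; rewrite -[pt U t](subrK (i (pt (phi T) t))); apply: (vgeD V) => //.
  by apply: (vge_le V _ (close t)).
have [_ _] := vcong_mmap V v1 f vi cong.
rewrite fU sub0r => /(vgeN V vm1); rewrite opprK.
have -> : mmap i (fun t => i (pt (phi T) t)) f = i (mmap idfun (pt (phi T)) f).
  rewrite /mmap rmorph_sum; apply: eq_bigr => mm _; rewrite rmorphM /mmap1 rmorph_prod.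
  by congr (_ * _); apply: eq_bigr => t _; rewrite rmorphXn.
(* The value of f at phi(T) lies in F and has valuation at least 1, hence is 0. *)
exact: vi0.
Qed.
End Transfer.

Lemma pchar0_char0 (F : fieldType) : [pchar F] =i pred0 -> char0 F.
Proof. by move=> /pcharf0P h l; rewrite h. Qed.

Lemma closed_alg_closed (F : closedFieldType) : alg_closed F.
Proof. by move=> p /closed_rootP. Qed.

Theorem theorem7p8 (F : closedFieldType) (hF : [pchar F] =i pred0)
    (n m d k : nat) (hn : (1 <= n)%N) (hm : (1 <= m)%N) (hd : (1 <= d)%N)
    (hk : (1 <= k)%N) (phi : {linear Ten F n d -> Ten F m k})
    (ha : (1 <= rank_one_brk_max phi)%N) :
  Bpot phi <= (k ^ d * n ^ ((k - 1) * d %/ k))%:R.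
Proof.
have le_a s : decomposable s -> brk_le (rank_one_brk_max phi) (phi s).
  (* The maximum is over nonzero s, whereas [transfer] asks for every decomposable tensor, 0
     included; phi(0) = 0 has rank 0. *)
  move=> ds; case: (eqVneq s 0) => [->|s0].
    rewrite linear0; apply: (brk_leW hk (leq0n _)).
    by apply: trank_brk_le; apply: trank_le0.
  apply: (brk_leW hk _ (brkP hk (T := phi s))); apply: supnat_ge; last exact: brk_max.
  by exists s.
have F0 := pchar0_char0 hF; have Fc := @closed_alg_closed F.
rewrite /Bpot ler_pdivrMr ?ltr0n // -natrM ler_nat mulnC.
apply: supnat_le => _ [T <-]; apply: brk_min => //.
exact: transfer Fc F0 hn hk hd le_a T.
Qed.
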